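(* Let $G$ be a non-solvable generalized Baumslag-Solitar group, let $\Phi\in\mathrm{Out}(G)$ and let $f:T\to T$ be a train track representative for $\Phi$. Let $\psi\in\mathrm{Aut}(G)$ be such that $\psi\in\Phi^k$ for some integer $k\ge1$. If $G_\psi$ contains a loxodromic element, then there exists a periodic indivisible Nielsen path $\eta\subset T$ for $f$ such that $$G_\psi\subset\mathrm{Stab}(VY(\eta)).$$ Moreover, for any periodic indivisible Nielsen path $\eta$ for $f$ such that $\mathrm{Stab}(VY(\eta))$ contains a loxodromic element, there exist $k\ge1$ and $\psi\in\Phi^k$ such that $\mathrm{Stab}(VY(\eta))=G_\psi$.
   Context: A generalized Baumslag-Solitar (GBS) group is the fundamental group of a finite graph of groups whose vertex and edge groups are all infinite cyclic. It is non-solvable if it is isomorphic to none of $\mathbb Z$, $\mathbb Z^2$, the Klein bottle group, $\mathrm{BS}(1,n)=\langle a,t\mid tat^{-1}=a^n\rangle$ ($n\in\mathbb Z\setminus\{0\}$). For such $G$, $\mathcal D$ is the set of minimal simplicial metric $G$-trees with infinite cyclic vertex and edge stabilizers, up to equivariant isometry and homothety. An element $g\in G$ is loxodromic if it fixes no point in some (equivalently every) $T\in\mathcal D$. Pseudo-periodic subgroup. For $\psi\in\mathrm{Aut}(G)$, $G_\psi=\{g\in G: (d_T( *,\psi^n(g)* ))_{n\in\mathbb N}\text{ is bounded}\}$, where $T\in\mathcal D$ and $*\in T$; it is a subgroup independent of $T$ and $*$. Train tracks. Let $T\in\mathcal D$. A map $f:T\to T$ represents $\phi\in\mathrm{Aut}(G)$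 if $f(gx)=\phi(g)f(x)$ for all $g\in G,x\in T$; maps send vertices to vertices and edges to non-backtracking edge paths. A turn is an unordered pair of distinct edges $\{e,e'\}$ with the same origin; it is illegal if for some $n\ge1$ the paths $f^n(e),f^n(e')$ have a common initial segment of positive length, and legal otherwise. A non-backtracking path is legal if all turns it crosses are legal. $f$ is a train track map if $f(e)$ is legal for every edge $e$. A train track representative of $\Phi$ is a train track map representing some $\phi\in\Phi$. The transition matrix $A(f)$ has as $(i,j)$ entry the number of edges in the orbit of $e_i$ in $f(e_j)$ (regardless of orientation), where $e_1,\dots,e_n$ represent the $G$-orbits of unoriented edges. Convention: $A(f)$ is irreducible, and the metric on $T$ is chosen so that $f$ stretches every edge uniformly by the same factor $\lambda$ (the Perron-Frobenius eigenvalue of $A(f)$), with $\lambda>1$. Nielsen paths. A periodic Nielsen path is a nondegenerate geodesic segment $\gamma\subset T$ (endpoints need not be vertices) such that for some $n\ge1$, $h\in G$, the map $h^{-1}f^n$ fixes both endpoints of $\gamma$. It is a periodic indivisible Nielsen path (pINP) if it is not a concatenation, without backtracking, of two shorter periodic Nielsen paths. For a pINP $\eta=[x_0,x_1]$, the Nielsen class $VY(\eta)$ is the set of $y\in T$ for which there are $x_0=y_0,y_1,\dots,y_n=y$ such that each $[y_{i-1},y_i]$ is a pINP. $\mathrm{Stab}(VY(\eta))=\{g\in G: gVY(\eta)=VY(\eta)\}$. *)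

(* Defs.v *)
From HB Require Import structures.
From mathcomp Require Import all_boot all_order all_algebra.
From mathcomp Require Import all_classical all_reals all_analysis.

Set Implicit Arguments.
Unset Strict Implicit.
Unset Printing Implicit Defensive.

Import Order.TTheory GRing.Theory Num.Theory.

Local Open Scope classical_set_scope.
Local Open Scope ring_scope.

(** * Groups *)

Definition expgz (G : groupType) (x : G) (n : int) : G :=
  match n with
  | Posz k => (x ^+ k)%g
  | Negz k => (x ^- k.+1)%g
  end.

Definition group_hom (G H : groupType) (f : G -> H) : Prop :=
  {morph f : x y / (x * y)%g >-> (x * y)%g}.

Definition automorphism (G : groupType) (psi : G -> G) : Prop :=
  group_hom psi /\ bijective psi.

(* [S] is the image of an injective homomorphism from the additive group of
   integers, i.e. an infinite cyclic subgroup of [G]. *)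
Definition infinite_cyclic (G : groupType) (S : set G) : Prop :=
  exists f : int -> G,
    [/\ {morph f : m n / m + n >-> (m * n)%g}, injective f & range f = S].

(* [G] is the group presented by generators [X] and relations [rels]: it
   carries a tuple of elements indexed by [X] satisfying the relations and is
   universal among groups carrying such a tuple. *)
Definition presented_by (X : Type)
    (rels : forall H : groupType, (X -> H) -> Prop) (G : groupType) : Prop :=
  exists gen : X -> G, rels G gen /\
    forall (H : groupType) (h : X -> H), rels H h ->
      exists! F : G -> H, group_hom F /\ F \o gen = h.

Definition is_Z (G : groupType) : Prop :=
  exists f : int -> G, {morph f : m n / m + n >-> (m * n)%g} /\ bijective f.

Definition is_Z2 (G : groupType) : Prop :=
  exists f : int * int -> G,
    {morph f : m n / m + n >-> (m * n)%g} /\ bijective f.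

(* The two generators of the presentations below are indexed by [bool]:
   a is [h true] and t is [h false]. *)
Definition is_BS1 (n : int) (G : groupType) : Prop :=
  presented_by (fun (H : groupType) (h : bool -> H) =>
    (h false * h true * (h false)^-1)%g = expgz (h true) n) G.

Definition is_Klein_bottle (G : groupType) : Prop :=
  presented_by (fun (H : groupType) (h : bool -> H) =>
    (h false * h true * (h false)^-1)%g = ((h true)^-1)%g) G.

Definition non_solvable_GBS (G : groupType) : Prop :=
  [/\ ~ is_Z G, ~ is_Z2 G, ~ is_Klein_bottle G
    & forall n : int, n != 0 -> ~ is_BS1 n G].

(** * Finite graphs of groups *)

(* Each geometric edge [e] carries one chosen orientation, from [gg_orig e] to
   [gg_term e], and one edge group with its two monomorphisms. *)
Record graph_of_groups := GraphOfGroups {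
  gg_vert : finType;
  gg_edge : finType;
  gg_orig : gg_edge -> gg_vert;
  gg_term : gg_edge -> gg_vert;
  gg_vgrp : gg_vert -> groupType;
  gg_egrp : gg_edge -> groupType;
  gg_iorig : forall e, gg_egrp e -> gg_vgrp (gg_orig e);
  gg_iterm : forall e, gg_egrp e -> gg_vgrp (gg_term e);
  gg_iorig_hom : forall e, group_hom (@gg_iorig e);
  gg_iterm_hom : forall e, group_hom (@gg_iterm e);
  gg_iorig_inj : forall e, injective (@gg_iorig e);
  gg_iterm_inj : forall e, injective (@gg_iterm e)
}.

Definition gg_adj (Y : graph_of_groups) (S : {set gg_edge Y}) :
    rel (gg_vert Y) :=
  fun u v => [exists e in S,
    ((gg_orig e == u) && (gg_term e == v)) ||
    ((gg_orig e == v) && (gg_term e == u))].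

(* A spanning tree is connected and contains no cycle: removing any of its
   edges disconnects the endpoints of that edge (this excludes loops). *)
Definition spanning_tree (Y : graph_of_groups) (S : {set gg_edge Y}) : Prop :=
  [/\ (0 < #|gg_vert Y|)%N,
      forall u v, connect (gg_adj S) u v
    & forall e, e \in S ->
        ~~ connect (gg_adj (S :\ e)%SET) (gg_orig e) (gg_term e)].

Definition gg_generator (Y : graph_of_groups) : Type :=
  ({v : gg_vert Y & gg_vgrp v} + gg_edge Y)%type.

(* The fundamental group with respect to a spanning tree [S]: generated by the
   vertex groups and one stable letter t_e per edge, subject to the relations
   of the vertex groups, t_e c t_e^-1 = c for c in the edge group (pushed to
   the terminal, resp. original, vertex group), and t_e = 1 for e in [S]. *)
Definition pi1_relations (Y : graph_of_groups) (S : {set gg_edge Y})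
    (H : groupType) (h : gg_generator Y -> H) : Prop :=
  let vtx v (a : gg_vgrp v) := h (inl (existT _ v a)) in
  let stable e := h (inr e) in
  [/\ forall v, group_hom (vtx v),
      forall e (c : gg_egrp e),
        (stable e * vtx _ (gg_iterm c) * (stable e)^-1)%g = vtx _ (gg_iorig c)
    & forall e, e \in S -> stable e = 1%g].

Definition GBS_group (G : groupType) : Prop :=
  exists (Y : graph_of_groups) (S : {set gg_edge Y}),
    [/\ forall v, is_Z (gg_vgrp (g := Y) v),
        forall e, is_Z (gg_egrp (g := Y) e),
        spanning_tree S
      & presented_by (@pi1_relations Y S) G].

(** * Outer automorphisms *)

(* An element of Out(G) is a coset of Inn(G) in Aut(G). *)
Definition inner (G : groupType) : set (G -> G) :=
  [set psi | exists g, psi = fun x => (g * x * g^-1)%g].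

Definition outer_class (G : groupType) (Phi : set (G -> G)) : Prop :=
  exists phi, automorphism phi /\
    Phi = [set i \o phi | i in @inner G].

Fixpoint outer_pow (G : groupType) (Phi : set (G -> G)) (k : nat) :
    set (G -> G) :=
  match k with
  | 0 => @inner G
  | k'.+1 =>
      [set psi | exists phi psi', Phi phi /\ outer_pow Phi k' psi' /\
                   psi = phi \o psi']
  end.

(** * Metric simplicial trees *)

Section MetricTrees.
Variables (R : realType) (X : metricType R).
Implicit Types x y z : X.

Definition geodesic x y (c : R -> X) : Prop :=
  [/\ c 0 = x, c (mdist x y) = y
    & forall s t, 0 <= s <= mdist x y -> 0 <= t <= mdist x y ->
        mdist (c s) (c t) = `|s - t|].

(* When geodesics exist and are unique, this is the image of the geodesic
   from [x] to [y]. *)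
Definition seg x y : set X := [set z | mdist x z + mdist z y = mdist x y].

Definition real_tree : Prop :=
  [/\ forall x y, exists c, geodesic x y c,
      forall x y c c', geodesic x y c -> geodesic x y c' ->
        forall s, 0 <= s <= mdist x y -> c s = c' s
    & forall x y z, seg y x `&` seg x z = [set x] ->
        seg y x `|` seg x z = seg y z].

Variable V : set X.

(* A tree has no multiple edges, so an oriented edge is the pair of its
   endpoints: two distinct vertices with no vertex strictly between them. *)
Definition edge u v : Prop :=
  [/\ V u, V v, u <> v & V `&` seg u v = [set u; v]].

(* Metric realizations (with the path metric) of simplicial trees whose edges
   are given positive lengths, as real trees with a distinguished vertex set:
   any two points are joined through finitely many vertices, the space is the
   union of its vertices and closed edges, and distinct edges meet only at
   vertices. *)
Definition simplicial_tree : Prop :=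
  [/\ real_tree, V !=set0,
      forall x y, finite_set (V `&` seg x y),
      forall x, V x \/ exists u v, edge u v /\ seg u v x
    & forall u v u' v' x, edge u v -> edge u' v' ->
        seg u v x -> seg u' v' x -> ~ V x ->
        (u = u' /\ v = v') \/ (u = v' /\ v = u')].

End MetricTrees.

(** * G-trees *)

Record gTree (R : realType) (G : groupType) := GTree {
  gt_space :> metricType R;
  gt_vert : set gt_space;
  gt_act : G -> gt_space -> gt_space
}.

Section GTrees.
Variables (R : realType) (G : groupType) (T : gTree R G).
Implicit Types (x y u v : T) (g h : G).

Notation V := (@gt_vert R G T).
Notation act := (@gt_act R G T).
Notation edge := (edge V).

(* Actions by isometric simplicial automorphisms, without inversions. *)
Definition simplicial_action : Prop :=
  [/\ forall x, act 1%g x = x,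
      forall g h x, act (g * h)%g x = act g (act h x),
      forall g x y, mdist (act g x) (act g y) = mdist x y,
      forall g v, V v -> V (act g v)
    & forall g u v, edge u v -> ~ (act g u = v /\ act g v = u)].

Definition minimal_action : Prop :=
  forall Y : set T, Y !=set0 ->
    (forall x y, Y x -> Y y -> seg x y `<=` Y) ->
    (forall g x, Y x -> Y (act g x)) ->
    Y = setT.

(* [T] represents a point of the set D of minimal simplicial metric G-trees
   with infinite cyclic vertex and edge stabilizers. *)
Definition in_D : Prop :=
  [/\ simplicial_tree V, simplicial_action, minimal_action,
      forall v, V v -> infinite_cyclic [set g | act g v = v]
    & forall u v, edge u v ->
        infinite_cyclic [set g | act g u = u /\ act g v = v]].

Definition pseudo_periodic (pt : T) (psi : G -> G) : set G :=
  [set g | exists M : R, forall n : nat,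
             mdist pt (act (iter n psi g) pt) <= M].

Definition represents (f : T -> T) (phi : G -> G) : Prop :=
  forall g x, f (act g x) = act (phi g) (f x).

(* [f] maps vertices to vertices, and each edge [u, v], with all lengths
   multiplied by [lam] > 0, onto a segment from f u to f v, i.e. onto a
   non-backtracking edge path. *)
Definition uniform_tree_map (lam : R) (f : T -> T) : Prop :=
  (forall v, V v -> V (f v)) /\
  (forall u v x y, edge u v -> seg u v x -> seg u v y ->
     mdist (f x) (f y) = lam * mdist x y).

Definition turn v u u' : Prop := [/\ edge v u, edge v u' & u <> u'].

(* Since [f] stretches all edges by the same factor, the paths f^n([v, u]) and
   f^n([v, u']) have a common initial segment iff f^n identifies the points of
   [v, u] and [v, u'] at distance s from [v], for all small s. *)
Definition illegal_turn (f : T -> T) v u u' : Prop :=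
  turn v u u' /\
  exists n : nat, (0 < n)%N /\
  exists delta : R, 0 < delta /\
    forall p p', seg v u p -> seg v u' p' ->
      mdist v p = mdist v p' -> mdist v p <= delta ->
      iter n f p = iter n f p'.

(* The segment [x, y] crosses the turn at [v] formed by the edges [v, u] and
   [v, u'] when it contains an initial segment of both. *)
Definition crosses x y v u u' : Prop :=
  [/\ turn v u u',
      exists p, [/\ p <> v, seg v u p & seg v p `<=` seg x y]
    & exists p', [/\ p' <> v, seg v u' p' & seg v p' `<=` seg x y]].

Definition legal_segment (f : T -> T) x y : Prop :=
  forall v u u', crosses x y v u u' -> ~ illegal_turn f v u u'.

Definition same_edge_orbit (e e' : T * T) : Prop :=
  exists g, (act g e.1 = e'.1 /\ act g e.2 = e'.2) \/
            (act g e.1 = e'.2 /\ act g e.2 = e'.1).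

Definition edge_orbit_representatives (n : nat) (e : 'I_n -> T * T) : Prop :=
  (forall i, edge (e i).1 (e i).2) /\
  (forall u v, edge u v -> exists! i, same_edge_orbit (e i) (u, v)).

(* The edges of the path f(e), oriented along the path, lying in the orbit of
   e'; orienting them makes each geometric edge count once. *)
Definition image_edges (f : T -> T) (e' e : T * T) : set (T * T) :=
  [set p | [/\ edge p.1 p.2,
               seg (f e.1) (f e.2) p.1, seg (f e.1) (f e.2) p.2,
               mdist (f e.1) p.1 < mdist (f e.1) p.2
             & same_edge_orbit e' p]].

Definition transition_matrix (f : T -> T) (n : nat) (e : 'I_n -> T * T)
    (A : 'M[R]_n) : Prop :=
  forall i j, exists k : nat,
    (image_edges f (e i) (e j) #= `I_k)%card /\ A i j = k%:R.

Definition irreducible_matrix (n : nat) (A : 'M[R]_n) : Prop :=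
  forall i j, exists m : nat, (0 < m)%N /\ 0 < (A ^+ m) i j.

(* For an irreducible nonnegative matrix, the only eigenvalue with a positive
   eigenvector. *)
Definition Perron_Frobenius_eigenvalue (n : nat) (A : 'M[R]_n) (lam : R) :
    Prop :=
  exists v : 'rV[R]_n, (forall i, 0 < v 0 i) /\ v *m A = lam *: v.

(* Includes the standing convention: A(f) irreducible, uniform stretching by
   its Perron-Frobenius eigenvalue, which is > 1. *)
Definition train_track_map (f : T -> T) : Prop :=
  (exists (lam : R) (n : nat) (e : 'I_n -> T * T) (A : 'M[R]_n),
     [/\ 1 < lam, uniform_tree_map lam f, edge_orbit_representatives e,
         transition_matrix f e A
       & irreducible_matrix A /\ Perron_Frobenius_eigenvalue A lam]) /\
  (forall u v, edge u v -> legal_segment f (f u) (f v)).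

Definition train_track_representative (Phi : set (G -> G)) (f : T -> T) :
    Prop :=
  train_track_map f /\ exists phi, Phi phi /\ represents f phi.

Definition periodic_Nielsen (f : T -> T) x y : Prop :=
  x <> y /\
  exists (n : nat) h, (0 < n)%N /\
    act (h^-1)%g (iter n f x) = x /\ act (h^-1)%g (iter n f y) = y.

Definition pINP (f : T -> T) x y : Prop :=
  periodic_Nielsen f x y /\
  ~ exists z, [/\ seg x y z, periodic_Nielsen f x z & periodic_Nielsen f z y].

(* VY([x0, x1]). It only mentions x0; when [x0, x1] is a pINP, starting from
   x1 gives the same set. *)
Definition Nielsen_class (f : T -> T) x0 : set T :=
  [set y | exists (n : nat) (z : nat -> T),
     [/\ z 0%N = x0, z n = y
       & forall i, (i < n)%N -> pINP f (z i) (z i.+1)]].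

Definition set_stabilizer (Y : set T) : set G := [set g | act g @` Y = Y].

End GTrees.

Definition loxodromic (R : realType) (G : groupType) (g : G) : Prop :=
  exists T : gTree R G, in_D T /\ forall x : T, gt_act g x <> x.

(* Main.v *)
(* Elements fixing a point of a tree in D have the same nonzero powers up to
   conjugation, an intrinsic property, and conversely such an element fixes a point of
   every tree of D because the train track tree is not a line. Hence loxodromic elements
   and, through equivariant Lipschitz maps, boundedness of orbits do not depend on the
   tree.

   If psi = c_u phi^k and g is a loxodromic element of G_psi, then F = u f^k maps the
   axis of psi^n(g) over that of psi^(n+1)(g), so some point x has all its F-iterates
   close to these axes; the distance from F^n(x) to a base point grows at most linearly.
   Points whose iterates stay at linear distance from each other meet each edge at most
   once, since f is expanding on edges, so by local finiteness an iterate of x is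
   periodic modulo G: f^m(x) = h x. For g in G_psi the points x and g x have iterates at
   linear, hence (bounded backtracking) at bounded distance, and the map h^-1 f^m, which
   fixes x, eventually sends g x to a point which it permutes periodically, that is, to a
   point joined to x by a periodic Nielsen path.

   It remains to see that g x itself lies in the Nielsen class of x, i.e. that paths of
   Nielsen paths lift through f. This requires that points identified with x by f lie in
   its class: the automorphism represented by h^-1 f^m may map the stabilizer of x to a
   proper subgroup, and it is a loxodromic element of the stabilizer of the class that
   forces the preimages of this stabilizer to be contained in it. *)
Require Import Defs.
From mathcomp Require Import all_boot all_order all_algebra.
From mathcomp Require Import all_classical all_reals all_analysis.
From mathcomp Require Import ring lra zify.

Set Implicit Arguments.
Unset Strict Implicit.
Unset Printing Implicit Defensive.

Import Order.TTheory GRing.Theory Num.Theory.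
Local Open Scope classical_set_scope.
Local Open Scope ring_scope.

(** * Segments in real trees *)

(** Two growth rates are played against each other: inside an edge f^n stretches by [lam] ^ n, while
    the points to be compared drift apart at most linearly. Linearly, because the tracked point may
    slide along the axes by powers psi^n(g)^k(n); translation lengths are bounded below by the
    shortest edge, so k has bounded increments. Linear distance becomes bounded because a fixed
    chain of edges joins x to y, and the image of each edge under f^n can share only a bounded
    length with [f^n x, f^n y]. Uniform constants come from the finiteness of the set of edge
    orbits: bounds on edge lengths, finite balls, a Lipschitz quasi-inverse of f. For the second
    claim, f^m(x0) = h x0 and psi is the automorphism represented by h^-1 f^m. This map fixes x0, so
    psi^n(g) x0 is the n-th image of g x0, and g is pseudo-periodic exactly when the iterates of x0
    and g x0 stay at bounded distance, the condition that also characterizes the stabilizer of the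
    class. *)

Section Segments.
Variables (R : realType) (X : metricType R).
Implicit Types x y z w : X.
Local Notation d := mdist.

Lemma segE x y z : seg x y z <-> d x z + d z y = d x y.
Proof. by []. Qed.

Lemma segC x y z : seg x y z -> seg y x z.
Proof. by rewrite !segE (metric_sym y x) (metric_sym y z) (metric_sym z x) addrC. Qed.

Lemma segCE x y : seg x y = seg y x.
Proof. by apply/seteqP; split=> z; exact: segC. Qed.

Lemma seg_left x y : seg x y x.
Proof. by rewrite segE mdistxx add0r. Qed.

Lemma seg_right x y : seg x y y.
Proof. by rewrite segE mdistxx addr0. Qed.

Lemma segxx x z : seg x x z -> z = x.
Proof.
rewrite segE (metric_sym z x) mdistxx => h.
by apply/esym/mdist_positivity; have := mdist_ge0 x z; lra.
Qed.

Lemma seg_trans x y z w : seg x y z -> seg x z w -> seg x y w /\ seg w y z.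
Proof.
rewrite !segE => xyz xzw.
have := metric_triangle x w y; have := metric_triangle w z y.
by split; lra.
Qed.

Lemma seg_incl_left x y z : seg x y z -> seg x z `<=` seg x y.
Proof. by move=> xyz w /(seg_trans xyz) []. Qed.

Lemma seg_incl_right x y z : seg x y z -> seg z y `<=` seg x y.
Proof. by move=> /segC/seg_incl_left; rewrite (segCE y z) (segCE y x). Qed.

Lemma mdist_eq0 x y : d x y <= 0 -> x = y.
Proof. by move=> h; apply: mdist_positivity; have := mdist_ge0 x y; lra. Qed.

Lemma seg_join x y z w :
  seg x z y -> seg y w z -> d x y + d y z + d z w <= d x w ->
  seg x w y /\ seg x w z.
Proof.
rewrite !segE => *.
have := metric_triangle x y w; have := metric_triangle x z w.
by have := metric_triangle y z w; split; lra.
Qed.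

Lemma seg_le_left x y z : seg x y z -> d x z <= d x y.
Proof. by rewrite segE => <-; rewrite lerDl mdist_ge0. Qed.

Lemma seg_quad x y z w : seg x y z -> seg x y w ->
  d z w <= d x y.
Proof.
rewrite !segE => h1 h2; have := metric_triangle z x w; have := metric_triangle z y w.
by rewrite (metric_sym z x) (metric_sym y w); lra.
Qed.

End Segments.

Section Trees.
Variables (R : realType) (X : metricType R).
Hypothesis tX : real_tree X.
Implicit Types x y z w : X.
Local Notation d := mdist.

Lemma tree_point x y t : 0 <= t <= d x y -> exists2 z, seg x y z & d x z = t.
Proof.
move=> t01; case: tX => /(_ x y) [c [c0 c1 cd]] _ _; exists (c t).
  have h0 : (0 : R) <= 0 <= d x y by rewrite lexx mdist_ge0.
  have h1 : (0 : R) <= d x y <= d x y by rewrite lexx mdist_ge0.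
  rewrite segE -[in d x (c t)]c0 -[in d (c t) y]c1 !cd //.
  by move: t01 => /andP[t0 t1]; rewrite sub0r normrN ger0_norm // ler0_norm; lra.
have h0 : (0 : R) <= 0 <= d x y by rewrite lexx mdist_ge0.
by rewrite -[in d x (c t)]c0 cd // sub0r normrN ger0_norm //; case/andP: t01.
Qed.

(** Geodesics from x to z and from z to y glue to a geodesic because the lengths add up. This turns
    the uniqueness clause of [real_tree], which is about parametrizations, into a statement about
    the metric intervals [seg]. *)
Lemma geodesic_through x y z : seg x y z ->
  exists2 c : R -> X, geodesic x y c & c (d x z) = z.
Proof.
rewrite segE => xyz; case: tX => geo _ _.
have [c1 [c10 c1z c1d]] := geo x z; have [c2 [c20 c2y c2d]] := geo z y.
have dxz := mdist_ge0 x z; have dzy := mdist_ge0 z y.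
pose c s := if s <= d x z then c1 s else c2 (s - d x z).
have cz : c (d x z) = z by rewrite /c lexx.
exists c => //; split.
- by rewrite /c dxz.
- rewrite /c -xyz; case: ifPn => [h|_]; last by rewrite addrC addKr.
  have e : d z y = 0 by lra.
  by rewrite e addr0 c1z; exact: mdist_positivity.
- have c0 : c 0 = x by rewrite /c dxz.
  have c_1 t : 0 <= t -> t <= d x z -> c t = c1 t by rewrite /c => _ ->.
  have c_2 t : d x z < t -> c t = c2 (t - d x z) by rewrite /c leNgt => ->.
  suff H s t : 0 <= s -> s <= t -> t <= d x y -> d (c s) (c t) = t - s.
    move=> s t /andP[s0 s1] /andP[t0 t1].
    have [st|/ltW ts] := leP s t.
      by rewrite H // distrC ger0_norm //; lra.
    by rewrite metric_sym H // ger0_norm //; lra.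
  move=> s0 st t1; have [tz|zt] := leP t (d x z).
    rewrite !c_1; [|lra..].
    rewrite c1d; [|by apply/andP; split; lra..].
    by rewrite ler0_norm; lra.
  have [sz|zs] := leP s (d x z); last first.
    rewrite !c_2; [|lra..].
    rewrite c2d; [|by apply/andP; split; lra..].
    by rewrite ler0_norm; lra.
  rewrite c_1 // c_2 //; set p := c1 s; set q := c2 _.
  have e1 : d x p = s.
    rewrite /p -c10 c1d ?lexx ?s0 // sub0r normrN ger0_norm //.
  have e2 : d p z = d x z - s.
    by rewrite /p -{1}c1z c1d ?s0 ?sz ?dxz ?lexx // ler0_norm; lra.
  have e3 : d z q = t - d x z.
    rewrite /q -{1}c20 c2d ?lexx ?dzy //; first by rewrite ler0_norm; lra.
    by apply/andP; split; lra.
  have e4 : d q y = d x y - t.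
    rewrite /q -{1}c2y c2d; first by rewrite ler0_norm; lra.
      by apply/andP; split; lra.
    by rewrite dzy lexx.
  have := metric_triangle p z q; have := metric_triangle x p y.
  have := metric_triangle p q y; lra.
Qed.

Lemma seg_uniq x y z w : seg x y z -> seg x y w -> d x z = d x w -> z = w.
Proof.
move=> xyz xyw e; case: tX => _ uniq _.
have [c1 g1 e1] := geodesic_through xyz; have [c2 g2 e2] := geodesic_through xyw.
rewrite -e1 -e2 -e; apply: (uniq _ _ _ _ g1 g2).
by rewrite mdist_ge0 seg_le_left.
Qed.

Lemma seg_order x y z w : seg x y z -> seg x y w -> d x z <= d x w ->
  seg x w z /\ seg z y w.
Proof.
move=> xyz xyw le; have [u xwu eu] : exists2 u, seg x w u & d x u = d x z.
  by apply: tree_point; rewrite mdist_ge0.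
have [xyu uyw] := seg_trans xyw xwu.
by rewrite -(seg_uniq xyu xyz eu).
Qed.

Lemma seg_mdist x y z w : seg x y z -> seg x y w -> d x z <= d x w ->
  d z w = d x w - d x z.
Proof.
by move=> xyz xyw le; have [/segE <- _] := seg_order xyz xyw le; rewrite addrC addKr.
Qed.

Lemma seg_convex x y z w : seg x y z -> seg x y w -> seg z w `<=` seg x y.
Proof.
wlog le : z w / d x z <= d x w.
  move=> H xyz xyw; have [le|/ltW le] := leP (d x z) (d x w); first exact: H.
  by rewrite segCE; apply: H.
move=> xyz xyw u zwu; have [xwz zyw] := seg_order xyz xyw le.
by apply: (seg_incl_left xyw); apply: (seg_incl_right xwz).
Qed.

Lemma seg_concat x y z : seg x y `&` seg x z = [set x] -> seg y z x.
Proof.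
rewrite segCE => h; case: tX => _ _ /(_ x y z h) <-.
by left; exact: seg_right.
Qed.

(** m is the last point common to [x, y] and [x, z]; the supremum is attained because the condition
    defining [seg] is closed. Past m the two segments share nothing, so the third clause of
    [real_tree] joins them. *)
Lemma tree_median x y z : exists m, [/\ seg x y m, seg x z m & seg y z m].
Proof.
pose S := [set t : R | exists w, [/\ seg x y w, seg x z w & d x w = t]].
have S0 : S 0 by exists x; rewrite mdistxx; split=> //; exact: seg_left.
have Sub : ubound S (d x y) by move=> t [w [xyw _ <-]]; exact: seg_le_left.
have Ssup : has_sup S by split; [exists 0|exists (d x y)].
have sup0 : 0 <= sup S by apply: ub_le_sup => //; exists (d x y).
have sup1 : sup S <= d x y by apply: ge_sup => //; exists 0.
have [m xym em] : exists2 m, seg x y m & d x m = sup S.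
  by apply: tree_point; rewrite sup0.
have xzm : seg x z m.
  rewrite segE; apply/eqP; rewrite eq_le metric_triangle andbT.
  apply/ler_addgt0Pr => e e0.
  have [_ [w [xyw xzw <-]] lw] := sup_adherent (divr_gt0 e0 (ltr0Sn R 1)) Ssup.
  have lew : d x w <= d x m by rewrite em; apply: ub_le_sup; [exists (d x y)|exists w].
  have := seg_mdist xyw xym lew; have := metric_triangle m w z.
  by rewrite (metric_sym m w); move: xzw; rewrite segE -em in lw *; lra.
exists m; split=> //; apply: seg_concat.
apply/seteqP; split=> [w [myw mzw]|w ->]; last by split; exact: seg_left.
have xyw := seg_incl_right xym myw; have xzw := seg_incl_right xzm mzw.
apply/esym/mdist_eq0.
have : d x w <= d x m by rewrite em; apply: ub_le_sup; [exists (d x y)|exists w].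
move: myw xyw xym; rewrite !segE.
have := metric_triangle x m w; lra.
Qed.

Lemma seg_union x y z w : seg x z w -> seg x y w \/ seg y z w.
Proof.
move=> xzw; have [m [xym xzm yzm]] := tree_median x y z.
have [le|/ltW le] := leP (d x w) (d x m).
  by have [xmw _] := seg_order xzw xzm le; left; exact: seg_incl_left xym _ xmw.
have [_ mzw] := seg_order xzm xzw le.
by right; exact: seg_incl_right yzm _ mzw.
Qed.

Lemma four_point x y z w :
  d x y + d z w <= d x z + d y w \/ d x y + d z w <= d x w + d y z.
Proof.
have [m [xym xzm yzm]] := tree_median x y z.
case: (seg_union w xym) => h; [right|left]; move: xym xzm yzm h; rewrite !segE;
  have := metric_triangle z m w; rewrite ?(metric_sym m z) ?(metric_sym m w) ?(metric_sym y m) ?(metric_sym w y); lra.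
Qed.

Lemma seg_proj x y z : exists2 m, seg x y m &
  forall w, seg x y w -> seg z w m.
Proof.
have [m [zxm zym xym]] := tree_median z x y; exists m => // w xyw.
have [le|/ltW le] := leP (d x w) (d x m).
  have [xmw _] := seg_order xyw xym le.
  have := seg_trans (segC zxm) xmw.
  by case=> _ /segC.
have [_ myw] := seg_order xym xyw le.
by have [_ /segC] := seg_trans (segC zym) (segC myw).
Qed.

(** Local geodesics are global: a nondegenerate overlap [y, z] excludes the first alternative of the
    four-point condition, and the second one says that lengths add up. *)
Lemma seg_concat_near x y z w : seg x z y -> seg y w z -> y <> z ->
  seg x w y /\ seg x w z.
Proof.
move=> xzy ywz yz; apply: seg_join => //.
move: xzy ywz; rewrite !segE.
have yz0 : 0 < d y z by rewrite mdist_gt0; apply/eqP.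
by case: (four_point x z y w); rewrite ?(metric_sym z y); lra.
Qed.

(** [a, q] passes through p and [p, b] through q, so these two segments overlap in the nondegenerate
    [p, q] and concatenate. *)
Lemma proj_bridge x y a b p q : seg x y p -> seg x y q ->
  (forall w, seg x y w -> seg a w p) -> (forall w, seg x y w -> seg b w q) ->
  p <> q -> [/\ seg a b p, seg a b q & d a b = d a p + d p q + d q b].
Proof.
move=> xyp xyq ap bq pq.
have [] := seg_concat_near (ap _ xyq) (segC (bq _ xyp)) pq.
move=> h1 h2; split=> //; move: h1 (bq _ xyp); rewrite !segE.
by rewrite (metric_sym b p) (metric_sym q p) (metric_sym b q); lra.
Qed.

End Trees.

(** * Lipschitz maps and chains of segments in trees *)

Section TreeMaps.
Variables (R : realType) (X : metricType R).
Hypothesis tX : real_tree X.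
Implicit Types x y z w p : X.
Local Notation d := mdist.

(** A path in a tree cannot jump over p. At the first z for which [h x, h z] contains p, one has h z
    = p: otherwise a point slightly before z would have the same property. *)
Lemma seg_IVT (h : X -> X) (K : R) x y p : 0 < K ->
  (forall a b, d (h a) (h b) <= K * d a b) ->
  seg (h x) (h y) p -> exists2 z, seg x y z & h z = p.
Proof.
move=> K0 hK hp.
pose S := [set t : R | exists z, [/\ seg x y z, seg (h x) (h z) p & d x z = t]].
have Sinf : has_inf S.
  split; first by exists (d x y), y; split=> //; exact: seg_right.
  by exists 0 => _ [z [_ _ <-]]; exact: mdist_ge0.
have i0 : 0 <= inf S.
  by apply: lb_le_inf => //; [case: Sinf|move=> _ [z [_ _ <-]]; exact: mdist_ge0].
have i1 : inf S <= d x y.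
  by apply: ge_inf; [case: Sinf|exists y; split=> //; exact: seg_right].
have [z xyz ez] : exists2 z, seg x y z & d x z = inf S.
  by apply: tree_point => //; rewrite i0.
exists z => //.
have hz : seg (h x) (h z) p.
  rewrite segE; apply/eqP; rewrite eq_le metric_triangle andbT.
  apply/ler_addgt0Pr => e e0.
  have e20 : 0 < e / (2 * K) by rewrite divr_gt0 // mulr_gt0.
  have [_ [w [xyw hw <-]] lw] := inf_adherent e20 Sinf.
  have lew : d x z <= d x w.
    by rewrite ez; apply: ge_inf; [case: Sinf|exists w].
  have dzw : d z w <= e / (2 * K) by rewrite (seg_mdist tX xyz xyw lew) ez; lra.
  have : d (h z) (h w) <= e / 2.
    apply: le_trans (hK _ _) _.
    have -> : e / 2 = K * (e / (2 * K)) by field; rewrite gt_eqF.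
    by rewrite ler_pM2l.
  move: hw; rewrite segE.
  have := metric_triangle p (h w) (h z); have := metric_triangle (h x) (h z) (h w).
  by rewrite (metric_sym (h w) (h z)); lra.
apply/esym/mdist_positivity/eqP; rewrite eq_le mdist_ge0 andbT leNgt; apply/negP => r0.
have [t0|t0] := leP (d x z) 0.
  have xz := mdist_eq0 t0; move: hz r0; rewrite -xz => /segxx ->.
  by rewrite mdistxx ltxx.
(* Going back by this amount moves the image by at most half of its distance to p, hence not across
   p. *)
pose t := Num.max 0 (d x z - d p (h z) / (2 * K)).
have tz : t < d x z by rewrite gt_max t0 /= ltrBlDr ltrDl divr_gt0 // mulr_gt0.
have [w xzw ew] : exists2 w, seg x z w & d x w = t.
  by apply: tree_point; rewrite // le_max lexx (ltW tz).
have dwz : d w z <= d p (h z) / (2 * K).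
  have : d x z - d p (h z) / (2 * K) <= t by rewrite le_max lexx orbT.
  by move: xzw; rewrite segE; lra.
have hwz : d (h w) (h z) <= d p (h z) / 2.
  apply: le_trans (hK _ _) _.
  have -> : d p (h z) / 2 = K * (d p (h z) / (2 * K)) by field; rewrite gt_eqF.
  by rewrite ler_pM2l.
case: (seg_union tX (h w) hz) => [hw|/segC/seg_le_left].
  have : inf S <= t.
    apply: ge_inf; first by case: Sinf.
    by exists w; split=> //; exact: seg_incl_left xyz _ xzw.
  by rewrite -ez leNgt tz.
by rewrite metric_sym (metric_sym (h z)) => ?; lra.
Qed.

(** The cluster point is placed at the limit superior of the distances d x (u n); a point of a
    segment is determined by its distance to x. *)
Lemma seg_cluster x y (u : nat -> X) : (forall n, seg x y (u n)) ->
  exists z, forall e : R, 0 < e -> forall N, exists2 n, (N <= n)%N & d z (u n) < e.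
Proof.
move=> xyu.
pose A := [set t : R | forall N, exists2 n, (N <= n)%N & t <= d x (u n)].
have A0 : A 0 by move=> N; exists N => //; exact: mdist_ge0.
have Aub : ubound A (d x y).
  move=> t /(_ 0%N) [n _ tn]; exact: le_trans tn (seg_le_left (xyu n)).
have Asup : has_sup A by split; [exists 0|exists (d x y)].
have [z xyz ez] : exists2 z, seg x y z & d x z = sup A.
  apply: tree_point => //; apply/andP; split.
    by apply: ub_le_sup => //; exists (d x y).
  by apply: ge_sup => //; exists 0.
exists z => e e0 N.
have [a Aa la] := sup_adherent e0 Asup.
have nA : ~ A (sup A + e / 2).
  move=> h; have : sup A + e / 2 <= sup A by apply: ub_le_sup => //; exists (d x y).
  by lra.
have [N0 hN0] : exists N0, forall n, (N0 <= n)%N -> d x (u n) < sup A + e / 2.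
  apply: contrapT => h; apply: nA => M; apply: contrapT => h'; apply: h.
  exists M => n Mn; rewrite ltNge; apply/negP => h2; apply: h'; by exists n.
have [n nN an] := Aa (maxn N N0).
exists n; first by rewrite (leq_trans _ nN) // leq_maxl.
have := hN0 n; rewrite (leq_trans _ nN) ?leq_maxr // => /(_ isT) nu.
have [le|/ltW le] := leP (d x z) (d x (u n)).
  by rewrite (seg_mdist tX xyz (xyu n) le) ez; lra.
by rewrite metric_sym (seg_mdist tX (xyu n) xyz le) ez; lra.
Qed.

Lemma seg_chain (u : nat -> X) m n z : (m <= n)%N -> seg (u m) (u n) z -> z <> u m ->
  exists2 i, (m <= i < n)%N & seg (u i) (u i.+1) z.
Proof.
elim: n => [|n IH]; first by rewrite leqn0 => /eqP -> /segxx.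
rewrite leq_eqVlt => /orP[/eqP <- /segxx //|]; rewrite ltnS => mn.
move=> /(seg_union tX (u n)) [h|h] zm.
  by have [i /andP[mi ni] hi] := IH mn h zm; exists i => //; rewrite mi ltnW.
by exists n => //; rewrite mn leqnn.
Qed.

Lemma mdist_chain (u : nat -> X) (K : R) n :
  (forall i, (i < n)%N -> d (u i) (u i.+1) <= K) -> d (u 0%N) (u n) <= n%:R * K.
Proof.
elim: n => [|n IH] h; first by rewrite mdistxx mul0r.
have h1 := IH (fun i hi => h i (ltnW hi)); have h2 := h n (ltnSn n).
by have := metric_triangle (u 0%N) (u n) (u n.+1); rewrite -natr1 mulrDl mul1r; lra.
Qed.

(* Projecting the chain to [u 0, u n] makes each step lie in the intersection. *)
Lemma chain_cover (u : nat -> X) (K : R) n :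
  (forall i a b, (i < n)%N -> seg (u 0%N) (u n) a -> seg (u 0%N) (u n) b ->
     seg (u i) (u i.+1) a -> seg (u i) (u i.+1) b -> d a b <= K) -> 0 <= K ->
  d (u 0%N) (u n) <= n%:R * K.
Proof.
move=> h K0; have /choice [v hv] : forall i, exists m, seg (u 0%N) (u n) m /\
    forall w, seg (u 0%N) (u n) w -> seg (u i) w m.
  by move=> i; have [m m1 m2] := seg_proj tX (u 0%N) (u n) (u i); exists m.
have v0 : v 0%N = u 0%N by have [_ /(_ _ (seg_left _ _)) /segxx] := hv 0%N.
have vn : v n = u n by have [_ /(_ _ (seg_right _ _)) /segxx] := hv n.
rewrite -{1}v0 -{1}vn; apply: mdist_chain => i ni.
have [vi pi] := hv i; have [vi1 pi1] := hv i.+1.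
have [->|/eqP ne] := eqVneq (v i) (v i.+1); first by rewrite mdistxx.
by have [h1 h2 _] := proj_bridge tX vi vi1 pi pi1 ne; apply: h ni vi vi1 h1 h2.
Qed.

End TreeMaps.

(** * Integer powers, homomorphisms and commensurability *)

Lemma intSr (n : nat) : n.+1%:Z = n%:Z + 1.
Proof. by rewrite -addn1 PoszD. Qed.

Section IntegerPowers.
Variable G : groupType.
Implicit Types (x y g h : G) (m n : int).

Lemma expgz1 x : expgz x 1 = x. Proof. by []. Qed.

Lemma expgzS x n : expgz x (n + 1) = (expgz x n * x)%g.
Proof.
case: n => [k|[|k]].
- by rewrite -intSr /= expgSr.
- by rewrite /= mulVg.
- have -> : Negz k.+1 + 1 = Negz k :> int by rewrite !NegzE intSr; ring.
  by rewrite /= [in RHS]expgS invgM mulgVK.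
Qed.

Lemma expgzP x n : expgz x (n - 1) = (expgz x n * x^-1)%g.
Proof. by rewrite -[in RHS](subrK 1 n) expgzS mulgK. Qed.

Lemma expgzD x m n : expgz x (m + n) = (expgz x m * expgz x n)%g.
Proof.
elim/int_rec: n => [|n IH|n IH]; first by rewrite addr0 mulg1.
  by rewrite intSr addrA !expgzS IH mulgA.
by rewrite intSr opprD addrA !expgzP IH mulgA.
Qed.

Lemma expgzN x n : expgz x (- n) = (expgz x n)^-1%g.
Proof.
by apply/eqP; rewrite -mulg_eq1 -expgzD addNr.
Qed.

Lemma expgzM x m n : expgz x (m * n) = expgz (expgz x m) n.
Proof.
elim/int_rec: n => [|n IH|n IH]; first by rewrite mulr0.
  by rewrite intSr mulrDr mulr1 expgzS -IH expgzD.
by rewrite intSr opprD mulrDr mulrN1 expgzP -IH expgzD expgzN.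
Qed.

Lemma expgzJ x g n : expgz (g * x * g^-1)%g n = (g * expgz x n * g^-1)%g.
Proof.
elim/int_rec: n => [|n IH|n IH]; first by rewrite /= mulg1 mulgV.
  by rewrite intSr !expgzS IH !mulgA mulgVK.
by rewrite intSr opprD !expgzP IH !invgM invgK !mulgA mulgVK.
Qed.

End IntegerPowers.

Section Homomorphisms.
Variables (G H : groupType) (f : G -> H).
Hypothesis fM : group_hom f.

Lemma hom1 : f 1%g = 1%g.
Proof. by apply: (@mulgI _ (f 1%g)); rewrite -fM !mulg1. Qed.

Lemma homV x : f x^-1%g = (f x)^-1%g.
Proof. by apply/esym/mulg1_eq; rewrite -fM mulgV hom1. Qed.

Lemma hom_expgz x n : f (expgz x n) = expgz (f x) n.
Proof.
elim/int_rec: n => [|n IH|n IH]; first exact: hom1.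
  by rewrite intSr !expgzS fM IH.
by rewrite intSr opprD !expgzP fM IH homV.
Qed.

End Homomorphisms.

Section Automorphisms.
Variable G : groupType.
Implicit Types phi psi : G -> G.

Lemma group_hom_iter phi n : group_hom phi -> group_hom (iter n phi).
Proof. by move=> pM; elim: n => [|n IH] x y //=; rewrite IH pM. Qed.

Lemma automorphism_iter phi n : automorphism phi -> automorphism (iter n phi).
Proof.
move=> [pM pb]; split; first exact: group_hom_iter.
by elim: n => [|n IH]; [exists id|exact: bij_comp].
Qed.

Lemma automorphism_conj (u : G) : automorphism (fun x => u * x * u^-1)%g.
Proof.
split; first by move=> x y; rewrite !mulgA mulgVK.
by exists (fun x => u^-1 * x * u)%g => x; rewrite !mulgA ?mulVg ?mulgV ?mul1g ?mulgVK ?mulgK.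
Qed.

Lemma automorphism_comp phi psi :
  automorphism phi -> automorphism psi -> automorphism (phi \o psi).
Proof.
move=> [pM pb] [qM qb]; split; last exact: bij_comp.
by move=> x y /=; rewrite qM pM.
Qed.

Lemma automorphism_inv phi psi : automorphism phi -> cancel phi psi -> cancel psi phi ->
  automorphism psi.
Proof.
move=> [pM _] pK qK; split; last by exists phi.
by move=> x y; apply: (can_inj pK); rewrite pM !qK.
Qed.

Lemma infinite_cyclicP (S : set G) : infinite_cyclic S ->
  exists s, [/\ S s, forall n, expgz s n = 1%g -> n = 0
    & forall g, S g -> exists n, g = expgz s n].
Proof.
move=> [f [fM fi <-]].
have f0 : f 0 = 1%g by apply: (@mulgI _ (f 0)); rewrite -fM addr0 mulg1.
have fE n : f n = expgz (f 1) n.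
  elim/int_rec: n => [//|n IH|n IH]; first by rewrite intSr fM IH expgzS.
  rewrite intSr opprD fM IH expgzP; congr (_ * _)%g.
  by apply/esym/mulg1_eq; rewrite -fM subrr.
exists (f 1); split; first by exists 1.
  by move=> n; rewrite -fE -f0 => /fi.
by move=> _ [n _ <-]; exists n.
Qed.

Definition commensurable (a b : G) := exists m n : int,
  [/\ m != 0, n != 0 & expgz a m = expgz b n].

Lemma commensurable_trans a b c :
  commensurable a b -> commensurable b c -> commensurable a c.
Proof.
move=> [m [n [m0 n0 e]]] [p [q [p0 q0 e']]]; exists (m * p), (q * n).
by rewrite !mulf_neq0 // !expgzM e -expgzM -e' -expgzM mulrC.
Qed.

Lemma commensurable_hom phi a b :
  group_hom phi -> commensurable a b -> commensurable (phi a) (phi b).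
Proof.
move=> pM [m [n [m0 n0 e]]]; exists m, n.
by split=> //; rewrite -!hom_expgz // e.
Qed.

(* The intrinsic description of the elements fixing a point of a tree in [D]
   which is not a line. *)
Definition commensurated (g : G) := forall h, commensurable (h * g * h^-1)%g g.

Lemma commensurated_hom phi g : automorphism phi -> commensurated g -> commensurated (phi g).
Proof.
move=> [pM [phi' pK qK]] cg h.
rewrite -(qK h) -homV // -!pM; exact: commensurable_hom (cg _).
Qed.

End Automorphisms.

(** * Axes of isometries *)

Section Actions.
Variables (R : realType) (G : groupType) (T : gTree R G).
Hypothesis tT : real_tree T.
Hypothesis aT : simplicial_action T.
Implicit Types (x y z p : T) (g h : G) (m n : int).
Local Notation d := mdist.
Local Notation act := (@gt_act R G T).

Lemma act1 x : act 1%g x = x. Proof. by case: aT. Qed.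

Lemma actM g h x : act (g * h)%g x = act g (act h x). Proof. by case: aT. Qed.

Lemma act_isom g x y : d (act g x) (act g y) = d x y. Proof. by case: aT. Qed.

Lemma actK g : cancel (act g) (act g^-1%g).
Proof. by move=> x; rewrite -actM mulVg act1. Qed.

Lemma actKV g : cancel (act g^-1%g) (act g).
Proof. by move=> x; rewrite -actM mulgV act1. Qed.

Lemma act_inj g : injective (act g). Proof. exact: can_inj (actK g). Qed.

Lemma act_seg g x y z : seg x y z -> seg (act g x) (act g y) (act g z).
Proof. by rewrite !segE !act_isom. Qed.

Lemma act_segV g x y z : seg (act g x) (act g y) z -> seg x y (act g^-1%g z).
Proof. by move=> /(act_seg g^-1%g); rewrite !actK. Qed.

Lemma act_expgz g n x : act g x = x -> act (expgz g n) x = x.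
Proof.
move=> gx; elim/int_rec: n => [|n IH|n IH]; first exact: act1.
  by rewrite intSr expgzS actM gx.
by rewrite intSr opprD expgzP actM -{1}gx actK.
Qed.

Lemma fix_seg g x y z : act g x = x -> act g y = y -> seg x y z -> act g z = z.
Proof.
move=> gx gy xyz; have := act_seg g xyz; rewrite gx gy => h.
by apply: (seg_uniq tT h xyz); rewrite -{1}gx act_isom.
Qed.

Definition elliptic g := exists x, act g x = x.

Lemma elliptic_conj g h : elliptic g -> elliptic (h * g * h^-1)%g.
Proof. by move=> [x gx]; exists (act h x); rewrite !actM actK gx. Qed.

(** For a loxodromic g these are the points of the axis, described without ends of the tree: p
    separates g^-k y from g^k y for all large k, whatever y. In this form conjugation, powers and
    convexity are immediate. *)
Definition axial g p := forall y, exists k0 : nat, forall k : nat, (k0 <= k)%N ->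
  seg (act (expgz g (- k%:Z)) y) (act (expgz g k%:Z) y) p.

Lemma axial_conj g h p : axial g p -> axial (h * g * h^-1)%g (act h p).
Proof.
move=> gp y; have [k0 hk] := gp (act h^-1%g y); exists k0 => k /hk /(act_seg h).
by rewrite !expgzJ !actM.
Qed.

Lemma axial_act g p n : axial g p -> axial g (act (expgz g n) p).
Proof.
move=> /(axial_conj (expgz g n)); congr axial.
by rewrite -expgzN -{2}(expgz1 g) -!expgzD addrAC addrN add0r.
Qed.

Lemma axial_convex g p q : axial g p -> axial g q -> seg p q `<=` axial g.
Proof.
move=> gp gq z pqz y; have [k1 h1] := gp y; have [k2 h2] := gq y.
exists (maxn k1 k2) => k; rewrite geq_max => /andP[/h1 ? /h2 ?].
exact: (seg_convex tT _ _ pqz).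
Qed.

Lemma axial_exp g p m : m != 0 -> axial g p -> axial (expgz g m) p.
Proof.
move=> m0 gp y; have [k0 hk] := gp y; exists k0 => k k0k.
have h j : (k0 <= j)%N -> seg (act (expgz g (- j%:Z)) y) (act (expgz g j%:Z) y) p.
  exact: hk.
rewrite -!expgzM mulrN.
have /h : (k0 <= `|m| * k)%N by rewrite (leq_trans k0k) // leq_pmull // lt0n absz_eq0.
rewrite PoszM; case: (m) => j /=; first by [].
by rewrite NegzE !mulNr opprK => /segC.
Qed.

(** The local criterion for p to lie on the axis of a loxodromic g: [p, g p] and [g p, g^2 p] meet
    only in g p. *)
Definition axis_base g p := 0 < d p (act g p) /\
  d p (act (g * g)%g p) = 2 * d p (act g p).

Lemma axis_base_line g p (n : nat) : axis_base g p ->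
  d p (act (expgz g n) p) = n%:R * d p (act g p) /\
  seg p (act (expgz g n.+1) p) (act (expgz g n) p).
Proof.
move=> [l0 l2].
have pgn : p <> act g p by move=> h; move: l0; rewrite -h mdistxx ltxx.
have step k : seg (act (expgz g k) p) (act (expgz g (k + 1 + 1)) p) (act (expgz g (k + 1)) p).
  have h : seg p (act (expgz g (1 + 1)) p) (act (expgz g 1) p).
    by rewrite segE expgzD actM act_isom /= -actM l2; ring.
  by have := act_seg (expgz g k) h; rewrite -!actM -!expgzD addrA.
have stepd k : d (act (expgz g k) p) (act (expgz g (k + 1)) p) = d p (act g p).
  by rewrite expgzD actM act_isom expgz1.
have H : seg p (act (expgz g n.+1) p) (act (expgz g n) p).
  elim: n => [|n IH]; first by rewrite act1; exact: seg_left.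
  have := step n; rewrite -!intSr => h.
  have ne : act (expgz g n) p <> act (expgz g n.+1) p.
    by move=> e; move: (stepd n); rewrite -intSr -e mdistxx => e'; move: l0; rewrite -e' ltxx.
  by have [] := seg_concat_near tT IH h ne.
split=> //; elim: n H => [|n IH] H; first by rewrite act1 mdistxx mul0r.
have h1 : seg p (act (expgz g n.+1) p) (act (expgz g n) p).
  elim: n {IH H} => [|n IH]; first by rewrite act1; exact: seg_left.
  have := step n; rewrite -!intSr => h.
  have ne : act (expgz g n) p <> act (expgz g n.+1) p.
    by move=> e; move: (stepd n); rewrite -intSr -e mdistxx => e'; move: l0; rewrite -e' ltxx.
  by have [] := seg_concat_near tT IH h ne.
by move: (h1); rewrite segE => <-; rewrite IH // intSr stepd -natr1; ring.
Qed.

Lemma axis_base_dist g p m n : axis_base g p ->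
  d (act (expgz g m) p) (act (expgz g n) p) = `|n - m|%:~R * d p (act g p).
Proof.
move=> gp; wlog : m n / m <= n => [H|].
  by have [/H//|/ltW/H] := leP m n; rewrite metric_sym distrC.
move=> mn; have -> : n = m + (n - m) by ring.
rewrite expgzD actM act_isom addrAC addrN add0r ger0_norm ?subr_ge0 //.
have : 0 <= n - m by rewrite subr_ge0.
by case: (n - m) => // k _; have [-> _] := axis_base_line k gp.
Qed.

(** The points g^k p and g^-k p are at distance k l from p. Once k l exceeds d y p, replacing them
    by g^k y and g^-k y moves the ends too little to bring the segment off p. *)
Lemma axis_base_axial g p : axis_base g p -> axial g p.
Proof.
move=> gp y; have [l0 _] := gp; set l := d p _ in l0.
have [k0 hk0] : exists k0 : nat, d y p < k0%:R * l.
  have := archi_boundP (x := d y p / l); rewrite divr_ge0 ?mdist_ge0 ?(ltW l0) // => /(_ isT) h.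
  by exists (Num.bound (d y p / l)); rewrite -ltr_pdivrMr.
exists k0 => k k0k; have kl : d y p < k%:R * l.
  by apply: lt_le_trans hk0 _; rewrite ler_pM2r // ler_nat.
have e1 := axis_base_dist (- k%:Z) 0 gp; have e2 := axis_base_dist 0 k%:Z gp.
have e3 := axis_base_dist (- k%:Z) k%:Z gp.
move: e1 e2 e3; rewrite !act1 !subr0 !sub0r !opprK -PoszD.
rewrite -[`|k%:Z|]/k%:Z -[`|(k + k)%N%:Z|]/(k + k)%N%:Z -!pmulrn natrD mulrDl -/l => e1 e2 e3.
have h : seg (act (expgz g (- k%:Z)) p) (act (expgz g k%:Z) p) p.
  by rewrite segE e1 e2 e3.
case: (seg_union tT (act (expgz g k%:Z) y) h) => [h1|/segC/seg_le_left]; last first.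
  by rewrite act_isom metric_sym e2 (metric_sym p); lra.
case: (seg_union tT (act (expgz g (- k%:Z)) y) h1) => [/seg_le_left|//].
by rewrite act_isom e1 (metric_sym p); lra.
Qed.

(** Look at the tripod y, g y, g^2 y with centre m. If the overlap [g y, m] covers half of [y, g y],
    the midpoint of [y, g y] is fixed; otherwise g^-1 m is on the axis. *)
Lemma axis_base_exists g (y : T) : ~ elliptic g ->
  exists2 p, axis_base g p & seg y (act g y) p.
Proof.
move=> ng; pose L := d y (act g y).
have [m [m1 m2 m3]] := tree_median tT y (act g y) (act (g * g)%g y).
have L2 : d (act g y) (act (g * g)%g y) = L by rewrite actM act_isom.
have [h|h] := leP (L / 2) (d (act g y) m).
  case: ng; have [w yw ew] : exists2 w, seg y (act g y) w & d y w = L / 2.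
    by apply: tree_point => //; rewrite /L; have := mdist_ge0 y (act g y); lra.
  exists w; have gw := act_seg g yw; rewrite -actM in gw.
  have egw : d (act g y) (act g w) = L / 2 by rewrite act_isom.
  have le : d (act g y) (act g w) <= d (act g y) m by rewrite egw.
  have [h1 _] := seg_order tT gw m3 le.
  have h2 := seg_incl_left (segC m1) h1.
  apply: (seg_uniq tT h2 (segC yw)); rewrite egw.
  by move: yw; rewrite segE ew (metric_sym w) -/L; lra.
pose p := act g^-1%g m; have gp : act g p = m by rewrite actKV.
have yp : seg y (act g y) p.
  by apply: (@act_segV g); rewrite -actM.
have dyp : d y p = d (act g y) m by rewrite -gp act_isom.
have le : d y p <= d y m.
  by move: m1; rewrite segE dyp (metric_sym m) -/L; lra.
have [h1 h2] := seg_order tT yp m1 le.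
exists p => //; split.
  rewrite gp (seg_mdist tT yp m1 le) dyp.
  by move: m1; rewrite segE (metric_sym m) -/L; lra.
rewrite actM gp.
have h3 : seg m (act (g * g)%g y) (act g m).
  by have := act_seg g h2; rewrite gp -actM.
have e : d p m = d m (act g m) by rewrite -(act_isom g p m) gp.
suff : d p m + d m (act g m) = d p (act g m) by rewrite -e => <-; ring.
move: h1 h3 m2; rewrite !segE => h1' h3' m2'.
have := metric_triangle y p (act (g * g)%g y).
have := metric_triangle p (act g m) (act (g * g)%g y).
have := metric_triangle p m (act g m); lra.
Qed.

(** The chain of points g^i z, for i from -k0 to k0, passes over p in one of its steps; a power of g
    carries that step to [z, g z]. *)
Lemma axial_meets_translates g p z : axial g p ->
  exists i : int, seg z (act g z) (act (expgz g i) p).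
Proof.
move=> gp; have [k0 /(_ _ (leqnn k0)) h] := gp z.
have [e|/eqP ne] := eqVneq p (act (expgz g (- k0%:Z)) z).
  by exists k0%:Z; rewrite e -actM -expgzD addrN act1; exact: seg_left.
pose u (i : nat) := act (expgz g (i%:Z - k0%:Z)) z.
have h' : seg (u 0%N) (u (k0 + k0)%N) p by rewrite /u sub0r PoszD addrK.
have ne' : p <> u 0%N by rewrite /u sub0r.
have [i _ hi] := seg_chain tT (leq0n _) h' ne'.
exists (- (i%:Z - k0%:Z)); rewrite expgzN; apply: act_segV.
by move: hi; rewrite /u intSr addrAC expgzS actM.
Qed.

Lemma nonelliptic_exp g m : m != 0 -> ~ elliptic g -> ~ elliptic (expgz g m).
Proof.
move=> m0 ng [x gx]; have [p gp _] := axis_base_exists x ng.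
have [k0 /(_ _ (leqnn k0))] := axial_exp m0 (axis_base_axial gp) x.
rewrite !(act_expgz _ gx) => /segxx px.
have := axis_base_dist 0 m gp; rewrite px act1 gx mdistxx subr0 -px.
have [l0 _] := gp => /esym/eqP; rewrite mulf_eq0 intr_eq0 normr_eq0 (negbTE m0) /=.
by move=> /eqP e; move: l0; rewrite e ltxx.
Qed.

Lemma elliptic_expP g m : m != 0 -> elliptic (expgz g m) <-> elliptic g.
Proof.
move=> m0; split=> [e|[x gx]]; last by exists x; exact: act_expgz.
by apply: contrapT => /(nonelliptic_exp m0).
Qed.

Lemma axial_expP g p m : m != 0 -> ~ elliptic g -> axial (expgz g m) p -> axial g p.
Proof.
move=> m0 ng gp; have [q gq _] := axis_base_exists p ng.
have [k0 /(_ _ (leqnn k0))] := gp q; rewrite -!expgzM.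
by apply: axial_convex; apply: axial_act; exact: axis_base_axial.
Qed.

Lemma commensurable_elliptic a b : commensurable a b -> elliptic a -> elliptic b.
Proof.
move=> [m [n [m0 n0 e]]] ea; apply/(elliptic_expP b n0); rewrite -e.
by apply/elliptic_expP.
Qed.

Hypothesis mT : minimal_action T.

(** The translate of the axis of g by h is the axis of h g h^-1, which shares a nontrivial power
    with g and so has the same axis. The axis is thus convex and invariant, and minimality makes it
    the whole tree. *)
Lemma commensurated_axis g : ~ elliptic g -> commensurated g -> forall z, axial g z.
Proof.
move=> ng cg z; suff -> : axial g = setT by [].
apply: mT; first by have [p gp _] := axis_base_exists z ng; exists p; exact: axis_base_axial.
- by move=> x y; exact: axial_convex.
move=> h x gx; have [m [n [m0 n0 e]]] := cg h.
by apply: (axial_expP n0) => //; rewrite -e; apply: axial_exp => //; exact: axial_conj.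
Qed.

End Actions.

(** * Simplicial trees *)

Lemma finite_argmin (R : realType) (X : eqType) (A : set X) (r : X -> R) :
  finite_set A -> A !=set0 -> exists2 a, A a & forall b, A b -> r a <= r b.
Proof.
move=> /finite_seqP[s ->] [a0 /= a0s]; elim: s a0 a0s => // b s IH a0 _.
have [s0|[c cs]] : s = [::] \/ exists c, c \in s.
  by case: (s) => [|c s']; [left|right; exists c; rewrite inE eqxx].
  by exists b; rewrite s0 /= ?inE // => c; rewrite inE => /eqP ->.
have [a /= as_ ha] := IH c cs; have [le|/ltW le] := leP (r a) (r b).
  exists a => [|x /=]; first by rewrite /= inE as_ orbT.
  by rewrite inE => /orP[/eqP -> //|]; exact: ha.
exists b => [|x /=]; first by rewrite /= inE eqxx.
by rewrite inE => /orP[/eqP -> //|/ha]; exact: le_trans.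
Qed.

Lemma finite_pigeonhole (X : Type) (A : set X) (y : nat -> X) : finite_set A ->
  (forall n, A (y n)) -> exists n m, (n < m)%N /\ y n = y m.
Proof.
move=> fA Ay; apply: contrapT => h; apply: infinite_nat.
have yi : injective y.
  move=> n m e; apply: contrapT => /eqP; rewrite neq_ltn => /orP[l|l]; apply: h.
    by exists n, m.
  by exists m, n.
have /card_le_finite : ([set: nat] #<= A)%card.
  apply: (@card_le_trans _ _ _ (range y)).
    by have /card_eqPle[] := inj_card_eq (A := [set: nat]) (in2W yi).
  by apply: subset_card_le => _ [n _ <-].
exact.
Qed.

(** Sums replace the minimum and the maximum; the + 1 covers n = 0. *)
Lemma finite_positive_bounds (R : realType) n (r : 'I_n -> R) : (forall i, 0 < r i) ->
  exists e L : R, [/\ 0 < e, 0 < L & forall i, e <= r i <= L].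
Proof.
move=> r0; exists (\sum_i (r i)^-1 + 1)^-1, (\sum_i r i + 1).
have s0 : 0 <= \sum_i (r i)^-1 by apply: sumr_ge0 => i _; rewrite invr_ge0 ltW.
have t0 : 0 <= \sum_i r i by apply: sumr_ge0 => i _; rewrite ltW.
split; [by rewrite invr_gt0; lra|by lra|move=> i; apply/andP; split].
  rewrite -[leRHS]invrK lef_pV2 ?posrE ?invr_gt0 //; last by lra.
  rewrite (bigD1 i) //=; have : 0 <= \sum_(j < n | j != i) (r j)^-1.
    by apply: sumr_ge0 => j _; rewrite invr_ge0 ltW.
  by lra.
rewrite (bigD1 i) //=; have : 0 <= \sum_(j < n | j != i) r j.
  by apply: sumr_ge0 => j _; rewrite ltW.
by lra.
Qed.

Section SimplicialTrees.
Variables (R : realType) (X : metricType R) (V : set X).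
Hypothesis sV : simplicial_tree V.
Implicit Types (x y z p u v w : X).
Local Notation d := mdist.
Local Notation edge := (edge V).

Lemma simplicial_real_tree : real_tree X. Proof. by case: sV. Qed.
Let tX := simplicial_real_tree.

Lemma edgeC u v : edge u v -> edge v u.
Proof.
by move=> [Vu Vv uv e]; split=> //; [exact: nesym|rewrite segCE e setUC].
Qed.

Lemma edge_vertex u v w : edge u v -> V w -> seg u v w -> w = u \/ w = v.
Proof. by move=> [_ _ _ e] Vw uvw; have : [set u; v] w by rewrite -e. Qed.

Lemma edge_mdist_gt0 u v : edge u v -> 0 < d u v.
Proof. by case=> _ _ uv _; rewrite mdist_gt0; apply/eqP. Qed.

Lemma edge_unique u v u' v' x : edge u v -> edge u' v' -> seg u v x -> seg u' v' x ->
  ~ V x -> (u = u' /\ v = v') \/ (u = v' /\ v = u').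
Proof. by move=> e e' h h' nx; case: sV => _ _ _ _ /(_ u v u' v' x); apply. Qed.

Lemma first_vertex p w : V w -> exists v, [/\ V v, seg p w v &
  forall v', V v' -> seg p v v' -> v' = v].
Proof.
move=> Vw; case: sV => _ _ fin _ _.
have [|v [Vv pwv] vmin] := @finite_argmin R X (V `&` seg p w) (d p) (fin _ _).
  by exists w; split=> //; exact: seg_right.
exists v; split=> // v' Vv' pvv'.
have := vmin v' (conj Vv' (seg_incl_left pwv pvv')).
move: pvv'; rewrite segE => e le; apply: mdist_eq0.
by lra.
Qed.

Lemma next_vertex u w : V u -> V w -> u <> w -> exists2 u', edge u u' & seg u w u'.
Proof.
move=> Vu Vw uw; case: sV => _ _ fin _ _.
have [||v [[Vv uwv] vu] vmin] :=
    @finite_argmin R X ((V `&` seg u w) `\ u) (d u).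
- by apply: sub_finite_set (fin u w) => x [].
- by exists w; split; [split=> //; exact: seg_right|exact: nesym].
exists v => //; split=> //; first exact: nesym.
apply/seteqP; split=> [x [Vx uvx]|x []-> /=]; last 2 first.
- by split=> //; exact: seg_left.
- by split=> //; exact: seg_right.
have [->|/eqP xu] := eqVneq x u; first by left.
right; have := vmin x (conj (conj Vx (seg_incl_left uwv uvx)) xu).
by move: uvx; rewrite segE => e le; apply: mdist_eq0; lra.
Qed.

(** Each step moves u one edge towards v, and the finite list of vertices on [u, v] loses u. *)
Lemma vertex_ind v (P : X -> Prop) : V v -> P v ->
  (forall u u', V u -> edge u u' -> seg u v u' -> P u' -> P u) ->
  forall u, V u -> P u.
Proof.
move=> Vv Pv step u Vu; case: sV => _ _ fin _ _.
have [s hs] := (finite_seqP _).1 (fin u v).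
have : forall x, V x -> seg u v x -> x \in s.
  by move=> x Vx ux; have : (V `&` seg u v) x by []; rewrite hs.
move: {hs} (leqnn (size s)); move: {2}(size s) => n; elim: n s u Vu => [|n IH] s u Vu sn us.
  by have := us u Vu (seg_left _ _); move: sn; rewrite leqn0 size_eq0 => /eqP ->.
have [->//|/eqP uv] := eqVneq u v.
have [u' eu uvu'] := next_vertex Vu Vv uv.
apply: (step u u') => //; apply: (IH [seq x <- s | x != u]).
- by case: eu.
- rewrite size_filter; have := count_predC (pred1 u) s.
  have : (0 < count (pred1 u) s)%N by rewrite -has_count has_pred1; apply: us => //; exact: seg_left.
  move=> h1 h2; rewrite -(leq_add2l 1); apply: leq_trans sn.
  by rewrite -[leqRHS]h2; apply: leq_add.
- move=> x Vx ux; rewrite mem_filter us //; last exact: seg_incl_right uvu' _ ux.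
  rewrite andbT; apply/eqP => e; case: eu => _ _ + _; apply; apply: mdist_eq0.
  move: uvu' ux; rewrite !segE e (metric_sym u' u).
  by have := mdist_ge0 u u'; have := mdist_ge0 u v; lra.
Qed.

Definition cell x y := x = y \/ exists u v, [/\ edge u v, seg u v x & seg u v y].

Lemma cellC x y : cell x y -> cell y x.
Proof. by case=> [->|[u [v [*]]]]; [left|right; exists u, v]. Qed.

Lemma vertex_or_edge x : V x \/ exists u v, [/\ edge u v, seg u v x & ~ V x].
Proof.
have [?|nx] := pselect (V x); [by left|right].
by case: sV => _ _ _ /(_ x) [//|[u [v [e ux]]]] _; exists u, v.
Qed.

(* An edge leaving [u, v] through an interior point p would give a vertex w with
   [u, w] an edge through p, contradicting that edges only meet at vertices. *)
Lemma edge_exit u v x y : edge u v -> seg u v x -> ~ seg u v y ->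
  seg x y u \/ seg x y v.
Proof.
move=> euv uvx uvy; have [p uvp yp] := seg_proj tX u v y.
have pxy : seg x y p by apply: segC; exact: yp.
have [pu|pu] := pselect (p = u); first by left; rewrite -pu.
have [pv|pv] := pselect (p = v); first by right; rewrite -pv.
have nVp : ~ V p by move=> /(edge_vertex euv) /(_ uvp) [].
exfalso.
(* w is y itself or an end of the edge [a, b] carrying y. If neither a nor b projected to p, both
   [a, y] and [b, y] would pass through p, which forces y = p. *)
have [w Vw [wp wNp]] : exists2 w, V w & (forall z, seg u v z -> seg w z p) /\ w <> p.
  case: (vertex_or_edge y) => [Vy|[a [b [eab ay _]]]].
    by exists y => //; split=> // e; apply: uvy; rewrite e.
  have [Va Vb _ _] := eab.
  have [p1 up1 ap1] := seg_proj tX u v a; have [p2 up2 bp2] := seg_proj tX u v b.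
  have key c q : seg u v q -> (forall w, seg u v w -> seg c w q) -> p <> q ->
      seg c y q /\ seg c y p.
    by move=> uq cq pq; have [] := proj_bridge tX uvp uq yp cq pq;
      move=> /segC h2 /segC h3 _.
  have [e1|n1] := pselect (p = p1).
    exists a => //; split; first by rewrite e1.
    by move=> e; apply: nVp; rewrite -e.
  have [e2|n2] := pselect (p = p2).
    exists b => //; split; first by rewrite e2.
    by move=> e; apply: nVp; rewrite -e.
  have [_ h1] := key _ _ up1 ap1 n1; have [_ h2] := key _ _ up2 bp2 n2.
  exfalso; apply: uvy; suff -> : y = p by [].
  apply: mdist_eq0; move: ay h1 h2; rewrite !segE.
  have := metric_triangle a p b; rewrite (metric_sym y p) (metric_sym b p) (metric_sym b y).
  by lra.
have [v' [Vv' pwv' v'min]] := first_vertex p Vw.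
have uw : seg u w p by apply: segC; apply: wp; exact: seg_left.
have [_ /segC uv'p] := seg_trans (wp _ (seg_left _ _)) (segC pwv').
have nuv' : u <> v'.
  by move=> e; move: uv'p; rewrite -e => /segxx.
have nvv' : v <> v'.
  move=> e; have := seg_trans (wp _ (seg_right u v)) (segC pwv').
  by rewrite -e => -[_ /segxx].
have euv' : edge u v'.
  split=> //; first by case: euv.
  apply/seteqP; split=> [x' [Vx' /(seg_union tX p) [h1|h1]]|x' []->]; last 2 first.
  - by split; [case: euv|exact: seg_left].
  - by split=> //; exact: seg_right.
  - have /(edge_vertex euv Vx') := seg_incl_left uvp h1; case=> [->|e]; first by left.
    exfalso; apply: pv; move: h1 uvp; rewrite e !segE => h1 h2; apply: mdist_eq0.
    by have := metric_triangle u p v; have := mdist_ge0 p v; rewrite (metric_sym v p) in h1; lra.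
  - by right; rewrite (v'min x' Vx') //; exact: segC.
case: (edge_unique euv euv' uvp uv'p nVp) => [[_ e]|[e _]]; first exact: nvv'.
exact: nuv'.
Qed.

Lemma cell_path x y : cell x y \/ exists w w', [/\ V w, V w', seg x y w, seg w y w' &
  cell x w /\ cell w' y].
Proof.
have one a b : cell a b \/ exists w, [/\ V w, seg a b w & cell a w].
  case: (vertex_or_edge a) => [Va|[u [v [e ua nVa]]]].
    by right; exists a; split=> //; [exact: seg_left|left].
  have [?|nb] := pselect (seg u v b); first by left; right; exists u, v.
  have [Vu Vv _ _] := e.
  case: (edge_exit e ua nb) => h; right; [exists u|exists v]; split=> //; right; exists u, v;
    by split=> //; first [exact: seg_left|exact: seg_right].
case: (one x y) => [|[w [Vw xyw cw]]]; first by left.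
right; case: (one y w) => [cyw|[w' [Vw' yww' cw']]].
  exists w, w; split=> //; first exact: seg_left.
  by split=> //; exact: cellC.
by exists w, w'; split=> //; [exact: segC|split=> //; exact: cellC].
Qed.

Lemma lipschitz_vertices (Y : metricType R) (h : X -> Y) (K : R) : 0 <= K ->
  (forall u v, edge u v -> d (h u) (h v) <= K * d u v) ->
  forall u v, V u -> V v -> d (h u) (h v) <= K * d u v.
Proof.
move=> K0 hK u v Vu Vv; move: u Vu; apply: (vertex_ind Vv).
  by rewrite !mdistxx mulr0.
move=> u u' Vu e /segE <- h1; rewrite mulrDr.
by have := metric_triangle (h u) (h u') (h v); have := hK _ _ e; lra.
Qed.

Lemma lipschitz_cells (Y : metricType R) (h : X -> Y) (K : R) : 0 <= K ->
  (forall u v x y, edge u v -> seg u v x -> seg u v y -> d (h x) (h y) <= K * d x y) ->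
  forall x y, d (h x) (h y) <= K * d x y.
Proof.
move=> K0 hK x y.
have hc a b : cell a b -> d (h a) (h b) <= K * d a b.
  by case=> [->|[u [v [e h1 h2]]]]; [rewrite !mdistxx mulr0|exact: hK e h1 h2].
case: (cell_path x y) => [/hc //|[w [w' [Vw Vw' /segE <- /segE <- [/hc c1 /hc c2]]]]].
have : d (h w) (h w') <= K * d w w'.
  apply: lipschitz_vertices => // u v e; apply: (hK u v) => //;
    [exact: seg_left|exact: seg_right].
rewrite !mulrDr.
have := metric_triangle (h x) (h w) (h y); have := metric_triangle (h w) (h w') (h y).
by lra.
Qed.

(* A vertex is coded as a degenerate edge. *)
Lemma point_code x : exists u v, [/\ V u, V v, seg u v x & u = v \/ edge u v].
Proof.
case: (vertex_or_edge x) => [Vx|[u [v [e h _]]]].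
  by exists x, x; split=> //; [exact: seg_left|left].
by have [Vu Vv _ _] := e; exists u, v; split=> //; right.
Qed.

End SimplicialTrees.

(** * Trees with infinite cyclic stabilizers *)

Lemma cyclic_commensurable (G : groupType) (S : set G) a b :
  infinite_cyclic S -> S a -> S b -> a <> 1%g -> b <> 1%g -> commensurable a b.
Proof.
move=> /infinite_cyclicP[s [_ _ sS]] /sS[i ->] /sS[j ->] ai bj; exists j, i; split.
- by apply/eqP => e; apply: bj; rewrite e.
- by apply/eqP => e; apply: ai; rewrite e.
by rewrite -!expgzM mulrC.
Qed.

Section TreesInD.
Variables (R : realType) (G : groupType) (T : gTree R G).
Hypothesis TD : in_D T.
Implicit Types (x y z p u v : T) (g h : G) (m n : int).
Local Notation d := mdist.
Local Notation act := (@gt_act R G T).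
Local Notation V := (@gt_vert R G T).
Local Notation edge := (edge V).

Lemma in_D_simplicial : simplicial_tree V. Proof. by case: TD. Qed.
Lemma in_D_action : simplicial_action T. Proof. by case: TD. Qed.
Lemma in_D_minimal : minimal_action T. Proof. by case: TD. Qed.
Lemma in_D_real_tree : real_tree T.
Proof. exact: simplicial_real_tree in_D_simplicial. Qed.
Let sV := in_D_simplicial.
Let aT := in_D_action.
Let tT := in_D_real_tree.

Lemma exists_vertex : exists v : T, V v. Proof. by case: sV. Qed.

Lemma act_vertex g v : V v -> V (act g v).
Proof. by case: aT => _ _ _ /(_ g v). Qed.

Lemma act_vertexV g v : V (act g v) -> V v.
Proof. by move=> /(act_vertex g^-1%g); rewrite actK. Qed.

Lemma act_edge g u v : edge u v -> edge (act g u) (act g v).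
Proof.
move=> [Vu Vv uv e]; split; [exact: act_vertex|exact: act_vertex|by move=> /(act_inj aT)|].
apply/seteqP; split=> [x [Vx h]|x []->]; last 2 first.
- by split; [exact: act_vertex|exact: seg_left].
- by split; [exact: act_vertex|exact: seg_right].
have : (V `&` seg u v) (act g^-1%g x).
  by split; [exact: act_vertex|exact: act_segV].
by rewrite e => -[] <-; [left|right]; rewrite actKV.
Qed.

Lemma fix_interior g x u v : act g x = x -> edge u v -> seg u v x -> ~ V x ->
  act g u = u /\ act g v = v.
Proof.
move=> gx e ux nx; have h := act_seg aT g ux; rewrite gx in h.
case: (edge_unique sV (act_edge g e) e h ux nx) => // swap.
by case: aT => _ _ _ _ /(_ g u v e).
Qed.

Lemma stab_cyclic x : infinite_cyclic [set g | act g x = x].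
Proof.
case: TD => _ _ _ sv se; case: (vertex_or_edge sV x) => [/sv //|[u [v [e ux nx]]]].
suff -> : [set g | act g x = x] = [set g | act g u = u /\ act g v = v] by exact: se.
apply/seteqP; split=> g /=; first by move=> gx; exact: fix_interior gx e ux nx.
by move=> [gu gv]; exact: (fix_seg tT aT) gu gv ux.
Qed.

Lemma elliptic_vertex g : elliptic T g -> exists2 v, V v & act g v = v.
Proof.
move=> [x gx]; case: (vertex_or_edge sV x) => [Vx|[u [v [e ux nx]]]]; first by exists x.
by have [gu _] := fix_interior gx e ux nx; exists u => //; case: e.
Qed.

Lemma exists_elliptic : exists2 c, elliptic T c & c <> 1%g.
Proof.
have [v _] := exists_vertex; have [s [sv s0 _]] := infinite_cyclicP (stab_cyclic v).
by exists s; [exists v|move=> e; have := s0 1 e].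
Qed.

(** Neighbouring vertex stabilizers share an infinite cyclic edge group, hence are commensurable;
    this propagates along the edge path from u to v. *)
Lemma elliptic_commensurable g h : elliptic T g -> elliptic T h -> g <> 1%g -> h <> 1%g ->
  commensurable g h.
Proof.
move=> /elliptic_vertex[u Vu gu] /elliptic_vertex[v Vv hv] g1 h1.
move: u Vu g gu g1; apply: (vertex_ind sV Vv).
  by move=> g gv g1; apply: cyclic_commensurable (stab_cyclic v) _ _ _ _.
move=> u u' Vu e _ IH g gu g1; case: TD => _ _ _ _ /(_ _ _ e) /infinite_cyclicP.
move=> [c [[cu cu'] c0 _]]; have c1 : c <> 1%g by move=> e1; have := c0 1 e1.
apply: commensurable_trans (IH c cu' c1).
exact: cyclic_commensurable (stab_cyclic u) _ _ _ _.
Qed.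

Lemma elliptic_commensurated g : elliptic T g -> commensurated g.
Proof.
move=> eg h; have [->|/eqP g1] := eqVneq g 1%g.
  by exists 1, 1; rewrite mulg1 mulgV.
apply: elliptic_commensurable => //; first exact: elliptic_conj.
by move=> e; apply: g1; apply: (@mulgI _ h); apply: (@mulIg _ h^-1%g); rewrite e mulg1 mulgV.
Qed.

(** Cocompactness. Unlike [edge_orbit_representatives] it tolerates repetitions, so that it can be
    transported to another tree. *)
Definition edge_cover (n : nat) (e : 'I_n -> T * T) := (forall i, edge (e i).1 (e i).2) /\
  forall u v, edge u v -> exists i, same_edge_orbit (e i) (u, v).

Section EdgeCover.
Variables (n : nat) (e : 'I_n -> T * T).
Hypothesis eC : edge_cover e.

Lemma same_edge_orbit_mdist i u v : same_edge_orbit (e i) (u, v) ->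
  d u v = d (e i).1 (e i).2.
Proof.
by move=> [g [[/= <- <-]|[/= <- <-]]]; rewrite act_isom // metric_sym.
Qed.

Lemma edge_bounds : exists a b : R, [/\ 0 < a, 0 < b &
  forall u v, edge u v -> a <= d u v <= b].
Proof.
have [eE eO] := eC.
have [i|a [b [a0 b0 ab]]] := @finite_positive_bounds R n (fun i => d (e i).1 (e i).2).
  exact: edge_mdist_gt0 (eE i).
by exists a, b; split=> // u v /eO[i /same_edge_orbit_mdist ->].
Qed.

(** The stabilizer <s> of u contains an element c = s^k, with k nonzero, that fixes u'. So a
    translate of u' depends only on an exponent of s modulo k. *)
Lemma translates_finite u u' v : V u -> edge u u' ->
  finite_set [set w | exists g, act g u = v /\ act g u' = w].
Proof.
move=> Vu eu.
have [[g0 g0u]|no] := pselect (exists g, act g u = v); last first.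
  by apply: (@sub_finite_set _ _ set0) => // w [g [gu _]]; case: no; exists g.
have [s [su _ sS]] := infinite_cyclicP (stab_cyclic u).
have [c [[cu cu'] c0 _]] : exists c, [/\ act c u = u /\ act c u' = u',
    (forall n, expgz c n = 1%g -> n = 0) & True].
  by case: TD => _ _ _ _ /(_ _ _ eu) /infinite_cyclicP[c [h1 h2 _]]; exists c.
have [k ck] := sS c cu.
have k0 : k != 0 by apply/eqP => k0; have := c0 1; rewrite ck k0 /= => /(_ erefl).
apply: (@sub_finite_set _ _
    ((fun r : nat => act (g0 * expgz s r)%g u') @` `I_(`|k|%N))); last first.
  exact/finite_image/finite_II.
move=> w [g [gu <-]].
have [j ej] : exists j, (g0^-1 * g)%g = expgz s j.
  by apply: sS; rewrite /= actM // gu -g0u actK.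
exists `|(j %% k)%Z|%N => /=.
  by rewrite -ltz_nat gez0_abs ?modz_ge0 // abszE ltz_mod.
change (act (g0 * expgz s `|(j %% k)%Z|%N)%g u' = act g u').
rewrite gez0_abs ?modz_ge0 //.
have ejk : expgz s j = (expgz s (j %% k)%Z * expgz c (j %/ k)%Z)%g.
  by rewrite ck -expgzM -expgzD mulrC addrC -divz_eq.
by rewrite -[g](mulVKg g0) ej ejk !actM // (act_expgz aT _ cu').
Qed.

Lemma neighbours_finite v : V v -> finite_set [set w | edge v w].
Proof.
move=> Vv; have [eE eO] := eC.
pose F (i : 'I_n) := [set w | exists g, act g (e i).1 = v /\ act g (e i).2 = w] `|`
  [set w | exists g, act g (e i).2 = v /\ act g (e i).1 = w].
apply: (@sub_finite_set _ _ (\bigcup_(i in [set: 'I_n]) F i)).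
  by move=> w /eO[i [g [[/= h1 h2]|[/= h1 h2]]]]; exists i => //; [left|right]; exists g.
apply: bigcup_finite; first exact: finite_finset.
move=> i _; rewrite finite_setU; have [V1 V2 _ _] := eE i.
by split; apply: translates_finite => //; exact: edgeC.
Qed.

Lemma ball_finite v (D : R) : V v -> finite_set [set u | V u /\ d v u <= D].
Proof.
have [a [b [a0 _ ab]]] := edge_bounds.
move=> Vv; pose N := Num.bound (D / a).
have [D0|D0] := ltP D 0.
  apply: (@sub_finite_set _ _ set0) => // u [_ h].
  by have := mdist_ge0 v u; lra.
have DN : D <= N%:R * a.
  rewrite -ler_pdivrMr //; apply: ltW; apply: archi_boundP.
  by rewrite divr_ge0 // ltW.
apply: (@sub_finite_set _ _ [set u | V u /\ d v u <= N%:R * a]).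
  by move=> u [Vu h]; split=> //; exact: le_trans DN.
elim: N v Vv {DN} => [|N IH] v Vv.
  apply: (@sub_finite_set _ _ [set v]); last exact: finite_set1.
  by move=> u [_]; rewrite mul0r => /mdist_eq0.
apply: (@sub_finite_set _ _ ([set v] `|` \bigcup_(w in [set w | edge v w])
    [set u | V u /\ d w u <= N%:R * a])).
  move=> u [Vu h]; have [->|/eqP vu] := eqVneq u v; [by left|right].
  have [w ew vuw] := next_vertex sV Vv Vu (nesym vu).
  exists w => //; split=> //; have /andP[h1 _] := ab _ _ ew.
  by move: vuw h; rewrite segE -natr1 mulrDl mul1r; lra.
rewrite finite_setU; split; first exact: finite_set1.
apply: bigcup_finite; first exact: neighbours_finite.
by move=> w [_ Vw _ _]; exact: IH.
Qed.

End EdgeCover.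

Lemma exists_edge (u0 v0 a : T) : edge u0 v0 -> V a -> exists a', edge a a'.
Proof.
move=> e Va; have [->|/eqP ne] := eqVneq a u0; first by exists v0.
by have [Vu _ _ _] := e; have [a' ea _] := next_vertex sV Va Vu ne; exists a'.
Qed.

Lemma edge_interior u v : edge u v -> exists2 m, seg u v m & ~ V m.
Proof.
move=> e; have l0 := edge_mdist_gt0 e.
have [m um em] : exists2 m, seg u v m & d u m = d u v / 2 by apply: tree_point => //; lra.
exists m => // Vm; case: (edge_vertex e Vm um) => h; move: em l0; rewrite h ?mdistxx;
  lra.
Qed.

(** From m each of the vertices p and q is reached through a or through b. The same exit for both
    would put m at that vertex, so the two exits differ. *)
Lemma interior_seg (p q a b m : T) : V p -> V q -> edge a b -> seg a b m -> ~ V m ->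
  seg p q m -> seg p q a /\ seg p q b.
Proof.
move=> Vp Vq e am nm pqm.
have ex c : V c -> seg m c a \/ seg m c b.
  move=> Vc; have [ac|nac] := pselect (seg a b c); last exact: (edge_exit sV e am nac).
  by case: (edge_vertex e Vc ac) => ->; [left|right]; exact: seg_right.
have no c : V c -> ~ (seg m p c /\ seg m q c).
  move=> Vc [h1 h2]; apply: nm; suff -> : m = c by [].
  apply: mdist_eq0; move: h1 h2 pqm; rewrite !segE.
  have := metric_triangle p c q; rewrite (metric_sym p c) (metric_sym p m).
  by lra.
have [Va Vb _ _] := e.
have ip c : seg m p c -> seg p q c by move=> /segC; exact: seg_incl_left.
have iq c : seg m q c -> seg p q c by exact: seg_incl_right.
case: (ex p Vp) (ex q Vq) => [h1|h1] [h2|h2].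
- by case: (no a).
- by split; [exact: ip|exact: iq].
- by split; [exact: iq|exact: ip].
- by case: (no b).
Qed.

End TreesInD.

(** * Equivariant maps between trees of D *)

Section EquivariantMaps.
Variables (R : realType) (G : groupType) (T1 T2 : gTree R G).
Hypotheses (D1 : in_D T1) (D2 : in_D T2).
Local Notation d := mdist.
Local Notation V := (@gt_vert R G _).

(** If s generates the stabilizer of a representative v, then alpha(s) is elliptic and fixes a
    vertex q; sending v to q extends equivariantly over the orbit of v. With alpha = id this
    compares two trees of D, with alpha = phi^-1 it yields a quasi-inverse of f. *)
Lemma equivariant_map (alpha : G -> G) n (e : 'I_n -> T1 * T1) :
  group_hom alpha -> (forall g, elliptic T1 g -> elliptic T2 (alpha g)) ->
  edge_cover e ->
  exists (tau : T1 -> T2) (K : R), [/\ 0 < K,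
    forall v, V v -> V (tau v),
    forall g v, V v -> tau (gt_act g v) = gt_act (alpha g) (tau v)
  & forall u v, V u -> V v -> d (tau u) (tau v) <= K * d u v].
Proof.
move=> aM ell eC; have [v0 _] := exists_vertex D1; have [w0 Vw0] := exists_vertex D2.
have A1 := in_D_action D1; have A2 := in_D_action D2.
pose O (x : T1) := [set y | exists g, y = gt_act g x].
pose rep x := xget v0 (O x).
have repP x : O x (rep x) by apply: (@xgetPex _ v0 (O x)); exists x, 1%g; rewrite act1.
have repE g x : rep (gt_act g x) = rep x.
  congr (xget v0 _); apply/seteqP; split=> y [h ->].
    by exists (h * g)%g; rewrite actM.
  by exists (h * g^-1)%g; rewrite actM // actK.
have /choice [gam gamE] : forall x, exists g, x = gt_act g (rep x).
  by move=> x; have [g ->] := repP x; exists g^-1%g; rewrite actK.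
have /choice [q qP] : forall v : T1, exists q : T2, V v ->
    V q /\ forall g, gt_act g v = v -> gt_act (alpha g) q = q.
  move=> v; have [Vv|nv] := pselect (V v); last by exists w0.
  have [s [sv _ sS]] := infinite_cyclicP (stab_cyclic D1 v).
  have [|q Vq sq] := @elliptic_vertex _ _ _ D2 (alpha s); first by apply: ell; exists v.
  exists q => _; split=> // g /sS[k ->]; rewrite hom_expgz //; exact: act_expgz.
pose tau x := gt_act (alpha (gam x)) (q (rep x)).
have Vrep v : V v -> V (rep v).
  by rewrite {1}(gamE v); exact: act_vertexV.
have tauE g v : V v -> tau (gt_act g v) = gt_act (alpha g) (tau v).
  move=> Vv; have [_ qf] := qP _ (Vrep _ Vv).
  have : gt_act ((g * gam v)^-1 * gam (gt_act g v))%g (rep v) = rep v.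
    by apply: (@act_inj _ _ _ A1 (g * gam v)%g); rewrite -actM // mulgA mulgV mul1g actM //
      -gamE -{1}(repE g v) -gamE.
  move=> /qf h; rewrite /tau repE -[gam (gt_act g v)](mulVKg (g * gam v)%g).
  by rewrite aM actM // h aM actM.
have Vtau v : V v -> V (tau v).
  by move=> /Vrep /qP[Vq _]; exact: act_vertex.
have [a [b [a0 b0 ab]]] := edge_bounds D1 eC; have [eE eO] := eC.
(* The + 1 provides the positivity that [finite_positive_bounds] asks for, since tau may send both
   ends of an edge to one vertex. *)
have [i|l [L [_ L0 hL]]] := @finite_positive_bounds R n
    (fun i => d (tau (e i).1) (tau (e i).2) + 1).
  by have := mdist_ge0 (tau (e i).1) (tau (e i).2); lra.
exists tau, (L / a); split=> //; first exact: divr_gt0.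
apply: (lipschitz_vertices (in_D_simplicial D1)); first by rewrite divr_ge0 // ltW.
move=> u v euv; have /andP[auv _] := ab _ _ euv.
have dL : d (tau u) (tau v) <= L.
  have [i oi] := eO _ _ euv; have /andP[_ hi] := hL i; have [V1 V2 _ _] := eE i.
  have : d (tau (e i).1) (tau (e i).2) <= L by lra.
  by case: oi => g [[/= <- <-]|[/= <- <-]]; rewrite !tauE // act_isom // metric_sym.
apply: le_trans dL _; by rewrite -mulrA ler_peMr ?(ltW L0) // mulrC ler_pdivlMr // mul1r.
Qed.

(** By minimality the segments joining the images of neighbouring vertices cover T2. Up to
    translation an edge of T2 then lies in one of the finitely many segments coming from the edges e
    i, and each of these contains finitely many vertices. *)
Lemma edge_cover_image n (e : 'I_n -> T1 * T1) (tau : T1 -> T2) (u0 v0 : T1) :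
  edge_cover e -> edge V u0 v0 -> (forall v, V v -> V (tau v)) ->
  (forall g v, V v -> tau (gt_act g v) = gt_act g (tau v)) ->
  exists n' (e' : 'I_n' -> T2 * T2), edge_cover e'.
Proof.
move=> [eE eO] e0 Vtau tauE; have A1 := in_D_action D1; have A2 := in_D_action D2.
have S1 := in_D_simplicial D1; have tT2 := in_D_real_tree D2.
pose Y := [set z | exists u v, edge V u v /\ seg (tau u) (tau v) z].
have Ytau a : V a -> Y (tau a).
  by move=> /(exists_edge D1 e0) [a' ea]; exists a, a'; split=> //; exact: seg_left.
have Yvert a u : V a -> V u -> seg (tau u) (tau a) `<=` Y.
  move=> Va Vu; move: u Vu; apply: (vertex_ind S1 Va).
    by move=> z /segxx ->; exact: Ytau.
  move=> u u' Vu eu _ IH z /(seg_union tT2 (tau u'))[h|/IH //].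
  by exists u, u'.
have Ycone a x : V a -> Y x -> seg x (tau a) `<=` Y.
  move=> Va [u [v [euv xuv]]] z /(seg_union tT2 (tau u))[h|].
    exists u, v; split=> //; apply: (seg_convex tT2 xuv (seg_left _ _)) h.
  by apply: Yvert => //; case: euv.
have YT : Y = setT.
  apply: (in_D_minimal D2).
  - by exists (tau u0); apply: Ytau; case: e0.
  - move=> x y Yx Yy z /(seg_union tT2 (tau u0)) [h|/segC h].
      by apply: Ycone Yx _ h; case: e0.
    by apply: Ycone Yy _ h; case: e0.
  - move=> g x [u [v [euv xuv]]]; exists (gt_act g u), (gt_act g v).
    have [Vu Vv _ _] := euv.
    by split; [exact: act_edge|rewrite !tauE //; exact: act_seg].
pose B := [set p : T2 * T2 | edge V p.1 p.2 /\
  exists i, seg (tau (e i).1) (tau (e i).2) p.1 /\ seg (tau (e i).1) (tau (e i).2) p.2].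
have fB : finite_set B.
  pose F i := V `&` seg (tau (e i).1) (tau (e i).2).
  apply: (@sub_finite_set _ _ (\bigcup_(i in [set: 'I_n]) (F i `*` F i))).
    by move=> [a b] [[/= Va Vb _ _] [i [h1 h2]]]; exists i.
  apply: bigcup_finite => [|i _]; first exact: finite_finset.
  by have [_ _ fin _ _] := in_D_simplicial D2; apply: finite_setX; exact: fin.
have [s sB] := (finite_seqP _).1 fB.
exists (size s), (tnth (in_tuple s)); split.
  move=> i; have : B (tnth (in_tuple s) i) by rewrite sB /=; exact: mem_tnth.
  by case.
move=> a b eab; have [m am nm] := edge_interior D2 eab.
have : Y m by rewrite YT.
move=> [u [v [euv muv]]]; have [i [g hg]] := eO _ _ euv.
have [V1 V2 _ _] := eE i.
have mi : seg (tau (e i).1) (tau (e i).2) (gt_act g^-1%g m).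
  apply: (act_segV A2); rewrite -!tauE //.
  by case: hg => -[/= -> ->] //; rewrite segCE.
have nm' : ~ V (gt_act g^-1%g m) by move=> /(act_vertexV D2).
have eab' := act_edge D2 g^-1%g eab.
have [h1 h2] := interior_seg D2 (Vtau _ V1) (Vtau _ V2) eab' (act_seg A2 g^-1%g am) nm' mi.
have : B (gt_act g^-1%g a, gt_act g^-1%g b) by split=> //; exists i.
rewrite sB /= => /seq_tnthP[j ej]; exists j, g; left.
by rewrite -ej /= !actKV.
Qed.

End EquivariantMaps.

(** * Train track maps *)

Lemma bernoulli (R : realType) (L : R) (n : nat) : 1 < L -> 1 + n%:R * (L - 1) <= L ^+ n.
Proof.
move=> L1; elim: n => [|n IH]; first by rewrite mul0r addr0 expr0.
rewrite exprS -natr1; have : 0 <= (L - 1) * (n%:R * (L - 1)).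
  by rewrite !mulr_ge0 // subr_ge0 ltW.
have : L * (1 + n%:R * (L - 1)) <= L * L ^+ n by rewrite ler_pM2l //; lra.
by lra.
Qed.

Lemma linear_lt_exponential (R : realType) (L a b c : R) : 1 < L -> 0 < c ->
  exists n : nat, a * n%:R + b < c * L ^+ n.
Proof.
move=> L1 c0; pose k := c * (L - 1) ^+ 2.
have k0 : 0 < k by rewrite mulr_gt0 // exprn_gt0 // subr_gt0.
pose m := (Num.bound ((2 * `|a| + `|b|) / k)).+1.
have hm : 2 * `|a| + `|b| < m%:R * k.
  have h0 : 0 <= (2 * `|a| + `|b|) / k by rewrite divr_ge0 ?(ltW k0) // addr_ge0 // mulr_ge0.
  by rewrite -ltr_pdivrMr //; apply: lt_trans (archi_boundP h0) _; rewrite ltr_nat.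
have m1 : (1 : R) <= m%:R by rewrite ler1n.
(* An even exponent allows the Bernoulli inequality to be squared: quadratic growth in m beats the
   linear term. *)
exists (m + m)%N; have h := bernoulli m L1.
have ge0 : 0 <= m%:R * (L - 1) by rewrite mulr_ge0 // subr_ge0 ltW.
have : (m%:R * (L - 1)) * (m%:R * (L - 1)) <= L ^+ m * L ^+ m.
  by apply: ler_pM => //; lra.
rewrite -exprD => h2; have : c * ((m%:R * (L - 1)) * (m%:R * (L - 1))) <= c * L ^+ (m + m).
  by rewrite ler_pM2l.
have -> : c * (m%:R * (L - 1) * (m%:R * (L - 1))) = m%:R * (m%:R * k) by rewrite /k; ring.
have : m%:R * (2 * `|a| + `|b|) < m%:R * (m%:R * k) by rewrite ltr_pM2l //; lra.
rewrite natrD; have : a * (m%:R + m%:R) <= `|a| * (m%:R + m%:R).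
  by rewrite ler_wpM2r ?ler_norm //; lra.
have : 1 * `|b| <= m%:R * `|b| by rewrite ler_wpM2r.
by have := ler_norm b; lra.
Qed.

Section TrainTracks.
Variables (R : realType) (G : groupType) (T : gTree R G).
Hypothesis TD : in_D T.
Variables (phi : G -> G) (f : T -> T) (lam : R).
Hypotheses (phiA : automorphism phi) (fphi : represents f phi).
Hypotheses (lam1 : 1 < lam) (fU : uniform_tree_map lam f).
Local Notation d := mdist.
Local Notation act := (@gt_act R G T).
Local Notation V := (@gt_vert R G T).
Local Notation edge := (edge V).
Implicit Types (x y z p u v w : T) (g h : G).

Let sV := in_D_simplicial TD.
Let aT := in_D_action TD.
Let tT := in_D_real_tree TD.
Let lam0 : 0 < lam. Proof. exact: lt_trans ltr01 lam1. Qed.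

Lemma map_vertex v : V v -> V (f v). Proof. by case: fU => h _; exact: h. Qed.

Lemma map_vertex_iter n v : V v -> V (iter n f v).
Proof. by move=> Vv; elim: n => //= n; exact: map_vertex. Qed.

Lemma map_edge_mdist u v x y : edge u v -> seg u v x -> seg u v y ->
  d (f x) (f y) = lam * d x y.
Proof. by case: fU => _; apply. Qed.

Lemma map_lipschitz x y : d (f x) (f y) <= lam * d x y.
Proof.
apply: (lipschitz_cells sV); first exact: ltW.
by move=> u v a b e ha hb; rewrite (map_edge_mdist e ha hb).
Qed.

Lemma map_lipschitz_iter n x y : d (iter n f x) (iter n f y) <= lam ^+ n * d x y.
Proof.
elim: n => [|n IH]; first by rewrite expr0 mul1r.
by rewrite exprS -mulrA; apply: le_trans (map_lipschitz _ _) _; rewrite ler_pM2l.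
Qed.

Lemma represents_iter n g x : iter n f (act g x) = act (iter n phi g) (iter n f x).
Proof. by elim: n => //= n ->; rewrite fphi. Qed.

Lemma crosses_seg x y z u u' : crosses x y z u u' -> seg x y z.
Proof. by move=> [_ [p [_ _ h]] _]; apply: h; exact: seg_left. Qed.

Lemma crosses_sub x y x' y' z u u' : seg x y `<=` seg x' y' ->
  crosses x y z u u' -> crosses x' y' z u u'.
Proof.
move=> s [t [p [h1 h2 h3]] [p' [h1' h2' h3']]]; split=> //.
  by exists p; split=> //; exact: subset_trans s.
by exists p'; split=> //; exact: subset_trans s.
Qed.

Lemma crosses_shrink x y c z u u' : crosses x y z u u' -> seg x y c -> seg x c z -> z <> c ->
  crosses x c z u u'.
Proof.
move=> cr xyc xcz zc; have xyz := crosses_seg cr; case: cr => t hu hu'.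
have zc0 : 0 < d z c by rewrite mdist_gt0; apply/eqP.
suff H v : (exists p, [/\ p <> z, seg z v p & seg z p `<=` seg x y]) ->
    exists p, [/\ p <> z, seg z v p & seg z p `<=` seg x c].
  by split=> //; exact: H.
move=> [p [pz zvp zp]].
have pz0 : 0 < d z p by rewrite mdist_gt0; apply/eqP; exact: nesym.
have [q zpq eq] : exists2 q, seg z p q & d z q = Num.min (d z p) (d z c).
  by apply: tree_point => //; rewrite le_min !mdist_ge0 ge_min lexx.
exists q; split.
- move=> e; have : 0 < d z q by rewrite eq lt_min pz0.
  by rewrite e mdistxx ltxx.
- exact: seg_incl_left zvp _ zpq.
- apply: (seg_convex tT) => //; have xyq := zp _ zpq.
  have le : d x q <= d x c.
    have : d z q <= d z c by rewrite eq ge_min lexx orbT.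
    by move: xcz; rewrite segE; have := metric_triangle x z q; lra.
  by have [] := seg_order tT xyq xyc le.
Qed.

Lemma crosses_seg_sym x y z u u' : crosses x y z u u' -> crosses y x z u u'.
Proof. by apply: crosses_sub; rewrite segCE. Qed.

Lemma legal_sub x y x' y' : seg x y `<=` seg x' y' ->
  legal_segment f x' y' -> legal_segment f x y.
Proof. by move=> s h z u u' /(crosses_sub s)/h. Qed.

Lemma legal_act g x y : legal_segment f (act g x) (act g y) -> legal_segment f x y.
Proof.
move=> L z u u' [[e e' ne] [p [h1 h2 h3]] [p' [h1' h2' h3']]] [_ [n [n0 [del [del0 H]]]]].
have t : turn (act g z) (act g u) (act g u').
  by split; [exact: act_edge|exact: act_edge|move=> /(act_inj aT)].
apply: (L (act g z) (act g u) (act g u')).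
  split=> //.
    exists (act g p); split; [by move=> /(act_inj aT)|exact: act_seg|].
    by move=> q /(act_segV aT)/h3/(act_seg aT g); rewrite actKV.
  exists (act g p'); split; [by move=> /(act_inj aT)|exact: act_seg|].
  by move=> q /(act_segV aT)/h3'/(act_seg aT g); rewrite actKV.
split=> //; exists n; split=> //; exists del; split=> // q q'.
rewrite -(actKV aT g q) -(actKV aT g q'); move: (act g^-1%g q) (act g^-1%g q') => r r'.
move=> /(act_segV aT); rewrite actK // => hr /(act_segV aT); rewrite actK // => hr'.
by rewrite !act_isom // !represents_iter => e1 le; rewrite (H _ _ hr hr' e1 le).
Qed.

Hypothesis fE : forall u v, edge u v -> legal_segment f (f u) (f v).

(** Add one edge [u, c] in front of a legal [c, v]. Cancellation between the two image paths at f c,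
    or an illegal turn there, would already make the turn of [u, v] at c illegal, one iterate
    earlier. *)
Lemma legal_map u v : V u -> V v -> legal_segment f u v ->
  d (f u) (f v) = lam * d u v /\ legal_segment f (f u) (f v).
Proof.
move=> Vu Vv; move: u Vu; apply: (vertex_ind sV Vv).
  move=> _; split; first by rewrite !mdistxx mulr0.
  move=> z w w' [_ [p [pz _ h]] _]; case: pz.
  by rewrite (segxx (h _ (seg_left _ _))) (segxx (h _ (seg_right _ _))).
move=> u c Vu e ucv IH L.
have Lcv : legal_segment f c v by apply: legal_sub L; exact: seg_incl_right.
have [dcv Lfcv] := IH Lcv.
have duc : d (f u) (f c) = lam * d u c.
  by apply: (map_edge_mdist e); [exact: seg_left|exact: seg_right].
have [ecv|/eqP cv] := eqVneq c v; first by rewrite -ecv; split=> //; exact: fE.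
have [_ Vc uc _] := e; have [w ecw cvw] := next_vertex sV Vc Vv cv.
have uw : u <> w.
  move=> uw; apply: uc; apply: mdist_eq0; move: ucv cvw; rewrite -uw !segE (metric_sym c u).
  by have := mdist_ge0 u c; lra.
have legal : ~ illegal_turn f c u w.
  apply: L; split; first by split=> //; exact: edgeC.
    exists u; split=> //; first exact: seg_right.
    by rewrite segCE; exact: seg_incl_left.
  exists w; split; [by case: ecw => _ _ /nesym|exact: seg_right|].
  exact: subset_trans (seg_incl_left cvw) (seg_incl_right ucv).
have fcvw : seg (f c) (f v) (f w).
  rewrite segE; apply/eqP; rewrite eq_le metric_triangle andbT dcv.
  by move: cvw; rewrite segE => <-; rewrite mulrDr lerD // map_lipschitz.
have germ_u q : seg c u q -> seg (f c) (f u) (f q) /\ d (f c) (f q) = lam * d c q.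
  move=> cuq; have h := map_edge_mdist (edgeC e).
  rewrite segE (h c q (seg_left _ _) cuq) (h q u cuq (seg_right _ _)).
  by rewrite (h c u (seg_left _ _) (seg_right _ _)) -mulrDr; move: cuq; rewrite segE => ->.
have germ_w q : seg c w q -> seg (f c) (f v) (f q) /\ d (f c) (f q) = lam * d c q.
  move=> cwq; have h := map_edge_mdist ecw; split; last exact: h (seg_left _ _) cwq.
  apply: seg_incl_left fcvw _ _.
  rewrite segE (h c q (seg_left _ _) cwq) (h q w cwq (seg_right _ _)).
  by rewrite (h c w (seg_left _ _) (seg_right _ _)) -mulrDr; move: cwq; rewrite segE => ->.
(* The case n = 0 excludes an overlap of the image paths, n > 0 an illegal turn at f c. *)
have fold p p' n del : seg (f c) (f u) p -> seg (f c) (f v) p' -> 0 < del ->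
    p <> f c -> p' <> f c ->
    (forall q q', seg (f c) p q -> seg (f c) p' q' -> d (f c) q = d (f c) q' ->
      d (f c) q <= del -> iter n f q = iter n f q') -> False.
  move=> hp hp' del0 np np' H; apply: legal; split; first by split=> //; exact: edgeC.
  exists n.+1; split=> //; pose m := Num.min del (Num.min (d (f c) p) (d (f c) p')).
  have m0 : 0 < m.
    by rewrite !lt_min del0 /= !mdist_gt0; apply/andP; split; apply/eqP => e1; [apply: np|apply: np'].
  (* The radius shrinks by [lam] because f stretches both germs at c by this factor. *)
  exists (m / lam); split; first exact: divr_gt0.
  move=> q q' cuq cwq' eqq; rewrite ler_pdivlMr // mulrC => le.
  have [h1 h2] := germ_u _ cuq; have [h1' h2'] := germ_w _ cwq'.
  move: le; rewrite -h2 !le_min => /and3P[le0 le1 le2].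
  rewrite !iterSr; apply: H => //; last by rewrite h2 h2' eqq.
    by have [] := seg_order tT h1 hp le1.
  have le2' : d (f c) (f q') <= d (f c) p' by rewrite h2' -eqq -h2.
  by have [] := seg_order tT h1' hp' le2'.
have fuv : seg (f u) (f v) (f c).
  apply: (seg_concat tT); apply/seteqP; split=> [z [zu zv]|z ->]; last first.
    by split; exact: seg_left.
  apply: contrapT => /= nz.
  apply: (fold z z 0%N 1 zu zv ltr01 nz nz) => q q' hq hq' eq _ /=.
  exact: (seg_uniq tT hq hq').
split; first by move: fuv ucv; rewrite !segE => <- <-; rewrite duc dcv mulrDr.
move=> z a b cr il; have zuv := crosses_seg cr.
have Luc := fE e; have [zc|zc] := pselect (z = f c); last first.
  case: (seg_union tT (f c) zuv) => h.
    exact: Luc (crosses_shrink cr fuv h zc) il.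
  exact: Lfcv (crosses_seg_sym (crosses_shrink (crosses_seg_sym cr) (segC fuv) (segC h) zc)) il.
case: (cr) => t [p [pz zap zp]] [p' [pz' zbp' zp']].
have side q : seg z q `<=` seg (f u) (f v) ->
    seg z q `<=` seg (f u) (f c) \/ seg z q `<=` seg (f c) (f v).
  move=> h; have := h _ (seg_right _ _) => /(seg_union tT (f c))[hq|hq]; [left|right].
    by apply: (seg_convex tT) => //; rewrite zc; exact: seg_right.
  by apply: (seg_convex tT) => //; rewrite zc; exact: seg_left.
have [t1 [n [n0 [del [del0 H]]]]] := il.
case: (side _ zp) (side _ zp') => [s|s] [s'|s'].
- by apply: (Luc z a b) il; split=> //; [exists p|exists p'].
- apply: (fold p p' n del) => //; rewrite -?zc //.
  + by rewrite zc; apply: segC; apply: s; exact: seg_right.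
  + by rewrite zc; apply: s'; exact: seg_right.
  + move=> q q' hq hq'; apply: H; [exact: seg_incl_left zap _ hq|exact: seg_incl_left zbp' _ hq'].
- apply: (fold p' p n del) => //; rewrite -?zc //.
  + by rewrite zc; apply: segC; apply: s'; exact: seg_right.
  + by rewrite zc; apply: s; exact: seg_right.
  + move=> q q' hq hq' eq le; apply/esym/H; rewrite -?eq //.
      exact: seg_incl_left zap _ hq'.
    exact: seg_incl_left zbp' _ hq.
- by apply: (Lfcv z a b) il; split=> //; [exists p|exists p'].
Qed.

Lemma edge_iter n u v : edge u v ->
  d (iter n.+1 f u) (iter n.+1 f v) = lam ^+ n.+1 * d u v /\
  legal_segment f (iter n.+1 f u) (iter n.+1 f v).
Proof.
move=> e; have [Vu Vv _ _] := e; elim: n => [|n [dn Ln]].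
  split; last exact: fE.
  by rewrite expr1 /= (map_edge_mdist e) //; [exact: seg_left|exact: seg_right].
have := legal_map (map_vertex_iter n.+1 Vu) (map_vertex_iter n.+1 Vv) Ln.
by rewrite dn mulrA -exprS.
Qed.

(** The Lipschitz bounds for [u, x], [x, y] and [y, v] add up to the exact distance of the images of
    u and v, so none of them can be strict. *)
Lemma edge_expand n u v x y : edge u v -> seg u v x -> seg u v y ->
  d (iter n f x) (iter n f y) = lam ^+ n * d x y.
Proof.
move=> e ux uy; case: n => [|n]; first by rewrite expr0 mul1r.
wlog le : x y ux uy / d u x <= d u y.
  move=> H; have [le|/ltW le] := leP (d u x) (d u y); first exact: H.
  by rewrite metric_sym (metric_sym x); exact: H.
have [uyx xvy] := seg_order tT ux uy le; have [h _] := edge_iter n e.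
apply/eqP; rewrite eq_le map_lipschitz_iter /=.
have := map_lipschitz_iter n.+1 u x; have := map_lipschitz_iter n.+1 y v.
have := metric_triangle (iter n.+1 f u) (iter n.+1 f x) (iter n.+1 f v).
have := metric_triangle (iter n.+1 f x) (iter n.+1 f y) (iter n.+1 f v).
move: uyx uy; rewrite !segE => e1 e2.
have : lam ^+ n.+1 * d u v = lam ^+ n.+1 * d u x + lam ^+ n.+1 * d x y + lam ^+ n.+1 * d y v.
  by rewrite -e2 -e1 !mulrDr.
by lra.
Qed.

(* On a line the long legal segments f^n(e) would contain a translate of every
   segment, so f would be a homothety and the translation lengths of the
   elements phi^-n(g) would tend to zero. *)
Lemma train_track_not_line n (e : 'I_n -> T * T) g :
  edge_cover e -> ~ elliptic T g -> ~ forall z, axial g z.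
Proof.
move=> eC ng ax; have [v Vv] := exists_vertex TD.
have [p gp _] := axis_base_exists tT aT v ng; have [l0 _] := gp.
set l := d p (act g p) in l0.
have line (K i : int) : 0 <= K -> - K <= i <= K ->
    seg (act (expgz g (- K)) p) (act (expgz g K) p) (act (expgz g i) p) /\
    d (act (expgz g (- K)) p) (act (expgz g i) p) = (i + K)%:~R * l.
  move=> K0 /andP[h1 h2]; rewrite segE !(axis_base_dist tT aT) // -/l -mulrDl -intrD.
  by split; last congr (_%:~R * _); [congr (_%:~R * _)|]; lia.
(* A legal segment of this length contains a translate, by a power of g, of the window from g^-k p
   to g^k p. The window has length 2 k l; the extra 2 l absorbs the rounding of A to the next point
   of the orbit of p. *)
have big A B (k : nat) x y : legal_segment f A B -> (2 * k%:R + 2) * l <= d A B ->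
    seg (act (expgz g (- k%:Z)) p) (act (expgz g k%:Z) p) x ->
    seg (act (expgz g (- k%:Z)) p) (act (expgz g k%:Z) p) y -> legal_segment f x y.
  move=> L long kx ky; have [k1 h1] := ax A p; have [k2 h2] := ax B p.
  pose K := maxn k1 k2; have := h1 K (leq_maxl _ _); have := h2 K (leq_maxr _ _).
  move=> {h1 h2}; set P := act (expgz g (- K%:Z)) p; set Q := act (expgz g K%:Z) p => hB hA.
  wlog le : A B L long hA hB / d P A <= d P B.
    move=> H; have [le|/ltW le] := leP (d P A) (d P B); first exact: (H A B).
    apply: (H B A) => //; last by rewrite metric_sym.
    by apply: legal_sub L; rewrite segCE.
  have dAB := seg_mdist tT hA hB le.
  have [_ dPQ] := line K K isT (ltac:(lia) : - K%:Z <= K%:Z <= K%:Z).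
  have [t t1 t2] : exists2 t : nat, t%:R * l <= d P A & d P A < t%:R * l + l.
    have /Num.Theory.truncn_itv /andP[t1 t2] : 0 <= d P A / l.
      by rewrite divr_ge0 ?mdist_ge0 // ltW.
    exists (Num.trunc (d P A / l)); first by rewrite -ler_pdivlMr.
    by rewrite -[X in _ + X]mul1r -mulrDl natr1 -ltr_pdivrMr.
  have dB := seg_le_left hB; rewrite dPQ -PoszD -pmulrn natrD in dB.
  have tK : (t + 1 + (k + k) <= K + K)%N.
    have : (t + 1 + (k + k))%N%:R * l <= (K + K)%N%:R * l by rewrite !natrD; lra.
    by rewrite ler_pM2r // ler_nat.
  have pt (i : nat) : (i <= K + K)%N -> d P A <= i%:R * l -> i%:R * l <= d P B ->
      seg A B (act (expgz g (i%:Z - K%:Z)) p).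
    move=> iK l1 l2; have [||h e1] := line K (i%:Z - K%:Z); [by []|by clear -iK; lia|].
    rewrite subrK -pmulrn -/P in e1; rewrite -e1 in l1 l2.
    have [h3 _] := seg_order tT h hB l2.
    have [h4 _] := seg_order tT hA hB le.
    by have [] := seg_order tT h4 h3 l1.
  have kl0 : 0 <= k%:R * l by rewrite mulr_ge0 // ltW.
  (* With P = g^-K p as origin, g^(t + 1 - K) p is the first point of the orbit beyond A; g^j moves
     the left end of the window there. *)
  pose j := t%:Z + 1 + k%:Z - K%:Z.
  apply: (@legal_act (expgz g j)); apply: legal_sub L.
  have inAB z : seg (act (expgz g (- k%:Z)) p) (act (expgz g k%:Z) p) z ->
      seg A B (act (expgz g j) z).
    move=> /(act_seg aT (expgz g j)); rewrite -!actM // -!expgzD.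
    apply: (seg_convex tT).
      have -> : j + - k%:Z = (t + 1)%N%:Z - K%:Z by rewrite /j; clear; lia.
      by apply: pt; [clear -tK; lia|rewrite natrD; lra|rewrite natrD; lra].
    have -> : j + k%:Z = (t + 1 + (k + k))%N%:Z - K%:Z by rewrite /j; clear; lia.
    by apply: pt; [clear -tK; lia|rewrite !natrD; lra|rewrite !natrD; lra].
  by apply: (seg_convex tT); exact: inAB.
have Lxy x y : legal_segment f x y.
  have [k1 h1] := ax x p; have [k2 h2] := ax y p.
  have gvv : v <> act g v by move=> e1; apply: ng; exists v.
  have [b eb _] := next_vertex sV Vv (act_vertex TD g Vv) gvv.
  have [m hm] := linear_lt_exponential 0 ((2 * (maxn k1 k2)%:R + 2) * l) lam1 (edge_mdist_gt0 eb).
  have [dm Lm] := edge_iter m eb.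
  apply: (big _ _ _ x y Lm _ (h1 _ (leq_maxl _ _)) (h2 _ (leq_maxr _ _))).
  move: hm; rewrite mul0r add0r dm => /ltW hm; apply: le_trans hm _.
  rewrite mulrC ler_pM2r ?(edge_mdist_gt0 eb) // exprS.
  by rewrite ler_peMl ?exprn_ge0 ?(ltW lam0) ?(ltW lam1).
have hom m u w : V u -> V w -> d (iter m f u) (iter m f w) = lam ^+ m * d u w.
  move=> Vu Vw; elim: m => [|m IH]; first by rewrite expr0 mul1r.
  have [-> _] := legal_map (map_vertex_iter m Vu) (map_vertex_iter m Vw) (Lxy _ _).
  by rewrite IH exprS mulrA.
have [a [b [a0 _ ab]]] := edge_bounds TD eC.
(* phi^-m(g) moves the vertex v by at least the shortest edge length a. So g moves f^m(v) by at
   least [lam] ^ m times a, more than l, although on a line it moves each point by at most l. *)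
have [m] := linear_lt_exponential 0 l lam1 a0; rewrite mul0r add0r => lm.
have [pM [phi' pK qK]] := automorphism_iter m phiA.
pose h := phi' g; have nh : v <> act h v.
  move=> e1; apply: ng; exists (iter m f v).
  by rewrite -[g]qK -/h -represents_iter -e1.
have [w ew /seg_le_left le1] := next_vertex sV Vv (act_vertex TD h Vv) nh.
have /andP[aw _] := ab _ _ ew.
have := hom m v (act h v) Vv (act_vertex TD h Vv); rewrite represents_iter qK.
set z := iter m f v => dz.
have dl : d z (act g z) <= l.
  have [i hi] := axial_meets_translates tT aT p (ax z).
  set y := act (expgz g i) z in hi.
  have -> : d z (act g z) = d y (act g y).
    have c : (g * expgz g i = expgz g i * g)%g.
      by have := expgzD g 1 i; have := expgzD g i 1; rewrite addrC expgz1 => -> ->.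
    by rewrite /y -(actM aT g) c actM // act_isom.
  have := metric_triangle y (act g p) (act g y); rewrite (act_isom aT).
  by move: hi; rewrite segE -/l; lra.
have : lam ^+ m * a <= lam ^+ m * d v (act h v).
  by rewrite ler_pM2l ?exprn_gt0 //; exact: le_trans le1.
by rewrite mulrC in lm *; lra.
Qed.

End TrainTracks.

(** * Dynamics of a train track map *)

Section OrbitBounds.
Variables (R : realType) (G : groupType).
Local Notation d := mdist.
Local Notation V := (@gt_vert R G _).

Lemma orbit_bound (T1 T2 : gTree R G) n (e : 'I_n -> T1 * T1) (p1 : T1) (p2 : T2) :
  in_D T1 -> in_D T2 -> edge_cover e -> (forall g, elliptic T1 g -> elliptic T2 g) ->
  exists K C : R, 0 < K /\
    forall g, d p2 (gt_act g p2) <= K * d p1 (gt_act g p1) + C.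
Proof.
move=> D1 D2 eC ell.
have [tau [K [K0 Vt tE tK]]] := equivariant_map D1 D2 (alpha := id) (fun _ _ => erefl) ell eC.
have [v Vv] := exists_vertex D1; have A1 := in_D_action D1; have A2 := in_D_action D2.
exists K, (2 * d p2 (tau v) + K * (2 * d p1 v)); split=> // g.
have := tK _ _ Vv (act_vertex D1 g Vv); rewrite tE //.
have : d v (gt_act g v) <= 2 * d p1 v + d p1 (gt_act g p1).
  have := metric_triangle v p1 (gt_act g v).
  have := metric_triangle p1 (gt_act g p1) (gt_act g v).
  by rewrite act_isom // (metric_sym v p1); lra.
rewrite -(ler_pM2l K0) mulrDr.
have := metric_triangle p2 (tau v) (gt_act g p2).
have := metric_triangle (tau v) (gt_act g (tau v)) (gt_act g p2).
by rewrite act_isom // (metric_sym _ p2); lra.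
Qed.

Lemma infinite_cyclic_is_Z : infinite_cyclic (@setT G) -> is_Z G.
Proof.
move=> [F [FM Fi Fr]]; exists F; split=> //.
have /choice [k kE] : forall g, exists n, F n = g.
  by move=> g; have : [set: G] g by []; rewrite -Fr => -[n _ <-]; exists n.
by exists k => // n; apply: Fi.
Qed.

(** Without edges a vertex would be fixed by all of G, which would then coincide with an infinite
    cyclic stabilizer. *)
Lemma exists_edge_of_not_Z (T : gTree R G) : in_D T -> ~ is_Z G ->
  exists u v : T, edge V u v.
Proof.
move=> TD nZ; have [v Vv] := exists_vertex TD.
apply: contrapT => ne; apply: nZ; apply: infinite_cyclic_is_Z.
have av g : gt_act g v = v.
  apply: contrapT => /nesym gv.
  have [w ew _] := next_vertex (in_D_simplicial TD) Vv (act_vertex TD g Vv) gv.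
  by apply: ne; exists v, w.
suff <- : [set g | gt_act g v = v] = setT by exact: stab_cyclic.
by apply/seteqP; split=> g _ //; exact: av.
Qed.

End OrbitBounds.

(** * Roots of an element under iterates of an automorphism *)

Lemma gcdn_exp_stationary a b : (0 < a)%N -> exists k, (gcdn a (b ^ k.+1) %| b ^ k)%N.
Proof.
move=> a0; apply: contrapT => no.
(* The gcd of a and b^k increases with k for divisibility. If it never became stationary it would
   exceed k for every k, in particular a for k = a. *)
have lt k : (k < gcdn a (b ^ k)%N)%N.
  elim: k => [|k IH]; first by rewrite gcdn1.
  apply: leq_ltn_trans IH _; rewrite ltn_neqAle; apply/andP; split.
    apply/eqP => e; apply: no; exists k.
    by rewrite -e dvdn_gcdr.
  apply: dvdn_leq; first by rewrite gcdn_gt0 a0.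
  by rewrite dvdn_gcd dvdn_gcdl /= expnS dvdn_mull // dvdn_gcdr.
by have := lt a; rewrite ltnNge dvdn_leq // dvdn_gcdl.
Qed.

Lemma gcdz_exp_stationary (a b : int) : a != 0 ->
  exists k : nat, (gcdz a (b ^+ k.+1) %| b ^+ k)%Z.
Proof.
move=> a0; have [|k hk] := @gcdn_exp_stationary `|a| `|b|; first by rewrite absz_gt0.
by exists k; rewrite dvdzE /gcdz /= !abszX.
Qed.

Section RootDescent.
Variables (G : groupType) (H : set G).
Hypotheses (HM : forall x y, H x -> H y -> H (x * y)%g) (HV : forall x, H x -> H x^-1%g).

Lemma subgroup_expgz x n : H x -> H (expgz x n).
Proof.
move=> Hx; have H1 : H 1%g by rewrite -(mulgV x); apply: HM => //; exact: HV.
elim/int_rec: n => [//|n IH|n IH]; first by rewrite intSr expgzS; exact: HM.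
by rewrite intSr opprD expgzP; apply: HM => //; exact: HV.
Qed.

Lemma expgz_iter (Psi : G -> G) s (J : int) (n : nat) : group_hom Psi ->
  Psi s = expgz s J -> iter n Psi s = expgz s (J ^+ n).
Proof.
move=> TM Ts; elim: n => [|n IH]; first by rewrite expr0.
by rewrite iterS IH hom_expgz // Ts -expgzM exprS.
Qed.

(* Since r 1 = (r k.+1)^(J^k) and s = (r k.+1)^(J^k.+1), it suffices to take k such
   that gcd(N, J^k.+1) divides J^k. *)
Lemma root_descent (Psi : G -> G) s (J N : int) (r : nat -> G) :
  automorphism Psi -> Psi s = expgz s J -> (forall n, iter n Psi (r n) = s) ->
  N != 0 -> H s -> (forall n, H (expgz (r n) N)) -> H (r 1%N).
Proof.
move=> TA Ts rs N0 Hs HN; have [TM _] := TA.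
have inj n : injective (iter n Psi).
  by have [_ /bij_inj] := automorphism_iter n TA.
have hexp n x m : iter n Psi (expgz x m) = expgz (iter n Psi x) m.
  by apply: hom_expgz; exact: group_hom_iter.
have rJ n : expgz (r n) (J ^+ n) = s.
  by apply: (inj n); rewrite hexp rs (expgz_iter _ TM Ts).
have [k hk] := gcdz_exp_stationary J N0.
have r1 : r 1%N = expgz (r k.+1) (J ^+ k).
  apply: (inj k.+1); rewrite hexp rs -(expgz_iter _ TM Ts) -(rs 1%N).
  by rewrite -iterSr.
have [a [b ab]] := Bezoutz N (J ^+ k.+1).
move: hk => /dvdzP[q hq]; rewrite r1 hq -ab (mulrC q) expgzM; apply: subgroup_expgz.
rewrite expgzD (mulrC a) (mulrC b) !expgzM rJ; apply: HM; exact: subgroup_expgz.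
Qed.

End RootDescent.

Section Dynamics.
Variables (R : realType) (G : groupType) (T : gTree R G).
Hypothesis TD : in_D T.
Variables (phi : G -> G) (f : T -> T) (lam : R).
Hypotheses (phiA : automorphism phi) (fphi : represents f phi).
Hypotheses (lam1 : 1 < lam) (fU : uniform_tree_map lam f).
Hypothesis fE : forall u v, edge (@gt_vert R G T) u v -> legal_segment f (f u) (f v).
Variables (ne : nat) (e : 'I_ne -> T * T).
Hypothesis eC : edge_cover e.
Local Notation d := mdist.
Local Notation act := (@gt_act R G T).
Local Notation V := (@gt_vert R G T).
Local Notation edge := (edge V).
Implicit Types (x y z p u v w : T) (g h : G).

Let sV := in_D_simplicial TD.
Let aT := in_D_action TD.
Let tT := in_D_real_tree TD.
Let lam0 : 0 < lam. Proof. exact: lt_trans ltr01 lam1. Qed.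
Let lamn0 n : 0 < lam ^+ n. Proof. exact: exprn_gt0. Qed.

(** * Elliptic elements do not depend on the tree *)

Lemma commensurated_elliptic g : commensurated g -> elliptic T g.
Proof.
move=> cg; apply: contrapT => ng.
apply: (train_track_not_line TD phiA fphi lam1 fU fE eC ng).
exact: (commensurated_axis tT aT (in_D_minimal TD) ng cg).
Qed.

(** For T' the converse goes through T, which carries the train track map: g and a nontrivial c
    elliptic in T' are both commensurated, hence elliptic in T, hence commensurable. *)
Lemma elliptic_commensuratedP (T' : gTree R G) g :
  in_D T' -> elliptic T' g <-> commensurated g.
Proof.
move=> D'; split; first exact: elliptic_commensurated.
move=> cg; have [c ec c1] := exists_elliptic D'.
have [->|/eqP g1] := eqVneq g 1%g.
  by have [v _] := exists_vertex D'; exists v; rewrite act1 //; exact: in_D_action.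
apply: (commensurable_elliptic (in_D_real_tree D') (in_D_action D') _ ec).
apply: (elliptic_commensurable TD) => //; apply: commensurated_elliptic => //.
exact: elliptic_commensurated ec.
Qed.

Lemma loxodromicP g : loxodromic R g <-> ~ elliptic T g.
Proof.
split=> [[T' [D' h]] /(elliptic_commensuratedP _ TD)/(elliptic_commensuratedP _ D')[x]|ng].
  exact: h.
by exists T; split=> // x gx; apply: ng; exists x.
Qed.

Lemma elliptic_automorphism alpha g : automorphism alpha ->
  elliptic T g -> elliptic T (alpha g).
Proof.
move=> aA /(elliptic_commensuratedP _ TD) cg; apply/(elliptic_commensuratedP _ TD).
exact: commensurated_hom.
Qed.

Lemma nonelliptic_automorphism alpha g : automorphism alpha ->
  ~ elliptic T g -> ~ elliptic T (alpha g).
Proof.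
move=> aA ng ea; apply: ng; have [aM [alpha' aK aK']] := aA.
by rewrite -(aK g); apply: elliptic_automorphism ea; exact: automorphism_inv aA aK aK'.
Qed.

(** For tau equivariant with respect to phi^-1, the composite of f and tau commutes with G on
    vertices. It therefore moves vertices by a bounded amount, and f has a Lipschitz
    quasi-inverse. *)
Lemma fibers_bounded : exists2 B : R, 0 < B & forall x y, f x = f y -> d x y <= B.
Proof.
have [pM [phi' pK qK]] := phiA; have qA := automorphism_inv phiA pK qK.
have [tau [K [K0 Vt tE tK]]] := equivariant_map TD TD (alpha := phi') (proj1 qA)
  (fun g => elliptic_automorphism qA (g := g)) eC.
have [a [b [a0 b0 ab]]] := edge_bounds TD eC; have [eE eO] := eC.
have [i|l [L [_ L0 hL]]] := @finite_positive_bounds R ne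
    (fun i => d (e i).1 (tau (f (e i).1)) + d (e i).2 (tau (f (e i).2)) + 1).
  have := mdist_ge0 (e i).1 (tau (f (e i).1)).
  by have := mdist_ge0 (e i).2 (tau (f (e i).2)); lra.
have tf g v : V v -> tau (f (act g v)) = act g (tau (f v)).
  by move=> Vv; rewrite fphi tE ?pK //; exact: map_vertex fU _ Vv.
have [v0 Vv0] := exists_vertex TD.
have near x : exists v, [/\ V v, d x v <= b & d v (tau (f v)) <= L + d v0 (tau (f v0))].
  case: (vertex_or_edge sV x) => [Vx|[u [v [euv ux _]]]]; last first.
    have [Vu Vv _ _] := euv; exists u; split=> //.
      have /andP[_ h] := ab _ _ euv; apply: le_trans h.
      by rewrite metric_sym; exact: seg_le_left.
    have [i [g oi]] := eO _ _ euv; have [V1 V2 _ _] := eE i; have /andP[_ hi] := hL i.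
    have h1 := mdist_ge0 (e i).1 (tau (f (e i).1)).
    have h2 := mdist_ge0 (e i).2 (tau (f (e i).2)).
    have h3 := mdist_ge0 v0 (tau (f v0)).
    by case: oi => -[/= E1 E2]; [rewrite -E1|rewrite -E2]; rewrite tf // act_isom //; lra.
  have [->|/eqP xv] := eqVneq x v0.
    by exists v0; split=> //; rewrite ?mdistxx ?(ltW b0) // lerDr ltW.
  have [w ew _] := next_vertex sV Vx Vv0 xv.
  exists x; split=> //; first by rewrite mdistxx ltW.
  have [i [g oi]] := eO _ _ ew; have [V1 V2 _ _] := eE i; have /andP[_ hi] := hL i.
  have h1 := mdist_ge0 (e i).1 (tau (f (e i).1)).
  have h2 := mdist_ge0 (e i).2 (tau (f (e i).2)).
  have h3 := mdist_ge0 v0 (tau (f v0)).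
  by case: oi => -[/= E1 E2]; [rewrite -E1|rewrite -E2]; rewrite tf // act_isom //; lra.
have t0 := mdist_ge0 v0 (tau (f v0)).
(* The path x, v, tau (f v), tau (f w), w, y: [near] bounds the two legs at either end, and f v, f w
   are at distance at most [lam] times 2 b because f x = f y. *)
exists (2 * b + 2 * (L + d v0 (tau (f v0))) + K * (lam * (2 * b))).
  by rewrite !addr_gt0 ?mulr_gt0 //; lra.
move=> x y fxy; have [v [Vv xv vt]] := near x; have [w [Vw yw wt]] := near y.
have h1 : d (f v) (f w) <= lam * (2 * b).
  have := map_lipschitz TD lam1 fU v x; have := map_lipschitz TD lam1 fU y w.
  have := metric_triangle (f v) (f x) (f w); rewrite fxy => h1 h2 h3.
  have : lam * (d v x + d y w) <= lam * (2 * b).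
    by rewrite ler_pM2l // (metric_sym v x); lra.
  by rewrite mulrDr; lra.
have := tK _ _ (map_vertex fU Vv) (map_vertex fU Vw).
move: h1; rewrite -(ler_pM2l K0).
have := metric_triangle x v y; have := metric_triangle v w y.
have := metric_triangle v (tau (f v)) w; have := metric_triangle (tau (f v)) (tau (f w)) w.
by rewrite (metric_sym w y) (metric_sym (tau (f w)) w); lra.
Qed.

(** By [seg_IVT] both [x, z] and [z, y] contain a point sent to the projection m of f z. These two
    points lie in one fiber and z is between them. *)
Lemma bounded_backtracking : exists2 B : R, 0 < B & forall x y z, seg x y z ->
  forall m, (forall w, seg (f x) (f y) w -> seg (f z) w m) -> seg (f x) (f y) m ->
  d (f z) m <= B.
Proof.
have [B B0 hB] := fibers_bounded; exists (lam * B); first exact: mulr_gt0.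
move=> x y z xyz m pm xym; have L := map_lipschitz TD lam1 fU.
have [a xza am] := seg_IVT tT lam0 L (segC (pm _ (seg_left _ _))).
have [b zyb bm] := seg_IVT tT lam0 L (pm _ (seg_right _ _)).
have h : d a b <= B by apply: hB; rewrite am bm.
rewrite -am; apply: le_trans (L _ _) _; rewrite ler_pM2l //; apply: le_trans h.
move: xza zyb xyz; rewrite !segE.
have := metric_triangle x a y; have := metric_triangle a b y.
have := mdist_ge0 z b; rewrite (metric_sym z a).
by lra.
Qed.

(** The metric counterpart of legality: f^n is [lam] ^ n - Lipschitz, and equality for all n
    excludes folding. It passes to subsegments and images without any mention of turns. *)
Definition expanded x y := forall n, d (iter n f x) (iter n f y) = lam ^+ n * d x y.

Lemma expanded_map m x y : expanded x y -> expanded (iter m f x) (iter m f y).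
Proof. by move=> h n; rewrite -!iterD !h exprD mulrA. Qed.

Lemma expanded_sub x y a b : expanded x y -> seg x y a -> seg x y b -> expanded a b.
Proof.
move=> h; wlog le : a b / d x a <= d x b.
  move=> H ha hb n; have [le|/ltW le] := leP (d x a) (d x b); first exact: H.
  by rewrite metric_sym (metric_sym a); exact: H.
move=> ha hb n; apply/eqP; rewrite eq_le (map_lipschitz_iter TD lam1 fU) /=.
have [xba ayb] := seg_order tT ha hb le.
have := map_lipschitz_iter TD lam1 fU n x a; have := map_lipschitz_iter TD lam1 fU n b y.
have := metric_triangle (iter n f x) (iter n f a) (iter n f y).
have := metric_triangle (iter n f a) (iter n f b) (iter n f y).
have : lam ^+ n * d x y = lam ^+ n * d x a + lam ^+ n * d a b + lam ^+ n * d b y.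
  by move: xba hb; rewrite !segE => <- <-; rewrite !mulrDr.
by rewrite -h; lra.
Qed.

Lemma expanded_cell x y : cell V x y -> expanded x y.
Proof.
case=> [->|[u [v [euv ux uy]]]] n; first by rewrite !mdistxx mulr0.
exact: (edge_expand TD lam1 fU fE n euv ux uy).
Qed.

(** * Linear and bounded distance between orbits *)

Definition linearly_close x y := exists a b : R, forall n,
  d (iter n f x) (iter n f y) <= a * n%:R + b.

Definition boundedly_close x y := exists M : R, forall n,
  d (iter n f x) (iter n f y) <= M.

Lemma boundedly_close_refl x : boundedly_close x x.
Proof. by exists 0 => n; rewrite mdistxx. Qed.

Lemma boundedly_close_trans x y z :
  boundedly_close x y -> boundedly_close y z -> boundedly_close x z.
Proof.
move=> [M h] [M' h']; exists (M + M') => n.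
exact: le_trans (metric_triangle _ (iter n f y) _) (lerD (h n) (h' n)).
Qed.

Lemma boundedly_close_sym x y : boundedly_close x y -> boundedly_close y x.
Proof. by move=> [M h]; exists M => n; rewrite metric_sym. Qed.

Lemma boundedly_close_linearly x y : boundedly_close x y -> linearly_close x y.
Proof. by move=> [M h]; exists 0, M => n; rewrite mul0r add0r. Qed.

Lemma linearly_close_map m x y :
  linearly_close x y -> linearly_close (iter m f x) (iter m f y).
Proof.
move=> [a [b h]]; exists a, (a * m%:R + b) => n; rewrite -!iterD.
by apply: le_trans (h _) _; rewrite natrD mulrDr addrA.
Qed.

Lemma expanded_linearly_close x y : expanded x y -> linearly_close x y -> x = y.
Proof.
move=> h [a [b hab]]; apply: contrapT => /eqP; rewrite -mdist_gt0 => xy0.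
have [n] := linear_lt_exponential a b lam1 xy0; have := hab n; rewrite h mulrC.
by rewrite leNgt => /negP.
Qed.

(* By bounded backtracking an expanded subsegment longer than 2B/(lam - 1)
   leaves a longer expanded subsegment after tightening the image. *)
Lemma expanded_subsegments_bounded : exists2 C : R, 0 <= C &
  forall x y a b, linearly_close x y -> seg x y a -> seg x y b -> expanded a b ->
  d a b <= C.
Proof.
have [B B0 hB] := bounded_backtracking.
have l0 : 0 < lam - 1 by rewrite subr_gt0.
pose C := 2 * B / (lam - 1).
have C0 : 0 <= C by rewrite divr_ge0 ?(ltW l0) // mulr_ge0 // ltW.
have CE : lam * C = C + 2 * B by rewrite /C; field; rewrite gt_eqF.
exists C => // x y a b [s [t hst]] xya xyb ab; rewrite leNgt; apply/negP => Cab.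
(* As [lam * C = C + 2 * B], the excess of the length over C is multiplied by at least [lam] at each
   step. *)
have grow n : exists a' b', [/\ seg (iter n f x) (iter n f y) a',
    seg (iter n f x) (iter n f y) b', expanded a' b' &
    lam ^+ n * (d a b - C) <= d a' b' - C].
  elim: n => [|n [a' [b' [xa xb ab' long]]]]; first by exists a, b; rewrite expr0 mul1r.
  have C1 : C < d a' b'.
    have : 0 < lam ^+ n * (d a b - C) by rewrite mulr_gt0 // subr_gt0.
    by lra.
  set x' := iter n f x in xa xb *; set y' := iter n f y in xa xb *.
  have [p xyp ap] := seg_proj tT (f x') (f y') (f a').
  have [q xyq bq] := seg_proj tT (f x') (f y') (f b').
  have dap := hB _ _ _ xa _ ap xyp; have dbq := hB _ _ _ xb _ bq xyq.
  have dab : d (f a') (f b') = lam * d a' b' by have := ab' 1%N; rewrite expr1.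
  have lC : lam * C < lam * d a' b' by rewrite ltr_pM2l.
  have pq : p <> q.
    move=> pq; have := metric_triangle (f a') p (f b').
    by rewrite {2}pq dab (metric_sym q); lra.
  have [ap' aq' sum] := proj_bridge tT xyp xyq ap bq pq.
  exists p, q; split=> //.
    by apply: expanded_sub ap' aq'; exact: (expanded_map 1 ab').
  have : lam * (lam ^+ n * (d a b - C)) <= lam * (d a' b' - C) by rewrite ler_pM2l.
  have -> : lam * (d a' b' - C) = lam * d a' b' - C - 2 * B by rewrite mulrBr CE; ring.
  by rewrite exprS -mulrA; move: sum; rewrite dab (metric_sym q); lra.
have : 0 < d a b - C by rewrite subr_gt0.
move=> /(linear_lt_exponential s (t - C) lam1) [n]; have [a' [b' [xa xb _ long]]] := grow n.
have := seg_quad xa xb; have := hst n.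
by rewrite (mulrC (d a b - C)); lra.
Qed.

Lemma cell_chain x y : exists (n : nat) (u : nat -> T),
  [/\ u 0%N = x, u n = y & forall i, (i < n)%N -> cell V (u i) (u i.+1)].
Proof.
pose chain x y := exists (n : nat) (u : nat -> T),
  [/\ u 0%N = x, u n = y & forall i, (i < n)%N -> cell V (u i) (u i.+1)].
have cons a b c : cell V a b -> chain b c -> chain a c.
  move=> ab [n [u [u0 un h]]]; exists n.+1, (fun i => if i is j.+1 then u j else a).
  by split=> // -[|i] //=; [rewrite u0|exact: h].
have nil a : chain a a by exists 0%N, (fun=> a).
have vert u v : V u -> V v -> forall c, chain v c -> chain u c.
  move=> Vu Vv c vc; move: u Vu; apply: (vertex_ind sV Vv) => // u u' Vu euu' _ h.
  apply: cons h; right; exists u, u'; split=> //; [exact: seg_left|exact: seg_right].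
case: (cell_path sV x y) => [xy|[w [w' [Vw Vw' _ _ [xw wy]]]]].
  exact: (cons x y y xy (nil y)).
apply: (cons x w y xw); apply: (vert w w' Vw Vw' y).
exact: (cons w' y y wy (nil y)).
Qed.

(** Join x to y by N cells. The images of cells are expanded, so each meets [f^n x, f^n y] in a
    piece of length at most C, and N such pieces cover it. *)
Lemma linearly_close_boundedly x y : linearly_close x y -> boundedly_close x y.
Proof.
move=> lxy; have [C C0 hC] := expanded_subsegments_bounded.
have [N [u [u0 uN cu]]] := cell_chain x y; exists (N%:R * C) => n.
rewrite -u0 -uN; apply: (chain_cover tT (u := fun i => iter n f (u i))) => //.
move=> i a b iN; rewrite u0 uN => xa xb ua ub.
apply: hC (linearly_close_map n lxy) xa xb _.
by apply: expanded_sub ua ub; apply: expanded_map; apply: expanded_cell; exact: cu.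
Qed.

(** Each point is coded by the ends of a closed edge containing it. A ball leaves finitely many
    codes, and two points with equal codes lie in one cell, where linear closeness forces
    equality. *)
Lemma boundedly_close_pigeonhole x (D : R) (y : nat -> T) :
  (forall m n, linearly_close (y m) (y n)) -> (forall n, d x (y n) <= D) ->
  exists m n, (m < n)%N /\ y m = y n.
Proof.
move=> lin yD; have [v Vv] := exists_vertex TD.
have [a [b [a0 b0 ab]]] := edge_bounds TD eC.
have /choice [code codeP] : forall z, exists c : T * T,
    [/\ V c.1, V c.2, seg c.1 c.2 z & c.1 = c.2 \/ edge c.1 c.2].
  by move=> z; have [u [w h]] := point_code sV z; exists (u, w).
pose B := [set u | V u /\ d v u <= d v x + D + b].
have fB : finite_set (B `*` B) by apply: finite_setX; exact: (ball_finite TD eC).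
have cB n : (B `*` B) (code (y n)).
  have [V1 V2 cs ce] := codeP (y n).
  have cb : d (code (y n)).1 (code (y n)).2 <= b.
    by case: ce => [->|/ab/andP[] //]; rewrite mdistxx ltW.
  have h := yD n; have := metric_triangle v x (y n).
  have := metric_triangle v (y n) (code (y n)).1; have := metric_triangle v (y n) (code (y n)).2.
  rewrite (metric_sym (y n) (code (y n)).1); move: cs; rewrite segE.
  have := mdist_ge0 (code (y n)).1 (y n); have := mdist_ge0 (y n) (code (y n)).2.
  by move=> *; split; split=> //; lra.
have [m [n [mn cmn]]] := @finite_pigeonhole _ _ (code \o y) fB cB.
exists m, n; split=> //; apply: expanded_linearly_close (lin m n).
apply: expanded_cell; have [V1 V2 cs ce] := codeP (y m); have [_ _ cs' _] := codeP (y n).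
move: cs'; rewrite -[code (y n)]cmn => cs'.
case: ce => [ce|ce]; last by right; exists (code (y m)).1, (code (y m)).2.
by left; rewrite /= -ce in cs cs'; rewrite (segxx cs') -(segxx cs).
Qed.

(** * Nielsen paths and Nielsen classes *)

Lemma periodic_Nielsen_sym x y : periodic_Nielsen f x y -> periodic_Nielsen f y x.
Proof.
move=> [xy [n [h [n0 [hx hy]]]]]; split; first exact: nesym.
by exists n, h.
Qed.

Lemma periodic_NielsenP x y : periodic_Nielsen f x y <-> x <> y /\
  exists (n : nat) h, [/\ (0 < n)%N, iter n f x = act h x & iter n f y = act h y].
Proof.
split=> [[xy [n [h [n0 [hx hy]]]]]|[xy [n [h [n0 hx hy]]]]]; split=> //; exists n, h.
  by split=> //; rewrite -1?[in RHS]hx -1?[in RHS]hy actKV.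
by rewrite hx hy !actK.
Qed.

Lemma periodic_Nielsen_act g x y :
  periodic_Nielsen f x y -> periodic_Nielsen f (act g x) (act g y).
Proof.
move=> /periodic_NielsenP[xy [n [h [n0 hx hy]]]]; apply/periodic_NielsenP.
split; first by move=> /(act_inj aT).
exists n, (iter n phi g * h * g^-1)%g.
by rewrite !(represents_iter fphi) hx hy !actM // !actK.
Qed.

Lemma periodic_Nielsen_map x y :
  periodic_Nielsen f x y -> periodic_Nielsen f (f x) (f y).
Proof.
move=> /periodic_NielsenP[xy [n [h [n0 hx hy]]]]; apply/periodic_NielsenP; split.
  move=> fxy; apply: xy; apply: (act_inj aT (g := h)); rewrite -hx -hy.
  by case: n n0 {hx hy} => // n _; rewrite !iterSr fxy.
by exists n, (phi h); rewrite -!iterSr !iterS hx hy !fphi.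
Qed.

Lemma pINP_sym x y : pINP f x y -> pINP f y x.
Proof.
move=> [n h]; split; first exact: periodic_Nielsen_sym.
move=> [z [yxz yz zx]]; apply: h; exists z; split.
- exact: segC.
- exact: periodic_Nielsen_sym.
- exact: periodic_Nielsen_sym.
Qed.

Lemma pINP_act g x y : pINP f x y -> pINP f (act g x) (act g y).
Proof.
move=> [n h]; split; first exact: periodic_Nielsen_act.
move=> [z [/(act_segV aT) xyz /(periodic_Nielsen_act g^-1%g) xz]].
move=> /(periodic_Nielsen_act g^-1%g); move: xz; rewrite !actK // => xz zy.
by apply: h; exists (act g^-1%g z).
Qed.

(** The distance between the iterates is periodic with period n; the sum over one period bounds its
    maximum. *)
Lemma periodic_Nielsen_boundedly_close x y :
  periodic_Nielsen f x y -> boundedly_close x y.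
Proof.
move=> /periodic_NielsenP[_ [n [h [n0 hx hy]]]].
exists (\sum_(i < n) d (iter i f x) (iter i f y)) => m.
rewrite (divn_eq m n); elim: (m %/ n)%N => [|q IH]; last first.
  have E z : iter (q.+1 * n + m %% n) f z = iter (q * n + m %% n) f (iter n f z).
    by rewrite -iterD mulSn -addnA addnC.
  by rewrite !E hx hy !(represents_iter fphi) act_isom.
rewrite mul0n add0n (bigD1 (Ordinal (ltn_pmod m n0))) //= lerDl.
by apply: sumr_ge0 => *; exact: mdist_ge0.
Qed.

(* Otherwise [x, y] lies in a closed edge, which f expands. *)
Lemma periodic_Nielsen_vertex x y : periodic_Nielsen f x y ->
  exists w, [/\ V w, seg x y w, w <> x & w <> y].
Proof.
move=> pn; apply: contrapT => no; have [xy _] := pn.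
have end_ w : V w -> seg x y w -> w = x \/ w = y.
  move=> Vw xyw; apply: contrapT => /not_orP[wx wy]; apply: no; by exists w.
suff /expanded_cell xye : cell V x y.
  apply: xy; apply: expanded_linearly_close xye _.
  by apply: boundedly_close_linearly; exact: periodic_Nielsen_boundedly_close.
case: (cell_path sV x y) => // -[w [w' [Vw Vw' xyw wyw' [xw wy]]]].
case: (end_ w Vw xyw) => ew; last by rewrite -ew.
subst w; case: (end_ w' Vw' wyw') => ew'; first by rewrite -ew'.
subst w'; right; exists x, y; split; [|exact: seg_left|exact: seg_right].
split=> //; apply/seteqP; split=> [w [Vw'' /(end_ _ Vw'')] //|w []->].
  by split=> //; exact: seg_left.
by split=> //; exact: seg_right.
Qed.

Local Notation VY := (Nielsen_class f).

Lemma Nielsen_class_refl x : VY x x.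
Proof. by exists 0%N, (fun=> x). Qed.

Lemma Nielsen_class_cons x y z : pINP f x y -> VY y z -> VY x z.
Proof.
move=> xy [n [u [u0 un h]]]; exists n.+1, (fun i => if i is j.+1 then u j else x).
by split=> // -[|i] //=; [rewrite u0|exact: h].
Qed.

Lemma Nielsen_class_ind (P : T -> T -> Prop) : (forall x, P x x) ->
  (forall x y z, pINP f x y -> VY y z -> P y z -> P x z) -> forall x y, VY x y -> P x y.
Proof.
move=> P0 PS x y [n [u [u0 un h]]].
elim: n u x u0 un h => [|n IH] u x u0 un h; first by rewrite -u0 un.
have hS i : (i < n)%N -> pINP f (u i.+1) (u i.+2) by move=> ii; exact: (h i.+1 ii).
apply: (PS x (u 1%N)).
- by rewrite -u0; exact: h.
- by exists n, (fun i => u i.+1).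
- exact: (IH (fun i => u i.+1)).
Qed.

Lemma Nielsen_class_trans x y z : VY x y -> VY y z -> VY x z.
Proof.
move=> xy; move: x y xy z; apply: Nielsen_class_ind => // x y z xy _ IH t /IH.
exact: Nielsen_class_cons.
Qed.

Lemma pINP_Nielsen_class x y : pINP f x y -> VY x y.
Proof. by move=> xy; apply: Nielsen_class_cons xy _; exact: Nielsen_class_refl. Qed.

Lemma Nielsen_class_sym x y : VY x y -> VY y x.
Proof.
move: x y; apply: Nielsen_class_ind => [x|x y z xy _ zy]; first exact: Nielsen_class_refl.
by apply: Nielsen_class_trans zy _; apply: pINP_Nielsen_class; exact: pINP_sym.
Qed.

Lemma Nielsen_class_act g x y : VY x y -> VY (act g x) (act g y).
Proof.
move: x y; apply: Nielsen_class_ind => [x|x y z xy _]; first exact: Nielsen_class_refl.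
by apply: Nielsen_class_cons; exact: pINP_act.
Qed.

Lemma Nielsen_class_boundedly_close x y : VY x y -> boundedly_close x y.
Proof.
move: x y; apply: Nielsen_class_ind => [x|x y z [xy _] _]; first exact: boundedly_close_refl.
by apply: boundedly_close_trans; exact: periodic_Nielsen_boundedly_close.
Qed.

(** Decomposition into indivisible paths terminates: each of the two pieces has a vertex in its
    interior, so the other piece contains fewer vertices than [x, y]. *)
Lemma periodic_Nielsen_class x y : periodic_Nielsen f x y -> VY x y.
Proof.
have [_ _ fin _ _] := sV; have [s hs] := (finite_seqP _).1 (fin x y).
have : forall w, V w -> seg x y w -> w \in s.
  by move=> w Vw xyw; have : (V `&` seg x y) w by []; rewrite hs.
move: {hs} (leqnn (size s)); move: {2}(size s) => n.
elim: n x y s => [|n IH] x y s sn xys pn.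
  have [w [Vw xyw _ _]] := periodic_Nielsen_vertex pn.
  by have := xys w Vw xyw; move: sn; rewrite leqn0 size_eq0 => /eqP ->.
have [|npi] := pselect (pINP f x y); first exact: pINP_Nielsen_class.
have [z [xyz xz zy]] : exists z, [/\ seg x y z, periodic_Nielsen f x z & periodic_Nielsen f z y].
  by apply: contrapT => no; apply: npi; split.
have sub a b w : periodic_Nielsen f a b -> V w -> seg x y w -> ~ seg a b w ->
    seg a b `<=` seg x y -> VY a b.
  move=> pab Vw xyw nabw abxy; apply: (IH a b [seq t <- s | t != w]) => //.
    rewrite size_filter; have h2 := count_predC (pred1 w) s.
    have h1 : (0 < count (pred1 w) s)%N by rewrite -has_count has_pred1; exact: xys.
    rewrite -(leq_add2l 1); apply: leq_trans sn.
    by rewrite -[leqRHS]h2; apply: leq_add.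
  move=> t Vt abt; rewrite mem_filter xys ?andbT //; last exact: abxy.
  by apply/eqP => et; apply: nabw; rewrite -et.
apply: (Nielsen_class_trans (y := z)).
  have [w [Vw zyw wz wy]] := periodic_Nielsen_vertex zy.
  apply: (sub x z w) => //; [exact: seg_incl_right zyw| |exact: seg_incl_left].
  move=> xzw; apply: wz; apply: mdist_eq0; move: zyw xzw xyz; rewrite !segE.
  by have := metric_triangle x w y; rewrite (metric_sym z w); lra.
have [w [Vw xzw wx wz]] := periodic_Nielsen_vertex xz.
apply: (sub z y w) => //; [exact: seg_incl_left xzw| |exact: seg_incl_right].
move=> zyw; apply: wz; apply: mdist_eq0; move: zyw xzw xyz; rewrite !segE.
by have := metric_triangle x w y; rewrite (metric_sym z w); lra.
Qed.

(** The indivisibility of the image of a pINP is not examined: the image is a periodic Nielsen path,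
    which suffices by [periodic_Nielsen_class]. *)
Lemma Nielsen_class_map x y : VY x y -> VY (f x) (f y).
Proof.
move: x y; apply: Nielsen_class_ind => [x|x y z [xy _] _]; first exact: Nielsen_class_refl.
by apply: Nielsen_class_trans; apply: periodic_Nielsen_class; exact: periodic_Nielsen_map.
Qed.

Lemma Nielsen_class_iter n x y : VY x y -> VY (iter n f x) (iter n f y).
Proof. by move=> xy; elim: n => //= n; exact: Nielsen_class_map. Qed.

Lemma Nielsen_class_stabilizerP x g : set_stabilizer (VY x) g <-> VY x (act g x).
Proof.
split=> [st|xg]; first by rewrite -st; exists x => //; exact: Nielsen_class_refl.
apply/seteqP; split=> [_ [y xy <-]|y xy].
  by apply: Nielsen_class_trans xg _; exact: Nielsen_class_act.
exists (act g^-1%g y); last by rewrite actKV.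
apply: (Nielsen_class_trans (y := act g^-1%g x)); last exact: Nielsen_class_act.
by apply: Nielsen_class_sym; have := Nielsen_class_act g^-1%g xg; rewrite actK.
Qed.

(** * Maps representing the members of the powers of Phi *)

Section TwistedMaps.
Variables (u : G) (m : nat).

Definition twisted_map z := act u (iter m f z).
Definition twisted_aut g := (u * iter m phi g * u^-1)%g.

Lemma twisted_aut_automorphism : automorphism twisted_aut.
Proof.
exact: (automorphism_comp (automorphism_conj u) (automorphism_iter m phiA)).
Qed.

Lemma twisted_map_act g z : twisted_map (act g z) = act (twisted_aut g) (twisted_map z).
Proof. by rewrite /twisted_map (represents_iter fphi) !actM // actK. Qed.

Lemma twisted_map_iter_act n g z :
  iter n twisted_map (act g z) = act (iter n twisted_aut g) (iter n twisted_map z).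
Proof. by elim: n => //= n ->; rewrite twisted_map_act. Qed.

Lemma twisted_map_iter n : exists w : G, forall z, iter n twisted_map z = act w (iter (m * n) f z).
Proof.
elim: n => [|n [w IH]]; first by exists 1%g => z; rewrite muln0 act1.
exists (u * iter m phi w)%g => z.
by rewrite iterS IH /twisted_map (represents_iter fphi) -iterD mulnS -actM.
Qed.

Lemma twisted_map_mdist n x y : d (iter n twisted_map x) (iter n twisted_map y) =
  d (iter (m * n) f x) (iter (m * n) f y).
Proof. by have [w h] := twisted_map_iter n; rewrite !h act_isom. Qed.

Lemma twisted_map_lipschitz n x y :
  d (iter n twisted_map x) (iter n twisted_map y) <= lam ^+ (m * n) * d x y.
Proof. by rewrite twisted_map_mdist; exact: map_lipschitz_iter. Qed.

(** In the division of N by m the remaining r < m steps cost at most a factor [lam] ^ m. Absolute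
    values allow the quotient to be replaced by N. *)
Lemma twisted_linearly_close x y : (0 < m)%N -> (exists a b : R, forall n,
  d (iter n twisted_map x) (iter n twisted_map y) <= a * n%:R + b) -> linearly_close x y.
Proof.
move=> m0 [a [b h]]; exists (lam ^+ m * `|a|), (lam ^+ m * `|b|) => N.
rewrite {1 2}(divn_eq N m) addnC !iterD.
apply: le_trans (map_lipschitz_iter TD lam1 fU _ _ _) _.
have := h (N %/ m)%N; rewrite twisted_map_mdist mulnC => h1.
have h2 : a * (N %/ m)%:R + b <= `|a| * N%:R + `|b|.
  apply: lerD; last exact: ler_norm.
  apply: le_trans (ler_wpM2r (ler0n _ _) (ler_norm a)) _.
  by rewrite ler_wpM2l // ler_nat leq_div.
rewrite -mulrA -mulrDr; apply: ler_pM => //; [exact: ltW|exact: mdist_ge0| |].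
  by rewrite ler_weXn2l ?(ltW lam1) // ltnW // ltn_pmod.
exact: le_trans h2.
Qed.

Lemma twisted_Nielsen_class n x y : VY x y ->
  VY (iter n twisted_map x) (iter n twisted_map y).
Proof.
have [w h] := twisted_map_iter n; rewrite !h => xy.
by apply: Nielsen_class_act; exact: Nielsen_class_iter.
Qed.

End TwistedMaps.

(** * Periodic points and stabilizers of their classes *)

Definition periodic_point x := exists (n : nat) h, (0 < n)%N /\ iter n f x = act h x.

Lemma iter_mul_periodic n h (A : set T) m : (forall x, A x -> iter n f x = act h x) ->
  exists h', forall x, A x -> iter (n * m) f x = act h' x.
Proof.
move=> hA; elim: m => [|m [h' IH]]; first by exists 1%g => x _; rewrite muln0 act1.
exists (iter n phi h' * h)%g => x Ax.
by rewrite mulnS iterD IH // (represents_iter fphi) hA // actM.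
Qed.

Lemma periodic_point_act g x : periodic_point x -> periodic_point (act g x).
Proof.
move=> [n [h [n0 hx]]]; exists n, (iter n phi g * h * g^-1)%g; split=> //.
by rewrite (represents_iter fphi) hx !actM // actK.
Qed.

Lemma periodic_point_map x : periodic_point x -> periodic_point (f x).
Proof.
by move=> [n [h [n0 hx]]]; exists n, (phi h); split=> //; rewrite -iterSr iterS hx fphi.
Qed.

Lemma periodic_point_Nielsen_class x y : VY x y -> periodic_point x -> periodic_point y.
Proof.
move: x y; apply: Nielsen_class_ind => // x y z [/periodic_NielsenP[_ [n [h [n0 _ hy]]]] _] _ IH _.
by apply: IH; exists n, h.
Qed.

Lemma twisted_fixed n h x : iter n f x = act h x -> twisted_map h^-1%g n x = x.
Proof. by move=> hx; rewrite /twisted_map hx actK. Qed.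

Lemma iter_fixed (X : Type) (F : X -> X) n a : F a = a -> iter n F a = a.
Proof. by move=> Fa; elim: n => //= n ->. Qed.

Lemma twisted_boundedly_close_bound E x y : (exists (v : G) (k : nat), E = twisted_map v k) ->
  E x = x -> boundedly_close x y ->
  exists M : R, forall n, d x (iter n E y) <= M /\ boundedly_close x (iter n E y).
Proof.
move=> [v [k ->]] Ex [M hM]; exists M => n; have [w hw] := twisted_map_iter v k n.
have xw : x = act w (iter (k * n) f x) by rewrite -hw iter_fixed.
split; first by rewrite {1}xw hw act_isom.
exists M => i; rewrite {1}xw hw !(represents_iter fphi) act_isom // -!iterD.
exact: hM.
Qed.

Lemma eventually_periodic E x y : (exists (v : G) (k : nat), E = twisted_map v k) ->
  E x = x -> boundedly_close x y ->
  exists n p : nat, (0 < p)%N /\ iter p E (iter n E y) = iter n E y.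
Proof.
move=> hE Ex xy; have [M hM] := twisted_boundedly_close_bound hE Ex xy.
have [n [n' [nn' e']]] : exists n n' : nat, (n < n')%N /\ iter n E y = iter n' E y.
  apply: (boundedly_close_pigeonhole (x := x) (D := M)) => [i j|n]; last by case: (hM n).
  apply: boundedly_close_linearly; apply: boundedly_close_trans (proj2 (hM j)).
  exact: boundedly_close_sym (proj2 (hM i)).
exists n, (n' - n)%N; rewrite subn_gt0 nn'; split=> //.
by rewrite -iterD subnK // ltnW.
Qed.

Lemma eventually_Nielsen n h x y : (0 < n)%N -> iter n f x = act h x ->
  boundedly_close x y -> exists k, VY x (iter k (twisted_map h^-1%g n) y).
Proof.
move=> n0 hx xy; set E := twisted_map _ _; have Ex : E x = x := twisted_fixed hx.
have [k [p [p0 ep]]] : exists k p : nat, (0 < p)%N /\ iter p E (iter k E y) = iter k E y.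
  by apply: (eventually_periodic (x := x)) => //; exists h^-1%g, n.
exists k; set z := iter k E y in ep *.
have [<-|/eqP xz] := eqVneq x z; first exact: Nielsen_class_refl.
apply: periodic_Nielsen_class; apply/periodic_NielsenP; split=> //.
have [w hw] := twisted_map_iter h^-1%g n p; exists (n * p)%N, w^-1%g.
rewrite muln_gt0 n0 p0; split=> //.
  by rewrite -{2}(iter_fixed p Ex) hw actK.
by rewrite -[in RHS]ep hw actK.
Qed.

(** By [Nielsen_class_stabilizerP] the second clause says that the stabilizer of the class contains
    a loxodromic element. *)
Definition loxodromic_class x := periodic_point x /\
  exists g, ~ elliptic T g /\ VY x (act g x).

Lemma loxodromic_class_Nielsen x y : VY x y -> loxodromic_class x -> loxodromic_class y.
Proof.
move=> xy [px [g [ng xg]]]; split; first exact: periodic_point_Nielsen_class px.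
exists g; split=> //; apply: Nielsen_class_trans (Nielsen_class_act g xy).
exact: Nielsen_class_trans (Nielsen_class_sym xy) xg.
Qed.

Lemma loxodromic_class_map x : loxodromic_class x -> loxodromic_class (f x).
Proof.
move=> [px [g [ng xg]]]; split; first exact: periodic_point_map.
exists (phi g); split; first exact: nonelliptic_automorphism.
by rewrite -fphi; exact: Nielsen_class_map.
Qed.

(* The automorphism theta represented by h^-1 f^M maps stab x = <s> into itself, perhaps
   not onto. For a power Psi of theta and some loxodromic g1 in the stabilizer H of the
   class, Psi(g1) is in g1 <s>, so conjugation by g1 maps the m-th power of each root
   rt k = Psi^-k(s) to its m'-th power. The latter therefore fixes a segment containing a
   translate by a power of g1 of a fixed point b of the axis, which puts the (m' c)-th
   power of rt k in H, where m' c does not depend on k. *)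
Lemma collapse_in_class x r : loxodromic_class x -> f (act r x) = f x -> VY x (act r x).
Proof.
move=> [[M [h [M0 hx]]] [g [ng xg]]] frx.
pose E := twisted_map h^-1%g M; pose theta := twisted_aut h^-1%g M.
have Ex : E x = x := twisted_fixed hx.
have thA : automorphism theta by exact: twisted_aut_automorphism.
have [n [p [p0 ep]]] : exists n p : nat, (0 < p)%N /\
    iter p E (iter n E (act g x)) = iter n E (act g x).
  apply: (eventually_periodic (x := x)) => //; first by exists h^-1%g, M.
  exact: Nielsen_class_boundedly_close.
pose g1 := iter n theta g; pose Psi := iter p theta.
have TA : automorphism Psi by exact: automorphism_iter.
have [TM [Psi' TK TK']] := TA.
have T'A : automorphism Psi' := automorphism_inv TA TK TK'.
have ng1 : ~ elliptic T g1.
  by apply: nonelliptic_automorphism => //; exact: automorphism_iter.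
have itE k a : iter k E (act a x) = act (iter k theta a) x.
  by rewrite twisted_map_iter_act (iter_fixed k Ex).
have g1x : VY x (act g1 x).
  rewrite -itE -{1}(iter_fixed n Ex); exact: twisted_Nielsen_class.
have Tg1 : act (Psi g1) x = act g1 x.
  by move: ep; rewrite !itE.
have Tst a : act a x = x -> act (Psi a) x = x.
  by move=> ax; rewrite -itE ax iter_fixed.
have [s [sx s0 sS]] := infinite_cyclicP (stab_cyclic TD x).
have [J TsJ] := sS _ (Tst s sx).
have s1 : s <> 1%g by move=> s1; have := s0 1 s1.
have TsS k : exists j, iter k Psi g1 = (g1 * expgz s j)%g.
  have [j hj] : exists j, (g1^-1 * iter k Psi g1)%g = expgz s j.
    apply: (sS); rewrite /= actM //; suff -> : act (iter k Psi g1) x = act g1 x by rewrite actK.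
    elim: k => //= k IH.
    have /sS[j hj] : act (g1^-1 * iter k Psi g1)%g x = x by rewrite actM // IH actK.
    rewrite -(mulVKg g1 (iter k Psi g1)) hj TM actM // Tst ?Tg1 //.
    by rewrite act_expgz.
  by exists j; rewrite -hj mulVKg.
pose rt k := iter k Psi' s.
have rts k : iter k Psi (rt k) = s.
  by rewrite /rt; elim: k => // k IH; rewrite iterSr iterS TK'.
have es : elliptic T s by exists x.
have [m [m' [m0 m'0 hm]]] := elliptic_commensurated TD es g1.
rewrite expgzJ in hm.
(* Under the injective Psi^k the root [rt k] becomes s and g1 becomes g1 s^j; since s^j commutes
   with powers of s, the relation turns into [hm]. *)
have conj k : (g1 * expgz (rt k) m * g1^-1)%g = expgz (rt k) m'.
  have [kM kb] := automorphism_iter k TA; apply: (bij_inj kb); have [j hj] := TsS k.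
  rewrite !kM (homV kM) !(hom_expgz kM) rts hj -hm invgM !mulgA; congr (_ * _)%g.
  rewrite -!mulgA; congr (_ * _)%g.
  by rewrite -expgzN -!expgzD addrCA addrN addr0.
have [b gb _] := axis_base_exists tT aT x ng1.
have axb := axis_base_axial tT aT gb.
have [eps [epsb eps0 epsS]] := infinite_cyclicP (stab_cyclic TD b).
have [c [c' [c0 c'0 hc]]] : commensurable eps s.
  apply: (elliptic_commensurable TD) => //; first by exists b.
  by move=> e1; have := eps0 1 e1.
pose H : set G := [set a | VY x (act a x)].
have HM a b' : H a -> H b' -> H (a * b')%g.
  move=> Ha Hb; rewrite /H /= actM //; apply: Nielsen_class_trans Ha _.
  exact: Nielsen_class_act.
have HV a : H a -> H a^-1%g.
  move=> Ha; apply: (Nielsen_class_sym); rewrite -{2}(actK aT a x).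
  exact: Nielsen_class_act.
have Hs : H s by rewrite /H /= sx; exact: Nielsen_class_refl.
have HN k : H (expgz (rt k) (m' * c)).
  have [z rz] : elliptic T (rt k).
    exact: (elliptic_automorphism (automorphism_iter k T'A) es).
  have [i hi] := axial_meets_translates tT aT z axb.
  have fz : act (expgz (rt k) m') z = z by exact: act_expgz.
  have fgz : act (expgz (rt k) m') (act g1 z) = act g1 z.
    by rewrite -conj !actM // actK // act_expgz.
  have fb := fix_seg tT aT fz fgz hi.
  have /epsS[l hl] : act ((expgz g1 i)^-1 * expgz (rt k) m' * expgz g1 i)%g b = b.
    by rewrite !actM // fb actK.
  have -> : expgz (rt k) (m' * c) =
      (expgz g1 i * expgz s (c' * l) * (expgz g1 i)^-1)%g.
    rewrite expgzM (expgzM s) -hc -(expgzM eps) (mulrC c) expgzM -hl -expgzJ.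
    by rewrite !mulgA mulgV mul1g mulgK.
  apply: (HM); last by apply: (HV); exact: subgroup_expgz.
  by apply: (HM); exact: subgroup_expgz.
have Hr1 : H (rt 1%N).
  exact: (root_descent HM HV TA TsJ rts (mulf_neq0 m'0 c0) Hs HN).
(* As f (r x) = f x, the map E sends r x to E x = x. Hence Psi(r) is a power of s, and r is a power
   of [rt 1]. *)
have /sS[i hi] : act (Psi r) x = x.
  rewrite /Psi -itE; case: (p) p0 => // k _; rewrite iterSr.
  suff -> : E (act r x) = x by rewrite iter_fixed.
  rewrite -[RHS]Ex /E /twisted_map; case: (M) M0 => // M' _.
  by rewrite !iterSr frx.
suff -> : r = expgz (rt 1%N) i by exact: (subgroup_expgz HM HV).
by rewrite -(TK r) hi hom_expgz //; case: T'A.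
Qed.

(** Go once around a common period M + 1 of x, z and z1 modulo G: f^M(z) is k' x, so x2 = k'^-1
    f^M(z1) is in the class of x, and f x2 = rho z1 with rho fixing z. The correction by phi^-1(rho)
    moves x inside a fiber of f, hence inside its class by [collapse_in_class]. *)
Lemma pINP_lift x z z1 : loxodromic_class x -> f x = z -> pINP f z z1 ->
  exists2 x1, VY x x1 & f x1 = z1.
Proof.
move=> lx fx pz; have [[N [k [N0 kx]]] _] := lx.
have [/periodic_NielsenP[_ [n [h [n0 hz hz1]]]] _] := pz.
have [h' hh'] : exists h', forall y, [set z; z1] y -> iter (n * N) f y = act h' y.
  by apply: (@iter_mul_periodic n h) => y [->|->].
have [k' hk'] : exists k', forall y, [set x] y -> iter (N * n) f y = act k' y.
  by apply: (@iter_mul_periodic N k) => y ->.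
have := hk' x erefl; rewrite mulnC; have : (0 < n * N)%N by rewrite muln_gt0 n0.
have := hh' z (or_introl erefl); have := hh' z1 (or_intror erefl).
case: (n * N)%N => // M; rewrite !iterS => fz1 fz _ fxk.
have [pM [phi' pK qK]] := phiA.
pose x2 := act k'^-1%g (iter M f z1).
have xx2 : VY x x2.
  have := Nielsen_class_iter M (pINP_Nielsen_class pz) => /(Nielsen_class_act k'^-1%g).
  by rewrite -{1}fx -iterSr iterS fxk actK.
pose rho := (phi k'^-1 * h')%g.
have fx2 : f x2 = act rho z1 by rewrite /x2 fphi fz1 actM.
have rz : act rho z = z.
  have fMz : iter M f z = act k' x by rewrite -fx -iterSr iterS.
  by rewrite actM // -fz fMz fphi homV // fx actK.
have xr : VY x (act (phi' rho)^-1%g x).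
  apply: collapse_in_class => //; rewrite fphi homV // qK fx.
  by rewrite -{1}rz actK.
exists (act (phi' rho)^-1%g x2); first exact: Nielsen_class_trans xr (Nielsen_class_act _ xx2).
by rewrite fphi homV // qK fx2 actK.
Qed.

Lemma Nielsen_class_lift z w : VY z w -> forall x, loxodromic_class x -> f x = z ->
  exists2 x', VY x x' & f x' = w.
Proof.
move: z w; apply: Nielsen_class_ind => [z x _ fx|z z1 w zz1 _ IH x lx fx].
  by exists x => //; exact: Nielsen_class_refl.
have [x1 xx1 fx1] := pINP_lift lx fx zz1.
have [x' x1x' fx'] := IH x1 (loxodromic_class_Nielsen xx1 lx) fx1.
by exists x' => //; exact: Nielsen_class_trans xx1 x1x'.
Qed.

(** Lift f y to y' in the class of x. Both y and y' are periodic modulo G with the same image under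
    f, so a common period makes them translates of each other, and [collapse_in_class] applies to
    y'. *)
Lemma Nielsen_class_descent x y : loxodromic_class x -> periodic_point y ->
  VY (f x) (f y) -> VY x y.
Proof.
move=> lx py fxy; have [y' xy' fy'] := Nielsen_class_lift fxy lx erefl.
have ly' := loxodromic_class_Nielsen xy' lx.
have [[n [h [n0 hy']]] _] := ly'; have [m [k [m0 ky]]] := py.
have [h' hh'] : exists h', forall z, [set y'] z -> iter (n * m) f z = act h' z.
  by apply: (@iter_mul_periodic n h) => z ->.
have [k' hk'] : exists k', forall z, [set y] z -> iter (m * n) f z = act k' z.
  by apply: (@iter_mul_periodic m k) => z ->.
have e1 : act h' y' = act k' y.
  rewrite -hh' // -hk' // mulnC; have : (0 < m * n)%N by rewrite muln_gt0 m0.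
  by case: (m * n)%N => // M _; rewrite !iterSr fy'.
have yE : y = act (k'^-1 * h')%g y' by rewrite actM // e1 actK.
rewrite yE; apply: Nielsen_class_trans xy' _; apply: collapse_in_class => //.
by rewrite -yE fy'.
Qed.

Lemma Nielsen_class_descent_iter n x y : loxodromic_class x -> periodic_point y ->
  VY (iter n f x) (iter n f y) -> VY x y.
Proof.
elim: n x y => // n IH x y lx py; rewrite !iterSr => h; apply: Nielsen_class_descent => //.
by apply: IH h; [exact: loxodromic_class_map|exact: periodic_point_map].
Qed.

Lemma boundedly_close_Nielsen_class x g : loxodromic_class x ->
  boundedly_close x (act g x) -> VY x (act g x).
Proof.
move=> lx xg; have [[n [h [n0 hx]]] _] := lx.
have [k hk] := eventually_Nielsen n0 hx xg.
apply: (@Nielsen_class_descent_iter (n * k)) => //.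
  by apply: periodic_point_act; case: lx.
have [w hw] := twisted_map_iter h^-1%g n k.
have := hk; rewrite hw -{1}(iter_fixed k (twisted_fixed hx)) hw.
by move=> /(Nielsen_class_act w^-1%g); rewrite !actK.
Qed.

(** The loxodromic witness is an image of g under an iterate of the twisted automorphism: before
    descent along f is available, only a late image of g x is known to be in the class of x. *)
Lemma loxodromic_classI n h x g : (0 < n)%N -> iter n f x = act h x -> ~ elliptic T g ->
  boundedly_close x (act g x) -> loxodromic_class x.
Proof.
move=> n0 hx ng xg; split; first by exists n, h.
have [k hk] := eventually_Nielsen n0 hx xg.
exists (iter k (twisted_aut h^-1%g n) g); split.
  apply: nonelliptic_automorphism => //; apply: automorphism_iter.
  exact: twisted_aut_automorphism.
by move: hk; rewrite twisted_map_iter_act (iter_fixed _ (twisted_fixed hx)).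
Qed.

(** The axis contains a vertex, which g moves to a different vertex, so the translation length is at
    least the shortest edge; no point is moved less than points of the axis. *)
Lemma translation_length_bound : exists2 a : R, 0 < a & forall g o (k : int),
  ~ elliptic T g -> `|k|%:~R * a <= d o (act (expgz g k) o).
Proof.
have [a [b [a0 b0 ab]]] := edge_bounds TD eC; exists a => // g o k ng.
have far v w : V v -> V w -> v <> w -> a <= d v w.
  move=> Vv Vw vw; have [v' ev /seg_le_left] := next_vertex sV Vv Vw vw.
  by have /andP[h _] := ab _ _ ev; exact: le_trans.
have [c gc _] := axis_base_exists tT aT o ng; have [l0 _] := gc.
have axc := axis_base_axial tT aT gc.
have al : a <= d c (act g c).
  have [w [Vw cw]] : exists w, V w /\ seg c (act g c) w.
    case: (vertex_or_edge sV c) => [Vc|[u [v [euv uc nc]]]].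
      by exists c; split=> //; exact: seg_left.
    (* For K large g^K c lies outside the edge [u, v], so an end of this edge lies on [c, g^K c]; a
       power of g moves it into [c, g c]. *)
    have [K hK] : exists K : nat, d u v < K%:R * d c (act g c).
      exists (Num.bound (d u v / d c (act g c))).
      by rewrite -ltr_pdivrMr //; apply: archi_boundP; rewrite divr_ge0 ?mdist_ge0.
    have [dK _] := axis_base_line tT aT K gc.
    have nK : ~ seg u v (act (expgz g K) c).
      by move=> /(seg_quad uc); rewrite dK leNgt hK.
    have [w Vw [cw wc]] : exists2 w, V w & seg c (act (expgz g K) c) w /\ w <> c.
      have [Vu Vv _ _] := euv.
      by case: (edge_exit sV euv uc nK) => h; [exists u|exists v] => //; split=> // e1;
        apply: nc; rewrite -e1.
    pose U (i : nat) := act (expgz g i) c.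
    have hU : seg (U 0%N) (U K) w by rewrite /U act1.
    have wU : w <> U 0%N by rewrite /U act1.
    have [i _ hi] := seg_chain tT (leq0n _) hU wU.
    exists (act (expgz g i)^-1%g w); split; first exact: act_vertex.
    by apply: (act_segV aT); rewrite -actM // -expgzS -intSr.
  have gw : w <> act g w by move=> e1; apply: ng; exists w.
  apply: le_trans (far _ _ Vw (act_vertex TD g Vw) gw) _.
  have := metric_triangle w (act g c) (act g w); rewrite act_isom //.
  by move: cw; rewrite segE; lra.
apply: (@le_trans _ _ (`|k|%:~R * d c (act g c))).
  by rewrite ler_wpM2l // ler0z.
have [->|k0] := eqVneq k 0; first by rewrite normr0 mul0r mdist_ge0.
have [i hi] := axial_meets_translates tT aT o (axial_exp k0 axc).
rewrite -expgzM in hi; set q := act (expgz g (k * i)) c in hi.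
have -> : `|k|%:~R * d c (act g c) = d q (act (expgz g k) q).
  rewrite /q -(actM aT) -expgzD (axis_base_dist tT aT) //; congr (_%:~R * _).
  by congr `|_|; lia.
have := metric_triangle q (act (expgz g k) o) (act (expgz g k) q).
by rewrite act_isom //; move: hi; rewrite segE; lra.
Qed.

Lemma act_expgz_mdist g o (k : int) : d o (act (expgz g k) o) <= `|k|%:~R * d o (act g o).
Proof.
have pos (n : nat) : d o (act (expgz g n) o) <= n%:R * d o (act g o).
  elim: n => [|n IH]; first by rewrite act1 // mdistxx mul0r.
  rewrite intSr expgzS actM // -natr1 mulrDl mul1r.
  have := metric_triangle o (act (expgz g n) o) (act (expgz g n) (act g o)).
  by rewrite act_isom //; lra.
case: k => n; first exact: pos.
rewrite NegzE expgzN normrN -(act_isom aT (expgz g n.+1)) actKV // metric_sym.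
exact: pos.
Qed.

(** * A periodic point following the axes of psi^n(g) *)

Section Tracking.
Variables (u : G) (m : nat).
Hypothesis m0 : (0 < m)%N.
Let F := twisted_map u m.
Let psi := twisted_aut u m.

Let F_act g z : F (act g z) = act (psi g) (F z). Proof. exact: twisted_map_act. Qed.
Let F_iter_act n g z : iter n F (act g z) = act (iter n psi g) (iter n F z).
Proof. exact: twisted_map_iter_act. Qed.
Let psiA : automorphism psi. Proof. exact: twisted_aut_automorphism. Qed.
Let F_lip n x y : d (iter n F x) (iter n F y) <= lam ^+ (m * n) * d x y.
Proof. exact: twisted_map_lipschitz. Qed.
Let psi_expgz n g k : iter n psi (expgz g k) = expgz (iter n psi g) k.
Proof. by apply: hom_expgz; apply: group_hom_iter; case: psiA. Qed.

(** For k large p lies between psi(g)^-k F(q) and psi(g)^k F(q), the images under F of two points of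
    the axis of g; [seg_IVT] lifts p to the segment between them. *)
Lemma axial_lift g p : ~ elliptic T g -> axial (psi g) p ->
  exists2 p', axial g p' & F p' = p.
Proof.
move=> ng ap; have [q gq _] := axis_base_exists tT aT p ng.
have axq := axis_base_axial tT aT gq; have [k /(_ _ (leqnn k))] := ap (F q).
have [pM _] := psiA; rewrite -!hom_expgz // -!F_act => h.
have lip x y : d (F x) (F y) <= lam ^+ m * d x y by have := F_lip 1 x y; rewrite muln1.
have [p' hp' <-] := seg_IVT tT (lamn0 m) lip h; exists p' => //.
exact: (axial_convex tT (axial_act aT _ axq) (axial_act aT _ axq) hp').
Qed.

Lemma axial_orbit N g : ~ elliptic T g ->
  exists p, forall i, (i <= N)%N -> axial (iter i psi g) (iter i F p).
Proof.
elim: N g => [|N IH] g ng.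
  have [v _] := exists_vertex TD; have [p gp _] := axis_base_exists tT aT v ng.
  by exists p => i; rewrite leqn0 => /eqP -> /=; exact: (axis_base_axial tT aT).
have [p hp] := IH (psi g) (nonelliptic_automorphism psiA ng).
have [p' gp' Fp'] := axial_lift ng (hp 0%N isT).
by exists p' => -[//|i]; rewrite ltnS !iterSr Fp'; exact: hp.
Qed.

(* Points x_N whose first N images stay on the axes of the psi^i(g) accumulate
   at a point all of whose images stay close to these axes. *)
Lemma tracking_point g o (M : R) : ~ elliptic T g ->
  (forall n, d o (act (iter n psi g) o) <= M) ->
  exists x (k : nat -> int), forall n,
    d o (act (expgz (iter n psi g) (k n)) (iter n F x)) <= M + 1.
Proof.
move=> ng gM.
have /choice [y hy] : forall N, exists y, seg o (act g o) y /\
    forall i, (i <= N)%N -> axial (iter i psi g) (iter i F y).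
  move=> N; have [p hp] := axial_orbit N ng.
  have [j hj] := axial_meets_translates tT aT o (hp 0%N (leq0n N)).
  exists (act (expgz g j) p); split=> // i iN.
  by rewrite F_iter_act psi_expgz; apply: (axial_act aT); exact: hp.
have [x hx] := seg_cluster tT (fun n => proj1 (hy n)).
suff /choice [k hk] : forall n, exists k : int,
    d o (act (expgz (iter n psi g) k) (iter n F x)) <= M + 1 by exists x, k.
(* Within this distance of x, the point y N has its n-th image within 1 of that of x; this is the +
   1 in the bound. *)
move=> n; have e0 : 0 < (lam ^+ (m * n))^-1 by rewrite invr_gt0.
have [N nN dN] := hx _ e0 n; have [_ /(_ n nN) ax] := hy N.
have [k hk] := axial_meets_translates tT aT o ax; exists k.
set h := expgz _ k in hk *.
have h1 : d (iter n F (y N)) (iter n F x) <= 1.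
  apply: le_trans (F_lip _ _ _) _; rewrite metric_sym -ler_pdivlMl // mulr1.
  exact: ltW.
have := metric_triangle o (act h (iter n F (y N))) (act h (iter n F x)).
by rewrite act_isom //; have := seg_le_left hk; have := gM n; lra.
Qed.

(** The points psi^n(g)^k(n) F^n(x) stay in a ball and are pairwise linearly close, so two of them
    coincide by pigeonhole, and F^i(x) is periodic modulo G for the smaller index i. *)
Lemma tracking_periodic_point g o (M : R) : ~ elliptic T g ->
  (forall n, d o (act (iter n psi g) o) <= M) ->
  exists x, periodic_point x /\
    exists a b : R, forall n, d o (iter n F x) <= a * n%:R + b.
Proof.
move=> ng gM; have [x [k hk]] := tracking_point ng gM.
have ngn n : ~ elliptic T (iter n psi g).
  by apply: (nonelliptic_automorphism _ ng); exact: automorphism_iter.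
have M0 : 0 <= M by apply: le_trans (gM 0%N); exact: mdist_ge0.
have [a a0 ha] := translation_length_bound.
pose D := d o (F o) + lam ^+ m * (M + 1) + (M + 1).
(* The image under F of the n-th point and the point of index n + 1 are both near o, and they differ
   by the power k(n+1) - k(n) of psi^(n+1)(g). *)
have drift n : `|k n.+1 - k n|%:~R * a <= D.
  apply: le_trans (ha (iter n.+1 psi g) o _ (ngn _)) _.
  set h := iter n.+1 psi g; set z := iter n.+1 F x.
  have h1 : d (F o) (act (expgz h (k n)) z) <= lam ^+ m * (M + 1).
    have [pM _] := psiA.
    rewrite /h /z !iterS -hom_expgz // -F_act; have := F_lip 1 o _; rewrite muln1 => /= lip.
    by apply: le_trans (lip _) _; rewrite ler_pM2l.
  have h2 : act (expgz h (k n.+1)) z = act (expgz h (k n.+1 - k n)) (act (expgz h (k n)) z).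
    by rewrite -actM // -expgzD subrK.
  have := hk n.+1; rewrite -/h -/z h2.
  set w := act (expgz h (k n)) z in h1 *; set t := expgz h _.
  have := metric_triangle o (act t w) (act t o); rewrite act_isom // (metric_sym w o).
  have := metric_triangle o (F o) w; rewrite /D; lra.
have kn n : `|k n|%:~R <= `|k 0%N|%:~R + n%:R * (D / a) :> R.
  elim: n => [|n IH]; first by rewrite mul0r addr0.
  have : `|k n.+1|%:~R <= `|k n.+1 - k n|%:~R + `|k n|%:~R :> R.
    by rewrite -intrD ler_int -[in leLHS](subrK (k n) (k n.+1)) ler_normD.
  have : `|k n.+1 - k n|%:~R <= D / a :> R by rewrite ler_pdivlMr.
  by rewrite -natr1 (mulrDl n%:R) mul1r; lra.
have kdist i j : d o (act (expgz (iter i psi g) (k j)) o) <= `|k j|%:~R * M.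
  apply: le_trans (act_expgz_mdist _ _ _) _.
  by rewrite ler_wpM2l // ler0z.
pose A := D / a * M; pose B := M + 1 + `|k 0%N|%:~R * M.
have lin n : d o (iter n F x) <= A * n%:R + B.
  have := hk n; set h := expgz _ _ => hn.
  have := metric_triangle o (act h^-1%g o) (iter n F x).
  rewrite -(act_isom aT h (act h^-1%g o)) actKV //.
  have -> : d o (act h^-1%g o) = d o (act h o).
    by rewrite -(act_isom aT h) actKV // metric_sym.
  have := kdist n n; rewrite -/h; have : `|k n|%:~R * M <= (`|k 0%N|%:~R + n%:R * (D / a)) * M.
    by rewrite ler_wpM2r.
  rewrite /A /B; have -> : D / a * M * n%:R = n%:R * (D / a) * M by ring.
  by rewrite mulrDl; lra.
pose y n := act (expgz (iter n psi g) (k n)) (iter n F x).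
have ylin n : exists b : R, forall i, d o (iter i F (y n)) <= A * i%:R + b.
  exists (A * n%:R + B + `|k n|%:~R * M) => i.
  rewrite /y F_iter_act psi_expgz -!iterD; set h := expgz _ _.
  have := metric_triangle o (act h o) (act h (iter (i + n) F x)); rewrite act_isom //.
  by have := lin (i + n)%N; have := kdist (i + n)%N n; rewrite natrD mulrDr -/h; lra.
have [i [j [ij yij]]] : exists i j : nat, (i < j)%N /\ y i = y j.
  apply: (boundedly_close_pigeonhole (x := o) (D := M + 1)) => // i j.
  have [b hb] := ylin i; have [b' hb'] := ylin j.
  apply: (twisted_linearly_close (u := u) m0); exists (2 * A), (b + b') => n.
  have := metric_triangle (iter n F (y i)) o (iter n F (y j)).
  by rewrite (metric_sym _ o); have := hb n; have := hb' n; rewrite -/F; lra.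
exists (iter i F x); split; last first.
  exists A, (A * i%:R + B) => n; rewrite -iterD; have := lin (n + i)%N.
  by rewrite natrD; lra.
have [w hw] := twisted_map_iter u m (j - i).
have e1 : iter (j - i) F (iter i F x) = iter j F x by rewrite -iterD subnK // ltnW.
exists (m * (j - i))%N, (w^-1 * ((expgz (iter j psi g) (k j))^-1 *
  expgz (iter i psi g) (k i)))%g.
rewrite muln_gt0 m0 subn_gt0 ij; split=> //.
rewrite !actM // -/(y i) yij actK // -e1 hw actK //.
Qed.

End Tracking.

End Dynamics.

(** * Powers of the outer class, and the theorem *)

Lemma outer_powP (G : groupType) (Phi : set (G -> G)) (phi : G -> G) (k : nat) (psi : G -> G) :
  outer_class Phi -> Phi phi ->
  outer_pow Phi k psi <-> exists u : G, psi = twisted_aut phi u k.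
Proof.
move=> [phi0 [[p0M p0B] ->]] [_ [a ->] phiE].
have phix x : phi x = (a * phi0 x * a^-1)%g by rewrite -phiE.
have phiM : group_hom phi by move=> x y; rewrite !phix p0M !mulgA mulgVK.
have [p0' p0K p0K'] := p0B.
elim: k psi => [|k IH] psi; first by split=> -[u ->]; exists u.
split=> [[_ [psi' [[_ [b ->] <-] [/IH[u ->] ->]]]]|[u ->]].
  exists (b * a^-1 * phi u)%g; apply/funext => x.
  rewrite /twisted_aut iterS /= !phix !p0M !(homV p0M) !invgM !invgK.
  by rewrite !mulgA !mulgVK.
(* This is phi^-1(u), as phi is phi0 followed by conjugation by a; conjugation by u' followed by phi
   is phi followed by conjugation by u. *)
pose u' := p0' (a^-1 * u * a)%g.
exists phi, (twisted_aut phi u' k); split; first by exists (fun x => a * x * a^-1)%g => //; exists a.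
split; first by apply/IH; exists u'.
have phiu : phi u' = u by rewrite phix /u' p0K' !mulgA mulgV mul1g mulgK.
by apply/funext => x; rewrite /= /twisted_aut !phiM (homV phiM) phiu iterS.
Qed.

Theorem theorem7 (R : realType) (G : groupType)
    (G_GBS : GBS_group G) (G_nonsolvable : non_solvable_GBS G)
    (Phi : set (G -> G)) (Phi_out : outer_class Phi)
    (T : gTree R G) (T_D : in_D T)
    (f : T -> T) (f_tt : train_track_representative Phi f)
    (* the tree and base point used to define pseudo-periodic subgroups *)
    (T0 : gTree R G) (T0_D : in_D T0) (pt : T0) :
  (forall (k : nat) (psi : G -> G),
     (1 <= k)%N -> outer_pow Phi k psi ->
     (exists g, pseudo_periodic pt psi g /\ loxodromic R g) ->
     exists x0 x1 : T, pINP f x0 x1 /\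
       pseudo_periodic pt psi `<=` set_stabilizer (Nielsen_class f x0))
  /\
  (forall x0 x1 : T, pINP f x0 x1 ->
     (exists g, set_stabilizer (Nielsen_class f x0) g /\ loxodromic R g) ->
     exists (k : nat) (psi : G -> G),
       [/\ (1 <= k)%N, outer_pow Phi k psi
         & set_stabilizer (Nielsen_class f x0) = pseudo_periodic pt psi]).
Proof.
have [[[lam [n [e [A [lam1 fU [eE eO] _ _]]]]] fE] [phi [Pphi fphi]]] := f_tt.
have phiA : automorphism phi.
  move: Phi_out Pphi => [phi0 [p0A ->]] [_ [a ->] <-].
  exact: automorphism_comp (automorphism_conj a) p0A.
have eC : edge_cover e.
  by split=> // u v /eO[i [oi _]]; exists i.
have [u0 [v0 e0]] : exists u v : T, edge (@gt_vert R G T) u v.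
  by apply: (exists_edge_of_not_Z T_D); case: G_nonsolvable.
have T_act := in_D_action T_D; have [base _] := exists_vertex T_D.
have ellP (T' : gTree R G) g : in_D T' -> elliptic T' g <-> commensurated g.
  exact: (elliptic_commensuratedP T_D phiA fphi lam1 fU fE eC).
have loxP g : loxodromic R g <-> ~ elliptic T g.
  exact: (loxodromicP T_D phiA fphi lam1 fU fE eC).
have ell0 g : elliptic T g -> elliptic T0 g by move=> /(ellP _ _ T_D)/(ellP _ _ T0_D).
have ell1 g : elliptic T0 g -> elliptic T g by move=> /(ellP _ _ T0_D)/(ellP _ _ T_D).
(* Cocompactness is not a clause of [in_D]; T0 inherits it from T through an equivariant map. *)
have [n0 [e1 eC1]] : exists (n0 : nat) (e1 : 'I_n0 -> T0 * T0), edge_cover e1.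
  have [tau [K [_ Vtau tauE _]]] :=
    equivariant_map T_D T0_D (alpha := id) (fun _ _ => erefl) ell0 eC.
  exact: (edge_cover_image T_D T0_D eC e0 Vtau tauE).
have ppP (p : T) psi g : pseudo_periodic pt psi g <->
    exists M : R, forall i, mdist p (gt_act (iter i psi g) p) <= M.
  split=> [[M hM]|[M hM]].
    have [K [C [K0 h]]] := orbit_bound pt p T0_D T_D eC1 ell1.
    exists (K * M + C) => i; apply: le_trans (h _) _.
    by rewrite lerD2r ler_pM2l.
  have [K [C [K0 h]]] := orbit_bound p pt T_D T0_D eC ell0.
  exists (K * M + C) => i; apply: le_trans (h _) _.
  by rewrite lerD2r ler_pM2l.
have bounded_in_class := boundedly_close_Nielsen_class T_D phiA fphi lam1 fU fE eC.
have stabP := Nielsen_class_stabilizerP T_D fphi.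
split=> [k psi k1 /(outer_powP _ _ Phi_out Pphi)[u ->] [g0 [/(ppP base)[M hM] /loxP ng0]]|].
  have [x [[m [h [m0 hx]]] [a [b hab]]]] :=
    tracking_periodic_point T_D phiA fphi lam1 fU fE eC k1 ng0 hM.
  have close g : pseudo_periodic pt (twisted_aut phi u k) g ->
      boundedly_close f x (gt_act g x).
    move=> /(ppP base)[M' hM']; apply: (linearly_close_boundedly T_D phiA fphi lam1 fU fE eC).
    apply: (twisted_linearly_close T_D fphi lam1 fU (u := u) k1).
    (* The path z, base, t base, t z has outer legs of length at most a i + b and a middle leg of
       length at most M'. *)
    exists (2 * a), (2 * b + M') => i.
    rewrite (twisted_map_iter_act T_D fphi); set z := iter i _ x; set t := iter i _ g.
    have := metric_triangle z base (gt_act t z).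
    have := metric_triangle base (gt_act t base) (gt_act t z).
    rewrite act_isom // (metric_sym z base); have := hab i; have := hM' i; rewrite -/z -/t.
    by lra.
  have lx : loxodromic_class f x.
    apply: (loxodromic_classI T_D phiA fphi lam1 fU fE eC m0 hx ng0).
    by apply: close; apply/(ppP base); exists M.
  have [_ [g1 [ng1 xg1]]] := lx.
  (* The loxodromic g1 does not fix x, so the chain of pINPs from x to g1 x is nonempty and its
     first member starts at x. *)
  have [x1 xx1] : exists x1, pINP f x x1.
    have : x = gt_act g1 x \/ exists x1, pINP f x x1.
      by move: (x) (gt_act g1 x) xg1; apply: Nielsen_class_ind => [|y z]; [left|right; exists z].
    by case=> // xg1x; case: ng1; exists x.
  exists x, x1; split=> // g /close xg; apply/stabP.
  exact: bounded_in_class.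
move=> x0 x1 x01 [g [/stabP x0g /loxP ng]].
have [/(periodic_NielsenP T_D)[_ [m [h [m0 hx _]]]] _] := x01.
have lx : loxodromic_class f x0 by split; [exists m, h|exists g].
exists m, (twisted_aut phi h^-1%g m); split=> //.
  by apply/(outer_powP _ _ Phi_out Pphi); exists h^-1%g.
(* The twisted map fixes x0, so psi^i(a) x0 is the i-th image of a x0, and its distance to x0 is
   that between f^(m i)(x0) and f^(m i)(a x0). *)
have fixed i := iter_fixed i (twisted_fixed T_D hx).
apply/seteqP; split=> [a /stabP xa|a].
  have [M hM] := Nielsen_class_boundedly_close T_D fphi xa.
  apply/(ppP x0); exists M => i.
  rewrite -{2}(fixed i) -(twisted_map_iter_act T_D fphi) -{1}(fixed i).
  by rewrite (twisted_map_mdist T_D fphi).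
move=> /(ppP x0)[M hM]; apply/stabP; apply: bounded_in_class => //.
apply: (linearly_close_boundedly T_D phiA fphi lam1 fU fE eC).
apply: (twisted_linearly_close T_D fphi lam1 fU (u := h^-1%g) m0).
exists 0, M => i; rewrite mul0r add0r.
by rewrite (twisted_map_iter_act T_D fphi) !fixed.
Qed.
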